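(* Let $u\in L^\infty(\mathbb R_+,\mathbb R_+)\cap L^1(\mathbb R_+,\mathbb R_+)$ with $F(0;u)>0$ and $R(u)<\infty$. Then there exists a unique function $S_t(u)(r)$, continuous in $(r,t)$ for $t>0$, such that for all $t>0$ and $r\in\mathbb R_+$: $$F(r;S_t(u))=\lim_{\ell\to\infty}F\big(r;S_t^{(2^{-\ell}t,\pm)}(u)\big)\quad\text{monotonically (for each choice of sign)},$$ $$F(r;S_t(u))=\inf_{\delta:\,t=k\delta,\,k\in\mathbb N}F\big(r;S_t^{(\delta,+)}(u)\big)=\sup_{\delta:\,t=k\delta,\,k\in\mathbb N}F\big(r;S_t^{(\delta,-)}(u)\big),$$ where only those $\delta>0$ for which the barriers are defined, i.e. $j\delta<F(0;u)$, are considered. Moreover $S_t(u)\to u$ weakly as $t\to0$, and if $v$ satisfies the same hypotheses as $u$ and $u\le v$, then $S_t(u)\le S_t(v)$.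
   Context: Fix a parameter $j>0$; $\mathbb R_+=[0,\infty)$. The space $\mathcal U$ consists of the positive Borel measures on $\mathbb R_+$ of the form $u=c_uD_0+\rho_u\,dr$ with $c_u\ge0$, $D_0$ the Dirac delta at $0$, and $\rho_u\in L^\infty(\mathbb R_+,\mathbb R_+)\cap L^1(\mathbb R_+,\mathbb R_+)$; a function in $L^\infty\cap L^1$ is identified with the element having $c_u=0$. For $u\in\mathcal U$, $F(r;u)=c_u\mathbf 1_{\{0\}}(r)+\int_r^\infty\rho_u(r')\,dr'$, so $F(0;u)$ is the total mass. $R(u):=\inf\{r:F(r;u)=0\}$. For $\delta\ge0$, $\mathcal U_\delta:=\{u\in\mathcal U:F(0;\rho_u)>j\delta\}$. Order: for $u,v\in\mathcal U$, $u\le v$ means $F(r;u)\le F(r;v)$ for all $r\ge0$. Cut-and-paste operator $K^{(\delta)}:\mathcal U_\delta\to\mathcal U$: $K^{(\delta)}u=j\delta D_0+\mathbf 1_{[0,R_\delta(u)]}u$, $R_\delta(u):=\inf\{r:F(r;u)=j\delta\}$. Free evolution: $G_t^{\rm neum}(r,r')=G_t(r,r')+G_t(r,-r')$, $G_t(r,r')=\frac{e^{-(r-r')^2/(2t)}}{\sqrt{2\pi t}}$, and $G_t^{\rm neum}*u(r)=\int_{\mathbb R_+}G_t^{\rm neum}(r,r')\,u(dr')$ for $u\in\mathcal U$. Barriers: for $u\in L^\infty(\mathbb R_+,\mathbb R_+)\cap L^1(\mathbb R_+,\mathbb R_+)$ and $\delta>0$ with $j\delta<F(0;u)$, set $S_0^{(\delta,\pm)}(u)=u$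 and, for $k\ge1$, $S^{(\delta,-)}_{k\delta}(u)=K^{(\delta)}\big(G_\delta^{\rm neum}*S^{(\delta,-)}_{(k-1)\delta}(u)\big)$, $S^{(\delta,+)}_{k\delta}(u)=G_\delta^{\rm neum}*\big(K^{(\delta)}S^{(\delta,+)}_{(k-1)\delta}(u)\big)$. Weak convergence is weak convergence of the measures $S_t(u)(r)\,dr$ on $\mathbb R_+$. *)

(* Defs.v *)
From mathcomp Require Import all_boot all_order all_algebra.
From mathcomp Require Import all_classical all_reals all_analysis.

Set Implicit Arguments.
Unset Strict Implicit.
Unset Printing Implicit Defensive.
Import Order.TTheory GRing.Theory Num.Theory.
Import numFieldTopology.Exports numFieldNormedType.Exports.

Local Open Scope classical_set_scope.
Local Open Scope ring_scope.

Definition Rplus (R : realType) : set R := `[0, +oo[.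
Arguments Rplus {R}.

(* A density on R_+ is a function R -> R whose values at negative arguments are
   never used; [patch] ([\_]) replaces them by 0. *)
Definition nonneg_Linf_L1 (R : realType) (rho : R -> R) : Prop :=
  [/\ forall r, 0 <= r -> 0 <= rho r,
      (rho \_ Rplus) \in Lfun (@lebesgue_measure R) +oo%E
    & (rho \_ Rplus) \in Lfun (@lebesgue_measure R) 1%E].

(* [Umeas c rho] stands for the measure  c D_0 + rho(r) dr  on R_+. *)
Record umeas (R : realType) := Umeas { atom : R ; dens : R -> R }.

Definition in_U (R : realType) (u : umeas R) : Prop :=
  0 <= atom u /\ nonneg_Linf_L1 (dens u).

Definition of_dens (R : realType) (rho : R -> R) : umeas R := Umeas 0 rho.

Definition umeas_int (R : realType) (u : umeas R) (f : R -> R) : R :=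
  atom u * f 0 + \int[@lebesgue_measure R]_(x in Rplus) (f x * dens u x).

Definition F (R : realType) (r : R) (u : umeas R) : R :=
  atom u * (r == 0)%:R + \int[@lebesgue_measure R]_(x in `[r, +oo[) dens u x.

Definition U_le (R : realType) (u v : umeas R) : Prop :=
  forall r, 0 <= r -> F r u <= F r v.

(* The infimum is taken in the extended reals, so that it is +oo when the level
   [a] is not attained. *)
Definition first_at_level (R : realType) (a : R) (u : umeas R) : \bar R :=
  ereal_inf [set r%:E | r in [set r : R | 0 <= r /\ F r u = a]].

Definition edge (R : realType) (u : umeas R) : \bar R := first_at_level 0 u.

Definition in_U_delta (R : realType) (j delta : R) (u : umeas R) : Prop :=
  in_U u /\ j * delta < F 0 (of_dens (dens u)).

(* Total on [umeas], but meaningful only when [in_U_delta j delta u]. The atom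
   of [u] is kept by the cut because 0 always belongs to [0, R_delta(u)]. *)
Definition cut_paste (R : realType) (j delta : R) (u : umeas R) : umeas R :=
  Umeas (j * delta + atom u)
    (fun r => if (r%:E <= first_at_level (j * delta) u)%E then dens u r else 0).

Definition G (R : realType) (t r r' : R) : R :=
  expR (- ((r - r') ^+ 2 / (2 * t))) / Num.sqrt (2 * pi * t).

Definition Gneum (R : realType) (t r r' : R) : R := G t r r' + G t r (- r').

Definition free_evol (R : realType) (t : R) (u : umeas R) : umeas R :=
  of_dens (fun r => umeas_int u (Gneum t r)).

(* [barrier_minus j delta u k] is the lower barrier started from [u] at time
   k * delta, and likewise for [barrier_plus]; they are meaningful only when
   j * delta < F 0 u. *)
Fixpoint barrier_minus (R : realType) (j delta : R) (u : umeas R) (k : nat) :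
    umeas R :=
  if k is k'.+1 then
    cut_paste j delta (free_evol delta (barrier_minus j delta u k'))
  else u.

Fixpoint barrier_plus (R : realType) (j delta : R) (u : umeas R) (k : nat) :
    umeas R :=
  if k is k'.+1 then
    free_evol delta (cut_paste j delta (barrier_plus j delta u k'))
  else u.

Definition initial_datum (R : realType) (rho : R -> R) : Prop :=
  [/\ nonneg_Linf_L1 rho, 0 < F 0 (of_dens rho)
    & (edge (of_dens rho) < +oo)%E].

(* Monotone convergence along the steps t / 2 ^ l; the monotonicity only
   concerns those l for which the barriers are defined. *)
Definition dyadic_limit (R : realType) (j : R) (rho : R -> R) (t r a : R) :
    Prop :=
  let u := of_dens rho in
  let Fplus l := F r (barrier_plus j (t / 2 ^+ l) u (2 ^ l)) in
  let Fminus l := F r (barrier_minus j (t / 2 ^+ l) u (2 ^ l)) in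
  [/\ Fplus l @[l --> \oo] --> a,
      Fminus l @[l --> \oo] --> a,
      forall l m : nat, (l <= m)%N -> j * (t / 2 ^+ l) < F 0 u ->
        Fplus m <= Fplus l
    & forall l m : nat, (l <= m)%N -> j * (t / 2 ^+ l) < F 0 u ->
        Fminus l <= Fminus m].

Definition admissible_step (R : realType) (j : R) (rho : R -> R) (t : R) :
    set (R * nat) :=
  [set dk | [/\ 0 < dk.1, t = dk.2%:R * dk.1 & j * dk.1 < F 0 (of_dens rho)]].

Definition inf_sup_barriers (R : realType) (j : R) (rho : R -> R) (t r a : R) :
    Prop :=
  let u := of_dens rho in
  a%:E = ereal_inf [set (F r (barrier_plus j dk.1 u dk.2))%:E
                   | dk in admissible_step j rho t] /\
  a%:E = ereal_sup [set (F r (barrier_minus j dk.1 u dk.2))%:E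
                   | dk in admissible_step j rho t].

(* [S t r] is S_t(u)(r); only its values for 0 < t and 0 <= r matter. *)
Definition separates_barriers (R : realType) (j : R) (rho : R -> R)
    (S : R -> R -> R) : Prop :=
  [/\ {within [set p : R * R | 0 <= p.1 /\ 0 < p.2],
        continuous (fun p : R * R => S p.2 p.1)},
      forall t, 0 < t -> nonneg_Linf_L1 (S t)
    & forall t r, 0 < t -> 0 <= r ->
        dyadic_limit j rho t r (F r (of_dens (S t))) /\
        inf_sup_barriers j rho t r (F r (of_dens (S t)))].

Definition bounded_continuous (R : realType) (f : R -> R) : Prop :=
  {within Rplus, continuous f} /\
  exists M : R, forall r, 0 <= r -> `|f r| <= M.

Definition weakly_to_initial (R : realType) (S : R -> R -> R) (rho : R -> R) :
    Prop :=
  forall f : R -> R, bounded_continuous f ->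
    umeas_int (of_dens (S t)) f @[t --> 0^'+] --> umeas_int (of_dens rho) f.

(* Main.v *)
(** Everything is read off the tail [phi r = F r u].  Reflecting [phi] through the
    point [(0, phi 0)] turns the Neumann evolution of a measure into the heat flow
    on the line, and cut-and-paste replaces [phi r] by [max (phi r - j delta) 0]
    for [r > 0].  Cutting after a diffusion leaves less than cutting before it, so
    coarsening a subdivision of [0, t] raises the upper barrier and lowers the
    lower one, every lower barrier lies below every upper one, and for steps
    [delta] the two differ by at most [j delta].  Hence all barriers converge to
    one limit [E t], which satisfies [|E (t + h) - heat_h E t| <= j h].
    Comparing [E t] with [heat_s (E (t - s))] at the scales [s = 4^-k] gives
    derivatives that differ by [O(2^-k)], so [E t] has a density jointly continuous
    in [(r, t)], which is [S_t(u)]. *)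
Require Import Defs.
From mathcomp Require Import all_boot all_order all_algebra.
From mathcomp Require Import all_classical all_reals all_analysis.
From mathcomp Require Import measurable_realfun ess_sup_inf zify ring lra.
Import Order.TTheory GRing.Theory Num.Theory.
Import numFieldTopology.Exports numFieldNormedType.Exports.
Local Open Scope classical_set_scope.
Local Open Scope ring_scope.

Set Implicit Arguments.
Unset Strict Implicit.
Unset Printing Implicit Defensive.

(** * Heat kernel and heat flow on the line *)

(** The cut radius depends on the measure that is cut, so barriers are hard to compare as densities;
    on tails the cut is one pointwise truncation, the same for all data, and successive cuts add up.
    The reflected extension does not preserve order on the negative half-line, so monotonicity of
    the diffusion needs an argument of its own ([heatF_mono]); it is stated with an additive slack
    [c], which also yields the one-step estimates. The gap between the barriers stays at a single
    cut, whatever the number of steps, because cutting the upper barrier gives the lower barrier of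
    the cut datum. The limit is known only as an infimum of tails, with no equation to
    differentiate. It has a derivative because an error [j s], convolved with a kernel derivative of
    [L^1] norm of order [s ^ (-1/2)], leaves [O(s ^ (1/2))], which is summable along a geometric
    sequence of [s]. Identities between derivatives are proved for integrals over intervals and then
    localised by continuity. *)

Section reflection.
Context {R : realType}.
Local Notation mu := (@lebesgue_measure R).
Implicit Types (f g : R -> R) (a x y t : R).

Lemma measurable_reflect a : measurable_fun setT (fun y : R => a - y).
Proof. exact: measurable_funB. Qed.

Lemma preimage_reflect a (p q : R) :
  (fun y : R => a - y) @^-1` `]p, q] = `[a - q, a - p[%classic.
Proof.
by apply/seteqP; split=> y /=; rewrite !in_itv/= => /andP[? ?]; apply/andP; split; lra.
Qed.

(** Lebesgue measure is determined by half-open intervals; the reflection moves the closed end to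
    the other side, which leaves the length unchanged. *)
Lemma lebesgue_measure_reflect a (A : set R) : measurable A ->
  pushforward mu (fun y : R => (a - y : measurableTypeR R)) A = mu A.
Proof.
move=> mA; apply/esym/lebesgue_measure_unique => //=.
  exact: measurable_reflect.
move=> mr _ [[p q]] _ <-.
rewrite /pushforward preimage_reflect !lebesgue_measure_itv/= !lte_fin.
by rewrite ltrD2l ltrN2; case: ifP => // _; congr EFin; ring.
Qed.

Lemma ge0_integral_reflect a (f : R -> \bar R) : measurable_fun setT f ->
  (forall x, 0 <= f x)%E -> (\int[mu]_x f (a - x)%R = \int[mu]_x f x)%E.
Proof.
move=> mf f0.
transitivity (\int[pushforward mu (fun y : R => ((a - y)%R : measurableTypeR R))]_y f y)%E.
  by rewrite ge0_integral_pushforward//; exact: measurable_reflect.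
apply: eq_measure_integral.
  exact: measurable_reflect.
by move=> ? A mA _; exact: lebesgue_measure_reflect.
Qed.

Lemma integrable_reflect a (f : R -> R) : mu.-integrable setT (EFin \o f) ->
  mu.-integrable setT (EFin \o (fun x => f (a - x))).
Proof.
move=> /integrableP[/measurable_EFinP mf foo]; apply/integrableP; split.
  apply/measurable_EFinP; apply: measurableT_comp => //.
  exact: measurable_reflect.
rewrite (ge0_integral_reflect a (f := fun x => `|(f x)%:E|%E))//.
by apply/measurableT_comp => //; apply/measurable_EFinP.
Qed.

Lemma Rintegral_reflect a (f : R -> R) : mu.-integrable setT (EFin \o f) ->
  \int[mu]_x f (a - x) = \int[mu]_x f x.
Proof.
move=> fi; congr fine.
have mf : measurable_fun setT (EFin \o f) by exact: measurable_int fi.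
rewrite integralE [RHS]integralE; congr (_ - _)%E.
  etransitivity; last apply: (ge0_integral_reflect a (measurable_funepos mf)) => //.
  by apply: eq_integral => x _; rewrite funeposE [in RHS]funeposE.
etransitivity; last apply: (ge0_integral_reflect a (measurable_funeneg mf)) => //.
by apply: eq_integral => x _; rewrite funenegE [in RHS]funenegE.
Qed.
End reflection.

(** [G t r r'] as a function of [r - r'], so that the evolution is a convolution; it is the centred
    normal density of variance [t]. *)
Definition heat (R : realType) (t z : R) : R :=
  expR (- (z ^+ 2 / (2 * t))) / Num.sqrt (2 * pi * t).

Section heat_kernel.
Context {R : realType}.
Local Notation mu := (@lebesgue_measure R).
Implicit Types (x y z s t : R).

Lemma heat_normal_pdf t m x : 0 < t ->
  heat t (x - m) = normal_pdf m (Num.sqrt t) x.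
Proof.
move=> t0; rewrite normal_pdfE ?sqrtr_eq0 -?ltNge// /normal_peak /normal_fun /heat.
rewrite !sqr_sqrtr ?ltW// mulrC; congr (_^-1 * expR _).
  by congr Num.sqrt; rewrite -mulr_natl; ring.
by rewrite mulNr mulr_natl.
Qed.

Lemma heat_normal_pdf0 t : 0 < t -> heat t = normal_pdf 0 (Num.sqrt t).
Proof. by move=> t0; apply/funext => x; rewrite -heat_normal_pdf// subr0. Qed.

Lemma heat_ge0 t z : 0 <= heat t z.
Proof. by rewrite /heat mulr_ge0 ?expR_ge0// invr_ge0 sqrtr_ge0. Qed.

Lemma heatN t z : heat t (- z) = heat t z.
Proof. by rewrite /heat sqrrN. Qed.

Lemma heat_distC t x y : heat t (x - y) = heat t (y - x).
Proof. by rewrite -heatN opprB. Qed.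

Lemma heat_anti t z z' : 0 < t -> `|z| <= `|z'| -> heat t z' <= heat t z.
Proof.
move=> t0 zz'; rewrite /heat ler_wpM2r ?invr_ge0 ?sqrtr_ge0// ler_expR lerN2.
apply: ler_wpM2r; first by rewrite invr_ge0 mulr_ge0// ltW.
by rewrite -[z ^+ 2]real_normK ?num_real// -[z' ^+ 2]real_normK ?num_real// lerXn2r ?nnegrE.
Qed.

Lemma measurable_heat t : measurable_fun setT (heat t).
Proof.
apply: measurable_funM => //; apply: measurableT_comp => //.
apply: measurableT_comp => //; apply: measurable_funM => //.
Qed.

Lemma integral_heat t x : 0 < t -> (\int[mu]_y (heat t (y - x))%:E = 1)%E.
Proof.
move=> t0; under eq_integral do rewrite heat_normal_pdf//.
exact: integral_normal_pdf.
Qed.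

Lemma integrable_heat t : 0 < t -> mu.-integrable setT (EFin \o heat t).
Proof. by move=> t0; rewrite heat_normal_pdf0//; exact: integrable_normal_pdf. Qed.

Lemma Rintegral_heat t : 0 < t -> \int[mu]_y heat t y = 1.
Proof.
move=> t0; rewrite /Rintegral -[RHS]/(fine 1%E) -(integral_heat 0 t0).
by congr fine; apply: eq_integral => x _; rewrite subr0.
Qed.

(** Completing the square in [y]: the product is a Gaussian in [y], of variance [s t / (s + t)]
    about a weighted mean, times a factor free of [y]. Integration in [y] leaves that factor, which
    is the semigroup law [heat_conv]. *)
Lemma heat_mul s t x z y : 0 < s -> 0 < t ->
  heat s (x - y) * heat t (y - z) =
  heat (s + t) (x - z) * heat (s * t / (s + t)) (y - (t * x + s * z) / (s + t)).
Proof.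
move=> s0 t0; have st0 : 0 < s + t by rewrite addr_gt0.
have pi0 := @pi_gt0 R.
rewrite /heat !mulf_div -!expRD -!sqrtrM ?mulr_ge0 ?ltW//; congr (expR _ / Num.sqrt _).
  by field; rewrite !gt_eqF.
by field; rewrite !gt_eqF.
Qed.

Lemma heat_conv s t x z : 0 < s -> 0 < t ->
  (\int[mu]_y (heat s (x - y) * heat t (y - z))%:E = (heat (s + t) (x - z))%:E)%E.
Proof.
move=> s0 t0; have st0 : 0 < s + t by rewrite addr_gt0.
under eq_integral do rewrite heat_mul// EFinM.
rewrite ge0_integralZl ?lee_fin ?heat_ge0//=.
- by rewrite integral_heat ?mule1// divr_gt0 ?mulr_gt0.
- apply/measurable_EFinP/measurableT_comp; first exact: measurable_heat.
  exact: measurable_funB.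
- by move=> y _; rewrite lee_fin heat_ge0.
Qed.

Definition dheat t z : R := - (z / t) * heat t z.

Lemma measurable_dheat t : measurable_fun setT (dheat t).
Proof.
apply: measurable_funM; last exact: measurable_heat.
by apply: measurableT_comp => //; exact: measurable_funM.
Qed.

(** Half of the Gaussian exponent absorbs the factor [|z|], the other half is the kernel at time
    [2 t]. The bound is a multiple of a probability density, so it integrates at once, both for the
    first moment and for [dheat]. *)
Lemma abs_heat_le t z : 0 < t -> `|z| * heat t z <= Num.sqrt (2 * t) * heat (2 * t) z.
Proof.
move=> t0; have pi0 := @pi_gt0 R; set a := `|z|.
have a0 : 0 <= a by exact: normr_ge0.
have st : 0 < Num.sqrt t by rewrite sqrtr_gt0.
have s20 : 0 < Num.sqrt 2 :> R by rewrite sqrtr_gt0.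
have sp : 0 < Num.sqrt (2 * pi * t) by rewrite sqrtr_gt0 !mulr_gt0.
set e := expR (- (z ^+ 2 / (4 * t))).
have e0 : 0 < e by exact: expR_gt0.
have -> : heat t z = e * e / Num.sqrt (2 * pi * t).
  by rewrite /heat /e -expRD; congr (expR _ / _); field; rewrite gt_eqF.
have -> : heat (2 * t) z = e / (Num.sqrt 2 * Num.sqrt (2 * pi * t)).
  rewrite /heat /e -sqrtrM//; congr (expR _ / Num.sqrt _); last by ring.
  by field; rewrite gt_eqF.
rewrite [Num.sqrt (2 * t)]sqrtrM//.
have ae : a * e <= Num.sqrt t.
  have zE : z ^+ 2 = (a / Num.sqrt t) ^+ 2 * t.
    by rewrite expr_div_n sqr_sqrtr ?ltW// divfK ?gt_eqF// real_normK ?num_real.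
  have : a / Num.sqrt t <= expR (z ^+ 2 / (4 * t)).
    apply: le_trans (expR_ge1Dx _); rewrite zE.
    have -> : (a / Num.sqrt t) ^+ 2 * t / (4 * t) = (a / Num.sqrt t) ^+ 2 / 4.
      by field; rewrite !gt_eqF.
    (* [w <= 1 + w ^ 2 / 4] is [(w / 2 - 1) ^ 2 >= 0]. *)
    set w := a / _; have := sqr_ge0 (w / 2 - 1); lra.
  rewrite ler_pdivrMr// => h.
  by rewrite /e expRN ler_pdivrMr ?expR_gt0// mulrC.
have -> : Num.sqrt 2 * Num.sqrt t * (e / (Num.sqrt 2 * Num.sqrt (2 * pi * t))) = Num.sqrt t * (e / Num.sqrt (2 * pi * t)).
  by field; rewrite !gt_eqF.
have -> : a * (e * e / Num.sqrt (2 * pi * t)) = a * e * (e / Num.sqrt (2 * pi * t)) by ring.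
by rewrite ler_wpM2r// divr_ge0// ltW.
Qed.

Lemma dheat_le t z : 0 < t -> `|dheat t z| <= Num.sqrt (2 / t) * heat (2 * t) z.
Proof.
move=> t0; rewrite /dheat normrM normrN normrM [`|t^-1|]gtr0_norm ?invr_gt0// (ger0_norm (heat_ge0 _ _)).
have := abs_heat_le z t0.
rewrite -(@ler_pM2l _ t^-1) ?invr_gt0// mulrA [t^-1 * _]mulrC => /le_trans; apply.
rewrite mulrA ler_wpM2r ?heat_ge0//.
have -> : 2 / t = (2 * t) / t ^+ 2 by field; rewrite gt_eqF.
rewrite [leRHS]sqrtrM; last by rewrite mulr_ge0// ltW.
by rewrite sqrtrV ?sqr_ge0// sqrtr_sqr gtr0_norm// mulrC.
Qed.

Lemma integrable_dheat t : 0 < t -> mu.-integrable setT (EFin \o dheat t).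
Proof.
move=> t0; have t20 : 0 < 2 * t by rewrite mulr_gt0.
apply: (@le_integrable _ _ _ mu setT _ _ (fun x => (Num.sqrt (2 / t))%:E * (heat (2 * t) x)%:E)%E) => //.
- by apply/measurable_EFinP; exact: measurable_dheat.
- move=> x _ /=; rewrite lee_fin [leRHS]ger0_norm ?mulr_ge0 ?heat_ge0 ?sqrtr_ge0//.
  exact: dheat_le.
- by apply: integrableZl => //; exact: integrable_heat.
Qed.

(** The smoothing rate [t ^ (-1/2)] behind all estimates on derivatives below. *)
Lemma Rintegral_abs_dheat t : 0 < t -> \int[mu]_y `|dheat t y| <= Num.sqrt (2 / t).
Proof.
move=> t0; have t20 : 0 < 2 * t by rewrite mulr_gt0.
have -> : Num.sqrt (2 / t) = \int[mu]_y (Num.sqrt (2 / t) * heat (2 * t) y).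
  by rewrite RintegralZl ?Rintegral_heat ?mulr1//; exact: integrable_heat.
apply: le_Rintegral => //.
- exact: (integrable_norm (integrable_dheat t0)).
- have := integrableZl measurableT (Num.sqrt (2 / t)) (integrable_heat t20); apply: eq_integrable => //.
- by move=> y _; exact: dheat_le.
Qed.

Lemma integrable_abs_heat t : 0 < t -> mu.-integrable setT (EFin \o (fun y => `|y| * heat t y)).
Proof.
move=> t0; have t20 : 0 < 2 * t by rewrite mulr_gt0.
apply: (@le_integrable _ _ _ mu setT _ _ (fun x => (Num.sqrt (2 * t))%:E * (heat (2 * t) x)%:E)%E) => //.
- by apply/measurable_EFinP; apply: measurable_funM; [exact: normr_measurable|exact: measurable_heat].
- move=> x _ /=; rewrite lee_fin ger0_norm ?mulr_ge0 ?heat_ge0//.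
  by rewrite [leRHS]ger0_norm ?mulr_ge0 ?heat_ge0 ?sqrtr_ge0//; exact: abs_heat_le.
- by apply: integrableZl => //; exact: integrable_heat.
Qed.

Lemma Rintegral_abs_heat t : 0 < t -> \int[mu]_y (`|y| * heat t y) <= Num.sqrt (2 * t).
Proof.
move=> t0; have t20 : 0 < 2 * t by rewrite mulr_gt0.
have -> : Num.sqrt (2 * t) = \int[mu]_y (Num.sqrt (2 * t) * heat (2 * t) y).
  by rewrite RintegralZl ?Rintegral_heat ?mulr1//; exact: integrable_heat.
apply: le_Rintegral => //.
- exact: integrable_abs_heat.
- have := integrableZl measurableT (Num.sqrt (2 * t)) (integrable_heat t20); apply: eq_integrable => //.
- by move=> y _; exact: abs_heat_le.
Qed.

Lemma is_derive_heat t z : 0 < t -> is_derive z 1 (heat t) (dheat t z).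
Proof.
move=> t0.
have -> : heat t = (fun z => expR (- ((2 * t)^-1 * z ^+ 2)) * (Num.sqrt (2 * pi * t))^-1).
  by apply/funext => w; rewrite /heat [_^-1 * _]mulrC.
apply: is_derive_eq; rewrite /dheat /heat /GRing.scale/=.
have sp : 0 < Num.sqrt (2 * pi * t) by rewrite sqrtr_gt0 !mulr_gt0// pi_gt0.
have -> : z ^+ 2 / (2 * t) = (2 * t)^-1 * z ^+ 2 by rewrite mulrC.
set e := expR _; set s := Num.sqrt _ in sp *.
by field; rewrite !gt_eqF.
Qed.

Lemma continuous_heat t : 0 < t -> continuous (heat t).
Proof. by move=> t0; rewrite heat_normal_pdf0//; apply: continuous_normal_pdf; rewrite sqrtr_eq0 -ltNge. Qed.

Lemma continuous_dheat t : 0 < t -> continuous (dheat t).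
Proof.
move=> t0 x; apply: cvgM; last exact: continuous_heat.
apply: cvgN; apply: cvgM; first exact: cvg_id.
exact: cvg_cst.
Qed.

Lemma integral_dheat t a b y : 0 < t -> a < b ->
  (\int[mu]_(x in `[a, b]) (dheat t (x - y))%:E = (heat t (b - y) - heat t (a - y))%:E)%E.
Proof.
move=> t0 ab.
have D x : is_derive x 1 (fun x => heat t (x - y)) (dheat t (x - y)).
  have Dh := is_derive_heat (x - y) t0.
  have Db : is_derive x 1 (fun x : R => x - y) (1 - 0) by apply: is_deriveB.
  by have := @is_derive1_comp _ (heat t) (fun x => x - y) x _ _ Dh Db; rewrite subr0 mulr1.
have C : continuous (fun x => heat t (x - y)).
  move=> x; apply: (@continuous_comp _ _ _ (fun x => x - y) (heat t)); last exact: continuous_heat.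
  by apply: cvgB; [exact: cvg_id|exact: cvg_cst].
rewrite (continuous_FTC2 ab (F := fun x => heat t (x - y))) ?EFinB//.
- apply: continuous_subspaceT => x.
  apply: (@continuous_comp _ _ _ (fun x => x - y) (dheat t)); last exact: continuous_dheat.
  by apply: cvgB; [exact: cvg_id|exact: cvg_cst].
- split.
  + by move=> x _; exact: ex_derive.
  + by apply: cvg_at_right_filter; exact: C.
  + by apply: cvg_at_left_filter; exact: C.
- by move=> x _; rewrite derive1E derive_val.
Qed.

End heat_kernel.

(** * Convolution of an integrable kernel with a bounded function *)

Definition bounded_measurable (R : realType) (M : R) (f : R -> R) : Prop :=
  measurable_fun setT f /\ forall x, `|f x| <= M.

Definition conv (R : realType) (k f : R -> R) (x : R) : R :=
  \int[@lebesgue_measure R]_y (k (x - y) * f y).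

Section convolution.
Context {R : realType}.
Local Notation mu := (@lebesgue_measure R).
Implicit Types (f g k : R -> R) (x y M L : R).

Lemma bounded_measurable_reflect M f a : bounded_measurable M f ->
  bounded_measurable M (fun y => f (a - y)).
Proof.
move=> [mf bf]; split=> //; apply: measurableT_comp => //.
exact: measurable_reflect.
Qed.

Lemma bounded_measurableB M M' f g : bounded_measurable M f ->
  bounded_measurable M' g -> bounded_measurable (M + M') (fun y => f y - g y).
Proof.
move=> [mf bf] [mg bg]; split=> [|x]; first exact: measurable_funB.
by rewrite (le_trans (ler_normB _ _))// lerD.
Qed.

Lemma bounded_measurable_cst (c : R) : bounded_measurable `|c| (fun=> c).
Proof. by split. Qed.

Lemma integrable_cstl (D : set (measurableTypeR R)) c f : measurable D ->
  mu.-integrable D (EFin \o f) -> mu.-integrable D (EFin \o (fun y => c * f y)).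
Proof. by move=> mD fi; have := integrableZl mD c fi; exact: eq_integrable. Qed.

Lemma integrable_diff (D : set (measurableTypeR R)) f g : measurable D ->
  mu.-integrable D (EFin \o f) -> mu.-integrable D (EFin \o g) ->
  mu.-integrable D (EFin \o (fun y => f y - g y)).
Proof. by move=> mD fi gi; have := integrableB mD fi gi; exact: eq_integrable. Qed.

Lemma lebesgue_tonelli (h : R * R -> \bar R) : measurable_fun setT h ->
  (forall p, 0 <= h p)%E ->
  (\int[mu]_x \int[mu]_y h (x, y) = \int[mu]_y \int[mu]_x h (x, y))%E.
Proof. by move=> mh h0; exact: (fubini_tonelli (m1 := mu) (m2 := mu) h mh h0). Qed.

Lemma lebesgue_fubini (h : R * R -> \bar R) : measurable_fun setT h ->
  (\int[mu]_x \int[mu]_y `|h (x, y)| < +oo)%E ->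
  (\int[mu]_x \int[mu]_y h (x, y) = \int[mu]_y \int[mu]_x h (x, y))%E.
Proof.
move=> mh hoo; apply: (@Fubini _ _ _ _ _ mu mu).
by apply/(@integrable12ltyP _ _ _ _ _ mu mu).
Qed.

Lemma integrable_mul_bounded M k f : mu.-integrable setT (EFin \o k) ->
  bounded_measurable M f -> mu.-integrable setT (EFin \o (fun y => k y * f y)).
Proof.
move=> ik [mf bf].
have mk : measurable_fun setT k by apply/measurable_EFinP; exact: measurable_int ik.
apply: (@le_integrable _ _ _ mu setT _ _ (fun x => M%:E * (k x)%:E)%E) => //.
- by apply/measurable_EFinP; exact: measurable_funM.
- move=> x _ /=; rewrite lee_fin !normrM mulrC ler_wpM2r//.
  by rewrite (le_trans (bf x))// ler_norm.
- exact: integrableZl.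
Qed.

Lemma integrable_conv M k f x : mu.-integrable setT (EFin \o k) ->
  bounded_measurable M f ->
  mu.-integrable setT (EFin \o (fun y => k (x - y) * f y)).
Proof. by move=> ik; apply: integrable_mul_bounded; exact: integrable_reflect. Qed.

(** Puts the dependence on [x] into the bounded factor, so that bounds, monotonicity and Lipschitz
    constants of [f] pass to the convolution. *)
Lemma conv_swap M k f x : mu.-integrable setT (EFin \o k) ->
  bounded_measurable M f -> conv k f x = \int[mu]_z (k z * f (x - z)).
Proof.
move=> ik bf; rewrite /conv -(Rintegral_reflect x (integrable_conv x ik bf)).
by congr fine; apply: eq_integral => y _; rewrite subKr.
Qed.

Lemma le_norm_conv M k f x : mu.-integrable setT (EFin \o k) ->
  bounded_measurable M f -> `|conv k f x| <= M * \int[mu]_y `|k y|.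
Proof.
move=> ik bf; rewrite (conv_swap x ik bf).
have ikf : mu.-integrable setT (EFin \o (fun y => k y * f (x - y))).
  exact: (integrable_mul_bounded ik (bounded_measurable_reflect x bf)).
apply: (le_trans (le_normr_Rintegral measurableT ikf)).
rewrite -RintegralZl//; last exact: (integrable_norm ik).
apply: le_Rintegral => //.
- exact: (integrable_norm ikf).
- by apply: integrable_cstl => //; exact: (integrable_norm ik).
- by move=> y _; rewrite normrM mulrC ler_wpM2r//; case: bf.
Qed.

Lemma convB M M' k f g x : mu.-integrable setT (EFin \o k) ->
  bounded_measurable M f -> bounded_measurable M' g ->
  conv k (fun y => f y - g y) x = conv k f x - conv k g x.
Proof.
move=> ik bf bg; rewrite /conv -RintegralB//; [|exact: integrable_conv bf|exact: integrable_conv bg].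
by congr fine; apply: eq_integral => y _; rewrite mulrBr.
Qed.

Lemma conv_lipschitz M L k f x x' : mu.-integrable setT (EFin \o k) ->
  bounded_measurable M f -> (forall y y', `|f y - f y'| <= L * `|y - y'|) ->
  `|conv k f x - conv k f x'| <= L * `|x - x'| * \int[mu]_y `|k y|.
Proof.
move=> ik bf Lf; rewrite (conv_swap x ik bf) (conv_swap x' ik bf).
have ikf z : mu.-integrable setT (EFin \o (fun y => k y * f (z - y))).
  exact: (integrable_mul_bounded ik (bounded_measurable_reflect z bf)).
rewrite -RintegralB//.
have -> : \int[mu]_y (k y * f (x - y) - k y * f (x' - y)) =
          \int[mu]_y (k y * (f (x - y) - f (x' - y))).
  by congr fine; apply: eq_integral => y _; rewrite mulrBr.
have bd : bounded_measurable (L * `|x - x'|) (fun y => f (x - y) - f (x' - y)).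
  split; last by move=> y; rewrite (le_trans (Lf _ _))// (_ : x - y - _ = x - x')//; ring.
  by apply: measurable_funB; apply: (bounded_measurable_reflect _ bf).1.
have ikd := integrable_mul_bounded ik bd.
apply: (le_trans (le_normr_Rintegral measurableT ikd)).
rewrite -RintegralZl//; last exact: (integrable_norm ik).
apply: le_Rintegral => //.
- exact: (integrable_norm ikd).
- by apply: integrable_cstl => //; exact: (integrable_norm ik).
- by move=> y _; rewrite normrM mulrC ler_wpM2r//; case: bd.
Qed.

End convolution.

(** * Heat flow of bounded functions and its spatial derivative *)

Definition heat_flow (R : realType) (t : R) := conv (heat t).
Definition heat_slope (R : realType) (t : R) := conv (dheat t).

Section heat_flow.
Context {R : realType}.
Local Notation mu := (@lebesgue_measure R).
Implicit Types (f g : R -> R) (x y M L s t : R).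

Lemma heat_flow_cst t c x : 0 < t -> heat_flow t (fun=> c) x = c :> R.
Proof.
move=> t0; rewrite /heat_flow (conv_swap x (integrable_heat t0) (bounded_measurable_cst c)).
by rewrite RintegralZr ?Rintegral_heat ?mul1r//; exact: integrable_heat.
Qed.

Lemma heat_flow_le M M' t f g x : 0 < t -> bounded_measurable M f ->
  bounded_measurable M' g -> (forall y, f y <= g y) ->
  heat_flow t f x <= heat_flow t g x.
Proof.
move=> t0 bf bg fg; apply: le_Rintegral => //.
- exact: integrable_conv (integrable_heat t0) bf.
- exact: integrable_conv (integrable_heat t0) bg.
- by move=> y _; rewrite ler_wpM2l// heat_ge0.
Qed.

Lemma heat_flowB M M' t f g x : 0 < t -> bounded_measurable M f ->
  bounded_measurable M' g ->
  heat_flow t (fun y => f y - g y) x = heat_flow t f x - heat_flow t g x.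
Proof. by move=> t0; apply: convB; exact: integrable_heat. Qed.

Lemma heat_slopeB M M' t f g x : 0 < t -> bounded_measurable M f ->
  bounded_measurable M' g ->
  heat_slope t (fun y => f y - g y) x = heat_slope t f x - heat_slope t g x.
Proof. by move=> t0; apply: convB; exact: integrable_dheat. Qed.

Lemma heat_flow_reflect M t f x : 0 < t -> bounded_measurable M f ->
  heat_flow t (fun y => f (- y)) x = heat_flow t f (- x).
Proof.
move=> t0 bf.
have ik := integrable_conv (- x) (integrable_heat t0) bf.
rewrite [RHS]/heat_flow /conv -(Rintegral_reflect 0 ik).
congr fine; apply: eq_integral => y _.
by rewrite sub0r opprK -[in RHS]heatN opprD !opprK.
Qed.

Lemma heat_flow_anti M t f : 0 < t -> bounded_measurable M f ->
  {homo f : x y /~ x <= y} -> {homo heat_flow t f : x y /~ x <= y}.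
Proof.
move=> t0 bf fd x y yx; rewrite /heat_flow !(conv_swap _ (integrable_heat t0) bf).
have ikf z : mu.-integrable setT (EFin \o (fun y => heat t y * f (z - y))).
  exact: (integrable_mul_bounded (integrable_heat t0) (bounded_measurable_reflect z bf)).
apply: le_Rintegral => //.
by move=> z _; rewrite ler_wpM2l ?heat_ge0// fd// lerD2r.
Qed.

Lemma le_norm_heat_flow M t f x : 0 < t -> bounded_measurable M f ->
  `|heat_flow t f x| <= M.
Proof.
move=> t0 bf; rewrite (le_trans (le_norm_conv x (integrable_heat t0) bf))//.
have -> : \int[mu]_y `|heat t y| = 1.
  rewrite -(Rintegral_heat t0); congr fine; apply: eq_integral => y _.
  by rewrite ger0_norm ?heat_ge0.
by rewrite mulr1.
Qed.

Lemma le_norm_heat_slope M t f x : 0 < t -> bounded_measurable M f ->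
  `|heat_slope t f x| <= M * Num.sqrt (2 / t).
Proof.
move=> t0 bf; rewrite (le_trans (le_norm_conv x (integrable_dheat t0) bf))//.
rewrite ler_wpM2l ?Rintegral_abs_dheat//.
by rewrite (le_trans _ (bf.2 0)).
Qed.

Lemma heat_slope_lipschitz M L t f x x' : 0 < t -> bounded_measurable M f ->
  (forall y y', `|f y - f y'| <= L * `|y - y'|) ->
  `|heat_slope t f x - heat_slope t f x'| <= L * Num.sqrt (2 / t) * `|x - x'|.
Proof.
move=> t0 bf Lf; rewrite (le_trans (conv_lipschitz x x' (integrable_dheat t0) bf Lf))//.
rewrite mulrAC ler_wpM2r// ler_wpM2l ?Rintegral_abs_dheat//.
by have := Lf 1 0; rewrite subr0 normr1 mulr1; apply: le_trans.
Qed.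

(** The kernel has mass [1] and first moment at most [sqrt (2 t)], which weight the two parts of the
    modulus. With [e = 0] this serves Lipschitz functions, with [e > 0] bounded functions that are
    merely continuous at [x]. *)
Lemma heat_flow_close M t f x e c : 0 < t -> bounded_measurable M f ->
  (forall y, `|f y - f x| <= e + c * `|y - x|) ->
  0 <= c -> `|heat_flow t f x - f x| <= e + c * Num.sqrt (2 * t).
Proof.
move=> t0 bf fx c0; have ih := integrable_heat t0.
rewrite -[X in _ - X](heat_flow_cst (f x) x t0) -(heat_flowB x t0 bf (bounded_measurable_cst _)).
have bd := bounded_measurableB bf (bounded_measurable_cst (f x)).
rewrite /heat_flow (conv_swap x ih bd).
have ikd := integrable_mul_bounded ih (bounded_measurable_reflect x bd).
apply: (le_trans (le_normr_Rintegral measurableT ikd)).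
have ie : mu.-integrable setT (EFin \o (fun y => e * heat t y)).
  exact: integrable_cstl.
have ic : mu.-integrable setT (EFin \o (fun y => c * (`|y| * heat t y))).
  by apply: integrable_cstl => //; exact: integrable_abs_heat.
apply: (@le_trans _ _ (\int[mu]_y (e * heat t y + c * (`|y| * heat t y)))).
  apply: le_Rintegral => //.
  - exact: (integrable_norm ikd).
  - have := integrableD measurableT ie ic; exact: eq_integrable.
  - move=> y _; rewrite normrM ger0_norm ?heat_ge0//.
    rewrite mulrA -mulrDl mulrC ler_wpM2r ?heat_ge0//.
    by rewrite (le_trans (fx _))// addrAC subrr add0r normrN.
rewrite RintegralD// !RintegralZl//; last exact: integrable_abs_heat.
by rewrite Rintegral_heat// mulr1 lerD2l ler_wpM2l// Rintegral_abs_heat.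
Qed.

Lemma measurable_sub_comp f : measurable_fun setT f ->
  measurable_fun setT (fun p : R * R => f (p.1 - p.2)).
Proof. by move=> mf; apply: measurableT_comp => //; exact: measurable_funB. Qed.

Lemma heat_flow_semigroup M s t f x : 0 < s -> 0 < t ->
  bounded_measurable M f -> (forall y, 0 <= f y) ->
  heat_flow s (heat_flow t f) x = heat_flow (s + t) f x.
Proof.
move=> s0 t0 bf f0; have st0 : 0 < s + t by rewrite addr_gt0.
rewrite /heat_flow /conv /Rintegral; congr fine.
have [mf _] := bf.
transitivity (\int[mu]_y \int[mu]_z (heat s (x - y) * (heat t (y - z) * f z))%:E)%E.
  apply: eq_integral => y _; rewrite EFinM fineK; last first.
    by apply: integrable_fin_num => //; exact: integrable_conv (integrable_heat t0) bf.
  rewrite -ge0_integralZl//=.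
  - by apply: measurable_int; exact: integrable_conv (integrable_heat t0) bf.
  - by move=> z _; rewrite lee_fin mulr_ge0 ?heat_ge0.
  - by rewrite lee_fin heat_ge0.
pose k (p : R * R) := (heat s (x - p.1) * (heat t (p.1 - p.2) * f p.2))%:E.
have mk : measurable_fun setT k.
  apply/measurable_EFinP; apply: measurable_funM.
    by apply: (measurableT_comp (measurable_heat s)); exact: measurable_funB.
  apply: measurable_funM; first exact: (measurable_sub_comp (measurable_heat t)).
  exact: measurableT_comp.
have k0 p : (0 <= k p)%E by rewrite lee_fin !mulr_ge0 ?heat_ge0.
etransitivity; first exact: (lebesgue_tonelli mk k0).
rewrite /k/=.
apply: eq_integral => z _.
under eq_integral do rewrite mulrA EFinM.
rewrite ge0_integralZr ?lee_fin//=.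
- by rewrite heat_conv// EFinM.
- apply/measurable_EFinP; apply: measurable_funM.
    by apply: (measurableT_comp (measurable_heat s)); exact: measurable_funB.
  by apply: (measurableT_comp (measurable_heat t)); exact: measurable_funB.
- by move=> y _; rewrite lee_fin mulr_ge0 ?heat_ge0.
Qed.

(** Differentiation of the flow in integrated form: Fubini moves the integral over [[a, b]] onto the
    kernel, where [integral_dheat] evaluates it. *)
Lemma Rintegral_heat_slope M t f a b : 0 < t -> bounded_measurable M f ->
  a < b -> mu.-integrable `[a, b] (EFin \o heat_slope t f) /\
  \int[mu]_(x in `[a, b]) heat_slope t f x = heat_flow t f b - heat_flow t f a.
Proof.
move=> t0 bf ab; have [mf M_f] := bf; have id := integrable_dheat t0.
have M0 : 0 <= M by rewrite (le_trans _ (M_f 0)).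
pose k (p : R * R) := (dheat t (p.1 - p.2) * f p.2 * (\1_`[a, b] p.1 : R))%:E.
have mk : measurable_fun setT k.
  apply/measurable_EFinP; apply: measurable_funM; last first.
    by apply: (@measurableT_comp _ _ _ _ _ _ (\1_`[a, b] : R -> R) _ fst) => //; exact: measurable_indic.
  apply: measurable_funM; first exact: (measurable_sub_comp (measurable_dheat t)).
  exact: measurableT_comp.
have Fx x : (\int[mu]_y k (x, y) = (heat_slope t f x * (\1_`[a, b] x : R))%:E)%E.
  have ic := integrable_conv x id bf.
  rewrite [RHS]EFinM /heat_slope /conv /Rintegral fineK; last exact: integrable_fin_num.
  by rewrite -integralZr//; apply: eq_integral => y _; rewrite -EFinM.
have Fy y : (\int[mu]_x k (x, y) = (heat t (b - y) * f y - heat t (a - y) * f y)%:E)%E.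
  have m1 : measurable_fun setT (fun x => dheat t (x - y)).
    by apply: (measurableT_comp (measurable_dheat t)); exact: measurable_funB.
  rewrite -mulrBl EFinM -(integral_dheat y t0 ab).
  have cd : mu.-integrable `[a, b] (EFin \o (fun x => dheat t (x - y))).
    apply: continuous_compact_integrable; first exact: segment_compact.
    apply: continuous_subspaceT => x; apply: (@continuous_comp _ _ _ (fun x => x - y) (dheat t)); last exact: continuous_dheat.
    by apply: cvgB; [exact: cvg_id|exact: cvg_cst].
  rewrite -integralZr//= [RHS]integral_mkcond.
  apply: eq_integral => x _; rewrite epatch_indic /= -EFinM; congr EFin; ring.
(* Absolute integrability: [dheat_le] dominates the kernel by a multiple of a probability density in
   [y], and the indicator then leaves the length [b - a]. *)
have koo : (\int[mu]_x \int[mu]_y `|k (x, y)| < +oo)%E.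
  apply: (@le_lt_trans _ _ (\int[mu]_x (((M * Num.sqrt (2 / t)) * (\1_`[a, b] x : R)))%:E)%E).
    apply: ge0_le_integral => //.
    - by move=> x _; apply: integral_ge0.
    - apply: (@measurable_fun_fubini_tonelli_F _ _ _ _ _ mu (abse \o k)) => //.
        by apply: measurableT_comp.
      by move=> p; exact: abse_ge0.
    - by apply/measurable_EFinP; apply: measurable_funM => //; exact: measurable_indic.
    move=> x _.
    have t20 : 0 < 2 * t by rewrite mulr_gt0.
    have C0 : 0 <= M * Num.sqrt (2 / t) * \1_`[a, b] x by rewrite !mulr_ge0 ?sqrtr_ge0.
    rewrite -[leRHS]mule1 -(integral_heat x t20) -ge0_integralZl//=; first last.
    - by move=> y _; rewrite lee_fin heat_ge0.
    - apply/measurable_EFinP; apply: (measurableT_comp (measurable_heat (2 * t))).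
      exact: measurable_funB.
    apply: ge0_le_integral => //.
    - apply/measurableT_comp => //.
      suff mkx : measurable_fun [set: R] (fun y : R => dheat t (x - y) * f y * (\1_`[a, b] x : R)).
        exact: (measurableT_comp _ mkx).
      apply: measurable_funM => //; apply: measurable_funM => //.
      by apply: (measurableT_comp (measurable_dheat t)); exact: measurable_funB.
    - apply/measurable_EFinP; apply: measurable_funM => //.
      by apply: (measurableT_comp (measurable_heat (2 * t))); exact: measurable_funB.
    move=> y _; rewrite /k/= lee_fin normrM (normrM (dheat _ _)) [`|\1_`[a, b] x|]ger0_norm//.
    rewrite [leRHS]mulrAC ler_wpM2r// [leLHS]mulrC -[leRHS]mulrA ler_pM//.
    rewrite heat_distC.
    exact: (dheat_le (x - y) t0).
  under eq_integral do rewrite EFinM.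
  rewrite ge0_integralZl//=.
  - rewrite integral_indic// setIT [X in (_ * X)%E](lebesgue_measure_itv `[a, b])/= lte_fin ab -EFinD -EFinM.
    exact: ltry.
  - by apply/measurable_EFinP; exact: measurable_indic.
  - by rewrite lee_fin mulr_ge0// sqrtr_ge0.
split.
  have ik : (mu \x mu)%E.-integrable setT k.
    by apply/(@integrable12ltyP _ _ _ _ _ mu mu).
  have iF := integrable_fubini_F ik.
  rewrite -(setTI [set` `[a, b]]).
  apply/integrable_restrict => //.
  apply: eq_integrable iF => // x _.
  by rewrite /fubini_F Fx epatch_indic /= EFinM.
have := lebesgue_fubini mk koo.
under eq_integral do rewrite Fx.
under [X in _ = X -> _]eq_integral do rewrite Fy.
move=> E; rewrite /heat_flow /conv -RintegralB//; first last.
- exact: integrable_conv (integrable_heat t0) bf.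
- exact: integrable_conv (integrable_heat t0) bf.
rewrite /Rintegral -E [in LHS]integral_mkcond; congr fine.
by apply: eq_integral => x _; rewrite epatch_indic /= -EFinM.
Qed.

Lemma bounded_interval_Rintegral g (c a b : R) : a < b ->
  mu.-integrable `[a, b] (EFin \o g) -> (forall x, x \in `[a, b] -> `|g x| <= c) ->
  `|\int[mu]_(x in `[a, b]) g x| <= c * (b - a).
Proof.
move=> ab ig gc; apply: (@le_trans _ _ (\int[mu]_(x in `[a, b]) `|g x|)).
  exact: le_normr_Rintegral.
have -> : c * (b - a) = \int[mu]_(x in `[a, b]) c.
  by rewrite Rintegral_cst// [X in fine X](lebesgue_measure_itv `[a, b])/= lte_fin ab.
apply: le_Rintegral => //.
- exact: (integrable_norm ig).
- apply/integrableP; split; first exact/measurable_EFinP.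
  rewrite integral_cst//= [X in (_ * X)%E](lebesgue_measure_itv `[a, b])/= lte_fin ab.
  by rewrite -EFinB -EFinM ltry.
Qed.

Lemma heat_flow_lipschitz M t f x y : 0 < t -> bounded_measurable M f ->
  `|heat_flow t f x - heat_flow t f y| <= M * Num.sqrt (2 / t) * `|x - y|.
Proof.
move=> t0 bf; wlog xy : x y / x < y.
  move=> h; have [xy|xy|->] := ltgtP x y; first exact: h.
    by rewrite distrC (distrC x) h.
  by rewrite !subrr normr0 mulr0.
have [ih hE] := Rintegral_heat_slope t0 bf xy.
rewrite distrC (distrC x) -hE [`|y - x|]gtr0_norm ?subr_gt0//.
by apply: bounded_interval_Rintegral => // z _; exact: le_norm_heat_slope.
Qed.

Lemma lipschitz_continuous (f : R -> R) L :
  (forall x y, `|f x - f y| <= L * `|x - y|) -> continuous f.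
Proof.
move=> fL x; apply/cvgrPdist_le => e e0.
have L0 : 0 <= L by have := fL 1 0; rewrite subr0 normr1 mulr1; exact: le_trans.
have L1 : 0 < L + 1 by rewrite ltr_wpDl.
near=> y; apply: le_trans (fL _ _) _.
have : `|x - y| <= e / (L + 1).
  by near: y; apply: cvgr_dist_le; [exact: cvg_id|rewrite divr_gt0].
rewrite ler_pdivlMr// => h; apply: le_trans _ h.
by rewrite mulrC ler_wpM2l// lerDl.
Unshelve. all: by end_near. Qed.

Lemma bounded_heat_flow M t f : 0 < t -> bounded_measurable M f ->
  bounded_measurable M (heat_flow t f).
Proof.
move=> t0 bf; split; last by move=> x; exact: le_norm_heat_flow.
apply: continuous_measurable_fun; apply: lipschitz_continuous => x y.
exact: heat_flow_lipschitz t0 bf.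
Qed.

(** If [g a < 0], right continuity makes [g] negative just after [a], and so its integral there.
    Applied to a difference in both orders, this identifies two densities with equal integrals, even
    at the boundary point [0] where only limits from the right are available. *)
Lemma right_limit_ge0 (g : R -> R) (a e : R) : 0 < e ->
  (forall b, a < b < a + e -> mu.-integrable `[a, b] (EFin \o g)) ->
  (forall b, a < b < a + e -> 0 <= \int[mu]_(x in `[a, b]) g x) ->
  g x @[x --> a^'+] --> g a -> 0 <= g a.
Proof.
move=> e0 ig pg ga; rewrite leNgt; apply/negP => ga0.
have h0 : 0 < - g a / 2 by rewrite divr_gt0// oppr_gt0.
have /cvgrPdist_le /(_ _ h0) := ga.
move=> [d /= d0 dg].
pose b := a + Num.min (d / 2) (e / 2).
have m0 : 0 < Num.min (d / 2) (e / 2) by rewrite lt_min !divr_gt0.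
have abe : a < b < a + e.
  rewrite /b ltrDl m0 ltrD2l (@le_lt_trans _ _ (e / 2)) ?ge_min ?lexx ?orbT//.
  by rewrite ltr_pdivrMr// ltr_pMr// ltr1n.
have ab : a < b by case/andP : abe.
have := pg b abe; apply/negP; rewrite -ltNge.
have gn x : x \in `[a, b] -> g x <= g a / 2.
  rewrite in_itv/= le_eqVlt => /andP[/predU1P[<- _|ax xb]].
    by move: ga0; lra.
  have : `|g a - g x| <= - g a / 2.
    apply: dg => //=; rewrite ltr0_norm ?subr_lt0// opprB ltrBlDl.
    rewrite (le_lt_trans xb)// ltrD2l (@le_lt_trans _ _ (d / 2)) ?ge_min ?lexx//.
    by rewrite ltr_pdivrMr// ltr_pMr// ltr1n.
  by rewrite ler_norml => /andP[]; lra.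
have : \int[mu]_(x in `[a, b]) g x <= \int[mu]_(x in `[a, b]) (g a / 2).
  apply: le_Rintegral => //; first exact: ig.
  apply/integrableP; split; first exact/measurable_EFinP.
  rewrite integral_cst//= [X in (_ * X)%E](lebesgue_measure_itv `[a, b])/= lte_fin ab.
  by rewrite -EFinB -EFinM ltry.
rewrite Rintegral_cst// [X in fine X](lebesgue_measure_itv `[a, b])/= lte_fin ab/= => /le_lt_trans; apply.
by rewrite pmulr_llt0 ?subr_gt0// pmulr_llt0.
Qed.

(** Both sides are continuous and have the same integral over each [[x, b]], an increment of
    [heat_flow (s + t) f]. The Lipschitz bound on [f] gives the continuity of the right-hand
    side. *)
Lemma heat_slope_flow M L s t f x : 0 < s -> 0 < t -> bounded_measurable M f ->
  (forall y, 0 <= f y) -> (forall y y', `|f y - f y'| <= L * `|y - y'|) ->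
  heat_slope s (heat_flow t f) x = heat_slope (s + t) f x.
Proof.
move=> s0 t0 bf f0 Lf; have st0 := addr_gt0 s0 t0.
have bh := bounded_heat_flow t0 bf.
have c1 : continuous (heat_slope s (heat_flow t f)).
  apply: lipschitz_continuous => y z.
  exact: (heat_slope_lipschitz y z s0 bh (fun y z => heat_flow_lipschitz y z t0 bf)).
have c2 : continuous (heat_slope (s + t) f).
  by apply: lipschitz_continuous => y z; exact: (heat_slope_lipschitz y z st0 bf Lf).
have iE b : x < b -> \int[mu]_(y in `[x, b]) heat_slope s (heat_flow t f) y =
    \int[mu]_(y in `[x, b]) heat_slope (s + t) f y.
  move=> xb; rewrite (Rintegral_heat_slope s0 bh xb).2 (Rintegral_heat_slope st0 bf xb).2.
  by rewrite !(heat_flow_semigroup _ s0 t0 bf f0).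
have i1 b : x < b -> mu.-integrable `[x, b] (EFin \o heat_slope s (heat_flow t f)).
  by move=> xb; have [] := Rintegral_heat_slope s0 bh xb.
have i2 b : x < b -> mu.-integrable `[x, b] (EFin \o heat_slope (s + t) f).
  by move=> xb; have [] := Rintegral_heat_slope st0 bf xb.
apply/eqP; rewrite eq_le -subr_ge0 -(subr_ge0 (heat_slope _ f x)); apply/andP; split.
- apply: (@right_limit_ge0 (fun y => heat_slope (s + t) f y - heat_slope s (heat_flow t f) y) x 1) => //.
  + by move=> b /andP[xb _]; exact: (integrable_diff (measurable_itv _) (i2 b xb) (i1 b xb)).
  + by move=> b /andP[xb _]; rewrite RintegralB ?iE ?subrr//; [exact: i2|exact: i1].
  + apply: cvg_at_right_filter; apply: cvgB; [exact: c2|exact: c1].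
- apply: (@right_limit_ge0 (fun y => heat_slope s (heat_flow t f) y - heat_slope (s + t) f y) x 1) => //.
  + by move=> b /andP[xb _]; exact: (integrable_diff (measurable_itv _) (i1 b xb) (i2 b xb)).
  + by move=> b /andP[xb _]; rewrite RintegralB ?iE ?subrr//; [exact: i1|exact: i2].
  + apply: cvg_at_right_filter; apply: cvgB; [exact: c1|exact: c2].
Qed.

End heat_flow.

(** * Tails and barriers *)

(* The reflection through [(0, phi 0)] is exact for the Neumann kernel: a density
   extended evenly has a primitive symmetric about that point. *)
Definition odd_ext (R : realType) (phi : R -> R) (x : R) : R :=
  if 0 <= x then phi x else 2 * phi 0 - phi (- x).

(** Abstract tails of mass [M]; they need not have a density, so the limit of the barriers is again
    one of them ([profile_evol]). *)
Definition profile (R : realType) (M : R) (phi : R -> R) : Prop :=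
  [/\ phi 0 = M, forall x, 0 <= x -> 0 <= phi x
    & forall x y, 0 <= x -> x <= y -> phi y <= phi x].

(* The pasted atom compensates the removed mass, so the total mass [phi 0] is kept. *)
Definition cutF (R : realType) (a : R) (phi : R -> R) (x : R) : R :=
  if x == 0 then phi 0 else Num.max (phi x - a) 0.

Definition heatF (R : realType) (t : R) (phi : R -> R) : R -> R :=
  heat_flow t (odd_ext phi).

Section profiles.
Context {R : realType}.
Local Notation mu := (@lebesgue_measure R).
Implicit Types (phi : R -> R) (x y M a b c s t : R).

Lemma profile_le M phi x : profile M phi -> 0 <= x -> phi x <= M.
Proof. by move=> [p0 _ pd] x0; rewrite -p0 pd. Qed.

Lemma profile_ge0 M phi : profile M phi -> 0 <= M.
Proof. by move=> [<- p _]; exact: p. Qed.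

Lemma odd_ext_ge0 phi x : 0 <= x -> odd_ext phi x = phi x.
Proof. by rewrite /odd_ext => ->. Qed.

Lemma odd_extN phi x : odd_ext phi (- x) = 2 * phi 0 - odd_ext phi x.
Proof.
rewrite /odd_ext oppr_ge0 opprK; have [x0|x0|<-] := ltgtP 0 x.
- by [].
- by rewrite opprB addrC subrK.
- by rewrite oppr0; ring.
Qed.

Lemma odd_ext_eq phi phi' : (forall x, 0 <= x -> phi x = phi' x) ->
  odd_ext phi = odd_ext phi'.
Proof.
move=> pp; apply/funext => x; rewrite /odd_ext; case: ifPn => [x0|]; first exact: pp.
by rewrite -ltNge => x0; rewrite !pp// oppr_ge0 ltW.
Qed.

Lemma odd_ext_anti M phi : profile M phi -> {homo odd_ext phi : x y /~ x <= y}.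
Proof.
move=> P x y yx; have [p0 pp pd] := P; have M0 := profile_ge0 P.
rewrite /odd_ext p0; case: ifPn => [x0|]; case: ifPn => [y0|]; rewrite -?ltNge.
- exact: pd.
- move=> y0; have xM := profile_le P x0.
  by have := @profile_le _ _ (- y) P; rewrite oppr_ge0 => /(_ (ltW y0)); lra.
- by move=> x0; move: (le_lt_trans yx x0); rewrite ltNge y0.
- by move=> y0 x0; have := pd (- x) (- y); rewrite oppr_ge0 lerN2 => /(_ (ltW x0) yx); lra.
Qed.

Lemma odd_ext_bound M phi x : profile M phi -> 0 <= odd_ext phi x <= 2 * M.
Proof.
move=> P; have [p0 pp _] := P; have M0 := profile_ge0 P.
rewrite /odd_ext p0; case: ifPn => [x0|].
  by have := profile_le P x0; have := pp _ x0; lra.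
rewrite -ltNge => x0; have nx0 : 0 <= - x by rewrite oppr_ge0 ltW.
by have := profile_le P nx0; have := pp _ nx0; lra.
Qed.

Lemma bounded_odd_ext M phi : profile M phi -> bounded_measurable (2 * M) (odd_ext phi).
Proof.
move=> P; split; last first.
  by move=> x; have /andP[? ?] := odd_ext_bound x P; rewrite ger0_norm.
by apply: nonincreasing_measurable => // x y xy; exact: (odd_ext_anti P xy).
Qed.

Lemma heatFN M t phi x : 0 < t -> profile M phi ->
  heatF t phi (- x) = 2 * M - heatF t phi x.
Proof.
move=> t0 P; have [p0 _ _] := P; have bE := bounded_odd_ext P.
rewrite /heatF -(heat_flow_reflect x t0 bE).
have -> : (fun y => odd_ext phi (- y)) = (fun y => 2 * M - odd_ext phi y).
  by apply/funext => y; rewrite odd_extN p0.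
by rewrite (heat_flowB x t0 (bounded_measurable_cst _) bE) heat_flow_cst.
Qed.

Lemma heatF0 M t phi : 0 < t -> profile M phi -> heatF t phi 0 = M.
Proof. by move=> t0 P; have := heatFN 0 t0 P; rewrite oppr0; lra. Qed.

(** The flow on the line preserves the symmetry about [(0, M)], so reflecting again after a step
    changes nothing; this transfers the semigroup law to [heatF]. *)
Lemma odd_ext_heatF M t phi : 0 < t -> profile M phi ->
  odd_ext (heatF t phi) = heatF t phi.
Proof.
move=> t0 P; apply/funext => x; rewrite /odd_ext; case: ifPn => // _.
by rewrite (heatF0 t0 P) (heatFN x t0 P); ring.
Qed.

Lemma profile_heatF M t phi : 0 < t -> profile M phi -> profile M (heatF t phi).
Proof.
move=> t0 P; have bE := bounded_odd_ext P; split.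
- exact: heatF0.
- move=> x _; rewrite -(heat_flow_cst 0 x t0).
  apply: heat_flow_le t0 (bounded_measurable_cst _) bE _ => y.
  by have /andP[] := odd_ext_bound y P.
- by move=> x y _; exact: (heat_flow_anti t0 bE (odd_ext_anti P)).
Qed.

Lemma profile_cutF M a phi : 0 <= a -> profile M phi -> profile M (cutF a phi).
Proof.
move=> a0 P; have [p0 pp pd] := P; have M0 := profile_ge0 P; split.
- by rewrite /cutF eqxx.
- by move=> x x0; rewrite /cutF; case: ifP => _; [exact: pp|rewrite le_max lexx orbT].
- move=> x y x0 xy; rewrite /cutF p0.
  have yM := profile_le P (le_trans x0 xy).
  case: (eqVneq y 0) => [y0|yn0].
    by rewrite (_ : x == 0) //; apply/eqP/le_anti; rewrite x0 -y0 xy.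
  case: ifPn => _; rewrite ge_max ?M0.
    by rewrite (le_trans _ yM)// gerBl.
  by rewrite !le_max lexx orbT andbT lerD2r pd.
Qed.

Lemma cutF_le M a phi x : 0 <= a -> profile M phi -> 0 <= x -> cutF a phi x <= phi x.
Proof.
move=> a0 [p0 pp _] x0; rewrite /cutF; case: ifPn => [/eqP->//|_].
by rewrite ge_max gerBl a0 pp.
Qed.

Lemma le_cutF a phi x : 0 <= a -> phi x <= cutF a phi x + a.
Proof.
move=> a0; rewrite /cutF; case: ifPn => [/eqP->|_]; first by rewrite lerDl.
by rewrite -lerBlDr le_max lexx.
Qed.

Lemma cutF_mono a c phi phi' : 0 <= c ->
  (forall x, 0 <= x -> phi x <= phi' x + c) ->
  forall x, 0 <= x -> cutF a phi x <= cutF a phi' x + c.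
Proof.
move=> c0 pp x x0; rewrite /cutF; case: ifPn => _; first exact: pp.
rewrite ge_max -!lerBlDr !le_max; have := pp _ x0 => ?.
by apply/andP; split; apply/orP; [left|right]; lra.
Qed.

Lemma cutF_comp a b phi : 0 <= a -> cutF a (cutF b phi) = cutF (a + b) phi.
Proof.
move=> a0; apply/funext => x; rewrite /cutF eqxx; case: eqP => // _.
by case: (leP (phi x - b) 0) => ?; case: leP => ?; case: leP => ?; lra.
Qed.

(** The difference [d] of the extensions, with the slack added, is nonnegative for [y >= 0] but may
    be negative for [y < 0]. It satisfies [d (- y) = 2 d 0 - d y], and for [r >= 0] the kernel
    weighs [y] at least as much as [- y], so each pair contributes a nonnegative amount. *)
Lemma heatF_mono M M' c t phi phi' : 0 < t -> profile M phi -> profile M' phi' ->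
  0 <= c -> (forall x, 0 <= x -> phi x <= phi' x + c) ->
  forall x, 0 <= x -> heatF t phi x <= heatF t phi' x + c.
Proof.
move=> t0 P P' c0 pp r r0.
have bE := bounded_odd_ext P; have bE' := bounded_odd_ext P'.
pose d y := odd_ext phi' y - (odd_ext phi y - c).
have bd : bounded_measurable _ d := bounded_measurableB bE' (bounded_measurableB bE (bounded_measurable_cst c)).
suff : 0 <= heat_flow t d r.
  rewrite /d (heat_flowB r t0 bE' (bounded_measurableB bE (bounded_measurable_cst c))).
  by rewrite (heat_flowB r t0 bE (bounded_measurable_cst c)) heat_flow_cst// /heatF; lra.
have ih := integrable_heat t0; have id := integrable_conv r ih bd.
have id' := integrable_reflect 0 id.
(* Doubling the integral and reflecting one copy pairs [y] with [- y], which makes the integrand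
   pointwise nonnegative. *)
suff : 0 <= heat_flow t d r + heat_flow t d r by lra.
rewrite {2}/heat_flow /conv -(Rintegral_reflect 0 id).
rewrite /heat_flow /conv -RintegralD//; apply: Rintegral_ge0.
have pos y : 0 <= y -> 0 <= heat t (r - y) * d y + heat t (r + y) * d (- y).
  move=> y0; have D0 : 0 <= d 0.
    by rewrite /d !odd_ext_ge0//; have := pp 0 (lexx _); lra.
  have dy : 0 <= d y by rewrite /d !odd_ext_ge0//; have := pp y y0; lra.
  have -> : d (- y) = 2 * d 0 - d y.
    by rewrite /d !odd_extN !(odd_ext_ge0 _ (lexx _)); ring.
  have -> : heat t (r - y) * d y + heat t (r + y) * (2 * d 0 - d y) =
    (heat t (r - y) - heat t (r + y)) * d y + 2 * d 0 * heat t (r + y) by ring.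
  rewrite addr_ge0 ?mulr_ge0 ?heat_ge0// subr_ge0 heat_anti//.
  by rewrite [leRHS]ger0_norm ?addr_ge0// ler_norml; apply/andP; split; lra.
move=> y _; rewrite sub0r opprK; have [y0|/ltW y0] := leP 0 y; first exact: pos.
by rewrite addrC; have := pos (- y); rewrite opprK; apply; rewrite oppr_ge0.
Qed.

Lemma heatF_comp M s t phi : 0 < s -> 0 < t -> profile M phi ->
  heatF s (heatF t phi) = heatF (s + t) phi.
Proof.
move=> s0 t0 P; apply/funext => x; rewrite {1}/heatF (odd_ext_heatF t0 P).
apply: heat_flow_semigroup s0 t0 (bounded_odd_ext P) _ => y.
by have /andP[] := odd_ext_bound y P.
Qed.

(** A cut lowers a profile by at most [a], and diffusion preserves this bound, so diffusing the cut
    profile loses at most [a] as well. Truncation at [0] and the value at the origin are harmless: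
    the right-hand side is nonnegative and has the same mass. *)
Lemma cutF_heatF M a t phi x : 0 <= a -> 0 < t -> profile M phi -> 0 <= x ->
  cutF a (heatF t phi) x <= heatF t (cutF a phi) x.
Proof.
move=> a0 t0 P x0; have Pc := profile_cutF a0 P.
rewrite {1}/cutF; case: ifPn => [/eqP->|_].
  by rewrite (heatF0 t0 P) (heatF0 t0 Pc).
rewrite ge_max; apply/andP; split; last by case: (profile_heatF t0 Pc) => _ + _; exact.
by rewrite lerBlDr; apply: (heatF_mono t0 P Pc a0 _ x0) => y _; exact: le_cutF.
Qed.

End profiles.

(** Lists of steps of arbitrary lengths rather than a count and one [delta]: comparing two uniform
    subdivisions leads through subdivisions that are not uniform. *)
Fixpoint upper (R : realType) (j : R) (l : seq R) (phi : R -> R) : R -> R :=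
  if l is s :: l' then upper j l' (heatF s (cutF (j * s) phi)) else phi.

Fixpoint lower (R : realType) (j : R) (l : seq R) (phi : R -> R) : R -> R :=
  if l is s :: l' then lower j l' (cutF (j * s) (heatF s phi)) else phi.

Definition total (R : realType) (l : seq R) : R := \sum_(s <- l) s.

(** * Order between the barriers of different subdivisions *)

Section barriers.
Context {R : realType}.
Variables (j : R) (j0 : 0 <= j).
Implicit Types (phi : R -> R) (x y M a b c s t h : R) (l : seq R).
Let pos l := all (fun s => 0 < s) l.

Let js s : 0 < s -> 0 <= j * s.
Proof. by move=> s0; rewrite mulr_ge0// ltW. Qed.

Lemma total_cons s l : total (s :: l) = s + total l.
Proof. by rewrite /total big_cons. Qed.

Lemma total_ge0 l : pos l -> 0 <= total l.
Proof.
by elim: l => [|s l IH]; rewrite /total ?big_nil// big_cons => /andP[s0 /IH]; rewrite /total => ?; rewrite addr_ge0// ltW.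
Qed.

Lemma total_nseq n s : total (nseq n s) = n%:R * s.
Proof.
elim: n => [|n IH]; first by rewrite /total big_nil mul0r.
by rewrite /= total_cons IH -natr1; ring.
Qed.

Lemma total_cat l l' : total (l ++ l') = total l + total l'.
Proof. by rewrite /total big_cat. Qed.

Lemma pos_nseq n s : 0 < s -> pos (nseq n s).
Proof. by move=> s0; rewrite /pos all_nseq s0 orbT. Qed.

Lemma upper_cat l l' phi : upper j (l ++ l') phi = upper j l' (upper j l phi).
Proof. by elim: l phi => //= s l IH phi; rewrite IH. Qed.

Lemma lower_cat l l' phi : lower j (l ++ l') phi = lower j l' (lower j l phi).
Proof. by elim: l phi => //= s l IH phi; rewrite IH. Qed.

Lemma profile_upper_step M s phi : 0 < s -> profile M phi ->
  profile M (heatF s (cutF (j * s) phi)).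
Proof. by move=> s0 P; exact: (profile_heatF s0 (profile_cutF (js s0) P)). Qed.

Lemma profile_lower_step M s phi : 0 < s -> profile M phi ->
  profile M (cutF (j * s) (heatF s phi)).
Proof. by move=> s0 P; exact: (profile_cutF (js s0) (profile_heatF s0 P)). Qed.

Lemma profile_upper M l phi : pos l -> profile M phi -> profile M (upper j l phi).
Proof.
elim: l phi => [//|s l IH] phi /= /andP[s0 pl] P.
exact: (IH _ pl (profile_upper_step s0 P)).
Qed.

Lemma profile_lower M l phi : pos l -> profile M phi -> profile M (lower j l phi).
Proof.
elim: l phi => [//|s l IH] phi /= /andP[s0 pl] P.
exact: (IH _ pl (profile_lower_step s0 P)).
Qed.

Lemma upper_mono M M' c l phi phi' : pos l -> profile M phi -> profile M' phi' ->
  0 <= c -> (forall x, 0 <= x -> phi x <= phi' x + c) ->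
  forall x, 0 <= x -> upper j l phi x <= upper j l phi' x + c.
Proof.
move=> + + + c0; elim: l phi phi' => [|s l IH] phi phi' /=; first by move=> _ _ _; exact.
move=> /andP[s0 pl] P P' pp.
apply: (IH _ _ pl (profile_upper_step s0 P) (profile_upper_step s0 P')).
apply: (heatF_mono s0 (profile_cutF (js s0) P) (profile_cutF (js s0) P') c0).
exact: cutF_mono _ c0 pp.
Qed.

Lemma lower_mono M M' c l phi phi' : pos l -> profile M phi -> profile M' phi' ->
  0 <= c -> (forall x, 0 <= x -> phi x <= phi' x + c) ->
  forall x, 0 <= x -> lower j l phi x <= lower j l phi' x + c.
Proof.
move=> + + + c0; elim: l phi phi' => [|s l IH] phi phi' /=; first by move=> _ _ _; exact.
move=> /andP[s0 pl] P P' pp.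
apply: (IH _ _ pl (profile_lower_step s0 P) (profile_lower_step s0 P')).
exact: (cutF_mono _ c0 (heatF_mono s0 P P' c0 pp)).
Qed.

Lemma upper_mono0 M M' l phi phi' : pos l -> profile M phi -> profile M' phi' ->
  (forall x, 0 <= x -> phi x <= phi' x) ->
  forall x, 0 <= x -> upper j l phi x <= upper j l phi' x.
Proof.
move=> pl P P' pp x x0; rewrite -[leRHS]addr0.
by apply: (upper_mono pl P P') => // y y0; rewrite addr0 pp.
Qed.

Lemma lower_mono0 M M' l phi phi' : pos l -> profile M phi -> profile M' phi' ->
  (forall x, 0 <= x -> phi x <= phi' x) ->
  forall x, 0 <= x -> lower j l phi x <= lower j l phi' x.
Proof.
move=> pl P P' pp x x0; rewrite -[leRHS]addr0.
by apply: (lower_mono pl P P') => // y y0; rewrite addr0 pp.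
Qed.

(** Once the step [s + t] is split by [cutF_comp] and [heatF_comp], the two sides differ only in the
    order of the middle cut and diffusion, which [cutF_heatF] compares. The same holds for
    [lower_merge]. *)
Lemma upper_merge M s t phi x : 0 < s -> 0 < t -> profile M phi -> 0 <= x ->
  upper j [:: s; t] phi x <= upper j [:: s + t] phi x.
Proof.
move=> s0 t0 P x0 /=; have Ps := profile_cutF (js s0) P.
have -> : heatF (s + t) (cutF (j * (s + t)) phi) =
    heatF t (heatF s (cutF (j * t) (cutF (j * s) phi))).
  by rewrite cutF_comp ?js// (heatF_comp t0 s0 (profile_cutF (addr_ge0 (js t0) (js s0)) P)) -mulrDr addrC.
rewrite -[leRHS]addr0.
apply: (heatF_mono t0 (profile_cutF (js t0) (profile_heatF s0 Ps))
  (profile_heatF s0 (profile_cutF (js t0) Ps)) (lexx 0) _ x0) => y y0.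
by rewrite addr0; exact: (cutF_heatF (js t0) s0 Ps y0).
Qed.

Lemma lower_merge M s t phi x : 0 < s -> 0 < t -> profile M phi -> 0 <= x ->
  lower j [:: s + t] phi x <= lower j [:: s; t] phi x.
Proof.
move=> s0 t0 P x0 /=; have Ps := profile_heatF s0 P.
have -> : cutF (j * (s + t)) (heatF (s + t) phi) =
    cutF (j * t) (cutF (j * s) (heatF t (heatF s phi))).
  by rewrite cutF_comp ?js// (heatF_comp t0 s0 P) -mulrDr [t + s]addrC.
rewrite -[leRHS]addr0; apply: (cutF_mono _ (lexx 0) _ x0) => y y0.
by rewrite addr0; exact: (cutF_heatF (js s0) t0 Ps y0).
Qed.

Lemma upper_coarsen M l s phi x : pos (s :: l) -> profile M phi -> 0 <= x ->
  upper j (s :: l) phi x <= upper j [:: total (s :: l)] phi x.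
Proof.
elim: l s phi => [|t l IH] s phi.
  by move=> _ _ _; rewrite /total big_seq1.
move=> /andP[s0 pl] P x0; have /andP[t0 pl'] := pl.
have P1 : profile M (upper j [:: s] phi).
  by apply: profile_upper P; rewrite /pos /= s0.
apply: le_trans (IH t (upper j [:: s] phi) pl P1 x0) _.
rewrite (total_cons s) (total_cons t).
apply: (upper_merge s0 _ P x0).
by rewrite ltr_wpDr// total_ge0.
Qed.

Lemma lower_coarsen M l s phi x : pos (s :: l) -> profile M phi -> 0 <= x ->
  lower j [:: total (s :: l)] phi x <= lower j (s :: l) phi x.
Proof.
elim: l s phi => [|t l IH] s phi.
  by move=> _ _ _; rewrite /total big_seq1.
move=> /andP[s0 pl] P x0; have /andP[t0 pl'] := pl.
have P1 : profile M (lower j [:: s] phi).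
  by apply: profile_lower P; rewrite /pos /= s0.
apply: le_trans (IH t (lower j [:: s] phi) pl P1 x0).
rewrite (total_cons s) (total_cons t).
apply: (lower_merge s0 _ P x0).
by rewrite ltr_wpDr// total_ge0.
Qed.

Lemma upper_refine M m k s phi x : (0 < m)%N -> 0 < s -> profile M phi -> 0 <= x ->
  upper j (nseq (k * m) s) phi x <= upper j (nseq k (m%:R * s)) phi x.
Proof.
move=> m0 s0 P x0; elim: k phi P => [//|k IH] phi P.
have ms0 : 0 < m%:R * s by rewrite mulr_gt0// ltr0n.
rewrite mulSn nseqD upper_cat.
apply: le_trans (IH _ (profile_upper (pos_nseq m s0) P)) _.
apply: (upper_mono0 (pos_nseq k ms0) (profile_upper (pos_nseq m s0) P) _ _ x0).
  by apply: (@profile_upper M [:: m%:R * s]) => //; rewrite /pos/= ms0.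
move=> y y0 {IH}; case: m m0 ms0 => // m _ _.
have := upper_coarsen (pos_nseq m.+1 s0) P y0.
by rewrite -[s :: nseq m s]/(nseq m.+1 s) total_nseq.
Qed.

Lemma lower_refine M m k s phi x : (0 < m)%N -> 0 < s -> profile M phi -> 0 <= x ->
  lower j (nseq k (m%:R * s)) phi x <= lower j (nseq (k * m) s) phi x.
Proof.
move=> m0 s0 P x0; elim: k phi P => [//|k IH] phi P.
have ms0 : 0 < m%:R * s by rewrite mulr_gt0// ltr0n.
rewrite mulSn nseqD lower_cat.
apply: le_trans _ (IH _ (profile_lower (pos_nseq m s0) P)).
apply: (lower_mono0 (pos_nseq k ms0) _ (profile_lower (pos_nseq m s0) P) _ x0).
  by apply: (@profile_lower M [:: m%:R * s]) => //; rewrite /pos/= ms0.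
move=> y y0 {IH}; case: m m0 ms0 => // m _ _.
have := lower_coarsen (pos_nseq m.+1 s0) P y0.
by rewrite -[s :: nseq m s]/(nseq m.+1 s) total_nseq.
Qed.

(* Splitting the longer of the two leading steps reduces the total number of
   steps, so no common refinement of the two subdivisions is needed. *)
Lemma lower_le_upper M l l' phi x : pos l -> pos l' -> total l = total l' ->
  profile M phi -> 0 <= x -> lower j l phi x <= upper j l' phi x.
Proof.
move=> pl pl' tt P x0.
(* Two ordered data instead of one: once the leading steps are removed, the two barriers continue
   from different profiles. *)
suff : forall n l l' phi phi', (size l + size l' <= n)%N -> pos l -> pos l' ->
    total l = total l' -> profile M phi -> profile M phi' ->
    (forall y, 0 <= y -> phi y <= phi' y) -> lower j l phi x <= upper j l' phi' x.
  by move=> /(_ _ l l' phi phi (leqnn _)); exact.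
move=> {l l' phi pl pl' tt P}; elim=> [|n IH] l l' phi phi'.
  by rewrite leqn0 addn_eq0 !size_eq0 => /andP[/eqP-> /eqP->] _ _ _ _ _; exact.
case: l => [|s l]; case: l' => [|s' l'].
- by move=> _ _ _ _ _ _; exact.
- move=> _ _ /andP[s0 pl]; rewrite total_cons {1}/total big_nil.
  by have := total_ge0 pl; lra.
- move=> _ /andP[s0 pl] _; rewrite total_cons [total [::]]/total big_nil.
  by have := total_ge0 pl; lra.
rewrite !total_cons => szn /andP[s0 pl] /andP[s0' pl'] tt P P' pp.
have Pc := profile_lower_step s0 P; have Pc' := profile_upper_step s0' P'.
have step t : 0 < t -> forall y, 0 <= y ->
    cutF (j * t) (heatF t phi) y <= heatF t (cutF (j * t) phi') y.
  move=> t0 y y0; apply: le_trans (cutF_heatF (js t0) t0 P y0) _.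
  rewrite -[leRHS]addr0; apply: (heatF_mono t0 (profile_cutF (js t0) P) (profile_cutF (js t0) P')) => // z z0.
  by apply: (cutF_mono _ (lexx 0) _ z0) => w w0; rewrite addr0 pp.
have [ss|ss|ss] := ltgtP s s'.
(* Splitting [s'] into [s] and [s' - s] only lowers the upper barrier, and removing the now equal
   leading steps shortens the two lists by one in all. *)
- have d0 : 0 < s' - s by rewrite subr_gt0.
  have Ps := profile_upper_step s0 P'.
  apply: le_trans (IH l ((s' - s) :: l') _ _ _ pl _ _ Pc Ps (step s s0)) _.
  + by rewrite /= in szn *; lia.
  + by rewrite /pos/= d0.
  + by rewrite total_cons; lra.
  apply: (upper_mono0 pl' _ Pc' _ x0).
    by apply: (@profile_upper M [:: s' - s]) => //; rewrite /pos/= d0.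
  by move=> y y0; have := upper_merge s0 d0 P' y0; rewrite /= [s + _]addrC subrK.
- have d0 : 0 < s - s' by rewrite subr_gt0.
  have Ps := profile_lower_step s0' P.
  apply: le_trans _ (IH ((s - s') :: l) l' _ _ _ _ pl' _ Ps Pc' (step s' s0')).
  + apply: (lower_mono0 pl Pc _ _ x0).
      by apply: (@profile_lower M [:: s - s']) => //; rewrite /pos/= d0.
    by move=> y y0; have := lower_merge s0' d0 P y0; rewrite /= [s' + _]addrC subrK.
  + by rewrite /= in szn *; lia.
  + by rewrite /pos/= d0.
  + by rewrite total_cons; lra.
- rewrite -ss in tt Pc' *; apply: (IH l l' _ _ _ pl pl' _ Pc Pc' (step s s0)).
  + by rewrite /= in szn *; lia.
  + by lra.
Qed.

(** Reassociation: both sides alternate cuts and diffusions, beginning and ending with a cut. *)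
Lemma cutF_upper n s phi : cutF (j * s) (upper j (nseq n s) phi) =
  lower j (nseq n s) (cutF (j * s) phi).
Proof. by elim: n phi => //= n IH phi; rewrite IH. Qed.

(** One outer cut costs at most [j s] and turns the upper barrier into the lower barrier of the cut
    datum, which lies below that of [phi]. Hence the gap does not grow with [n]. *)
Lemma upper_le_lower M n s phi x : 0 < s -> profile M phi -> 0 <= x ->
  upper j (nseq n s) phi x <= lower j (nseq n s) phi x + j * s.
Proof.
move=> s0 P x0; apply: (le_trans (le_cutF _ _ (js s0))).
rewrite lerD2r cutF_upper.
apply: (lower_mono0 (pos_nseq n s0) (profile_cutF (js s0) P) P _ x0) => y y0.
exact: cutF_le (js s0) P y0.
Qed.

End barriers.

(** * The common limit of the barriers and its one-step estimate *)

Definition uniform_steps (R : realType) (n : nat) (t : R) : seq R :=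
  nseq n.+1 (t / n.+1%:R).

(** The infimum runs over all [n], including steps for which [j delta] exceeds the mass: [cutF]
    still makes sense there, so admissibility enters only on the return to measures. *)
Definition evol (R : realType) (j : R) (phi : R -> R) (t x : R) : R :=
  inf [set upper j (uniform_steps n t) phi x | n in [set: nat]].

Section evolution.
Context {R : realType}.
Variables (j : R) (j0 : 0 <= j).
Implicit Types (phi : R -> R) (x y M a b c s t h : R) (l : seq R).

Lemma le_harmonic a b c : (forall n : nat, a <= b + c / n.+1%:R) -> a <= b.
Proof.
move=> h; rewrite leNgt; apply/negP => ba.
have c0 : 0 < c by have := h 0%N; rewrite divr1; lra.
have d0 : 0 < a - b by rewrite subr_gt0.
have := archi_boundP (divr_ge0 (ltW c0) (ltW d0)); set n := Num.bound _ => cn.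
have := h n; have n0 : 0 < n.+1%:R :> R by rewrite ltr0n.
rewrite -lerBlDl ler_pdivlMr// leNgt => /negP; apply.
rewrite mulrC -ltr_pdivrMr//; apply: lt_trans cn _.
by rewrite ltr_nat.
Qed.

Lemma total_uniform n t : total (uniform_steps n t) = t.
Proof. by rewrite total_nseq mulrC divfK// pnatr_eq0. Qed.

Lemma pos_uniform n t : 0 < t -> all (fun s => 0 < s) (uniform_steps n t).
Proof. by move=> t0; apply: pos_nseq; rewrite divr_gt0// ltr0n. Qed.

Lemma upper_le_lower_uniform M n t phi x : 0 < t -> profile M phi -> 0 <= x ->
  upper j (uniform_steps n t) phi x <=
  lower j (uniform_steps n t) phi x + j * t / n.+1%:R.
Proof.
move=> t0 P x0; rewrite -mulrA; apply: (upper_le_lower j0 n.+1 _ P x0).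
by rewrite divr_gt0// ltr0n.
Qed.

Lemma has_inf_evol M phi t x : 0 < t -> profile M phi -> 0 <= x ->
  has_inf [set upper j (uniform_steps n t) phi x | n in [set: nat]].
Proof.
move=> t0 P x0; split; first by exists (upper j (uniform_steps 0 t) phi x); exists 0%N.
exists 0 => _ [n _ <-].
by have [_ + _] := profile_upper j0 (pos_uniform n t0) P; exact.
Qed.

Lemma evol_le_uniform M n phi t x : 0 < t -> profile M phi -> 0 <= x ->
  evol j phi t x <= upper j (uniform_steps n t) phi x.
Proof.
move=> t0 P x0; apply: ge_inf; last by exists n.
by have [] := has_inf_evol t0 P x0.
Qed.

Lemma lower_le_evol M l phi t x : all (fun s => 0 < s) l -> total l = t -> 0 < t ->
  profile M phi -> 0 <= x -> lower j l phi x <= evol j phi t x.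
Proof.
move=> pl tl t0 P x0; apply: lb_le_inf; first by case: (has_inf_evol t0 P x0).
move=> _ [n _ <-]; apply: (lower_le_upper j0 pl (pos_uniform n t0) _ P x0).
by rewrite total_uniform.
Qed.

(** Every upper barrier lies above all uniform lower ones, and these are within [j t / n.+1] of the
    uniform upper ones. *)
Lemma evol_le_upper M l phi t x : all (fun s => 0 < s) l -> total l = t -> 0 < t ->
  profile M phi -> 0 <= x -> evol j phi t x <= upper j l phi x.
Proof.
move=> pl tl t0 P x0; apply: (@le_harmonic _ _ (j * t)) => n.
apply: le_trans (evol_le_uniform n t0 P x0) _.
apply: le_trans (upper_le_lower_uniform n t0 P x0) _; rewrite lerD2r.
by apply: (lower_le_upper j0 (pos_uniform n t0) pl _ P x0); rewrite total_uniform.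
Qed.

Lemma upper_le_evol M n phi t x : 0 < t -> profile M phi -> 0 <= x ->
  upper j (uniform_steps n t) phi x <= evol j phi t x + j * t / n.+1%:R.
Proof.
move=> t0 P x0; apply: le_trans (upper_le_lower_uniform n t0 P x0) _.
by rewrite lerD2r (lower_le_evol (pos_uniform n t0) (total_uniform n t) t0 P x0).
Qed.

Lemma evol_le_lower M n phi t x : 0 < t -> profile M phi -> 0 <= x ->
  evol j phi t x <= lower j (uniform_steps n t) phi x + j * t / n.+1%:R.
Proof.
by move=> t0 P x0; apply: le_trans (evol_le_uniform n t0 P x0) (upper_le_lower_uniform n t0 P x0).
Qed.

Lemma profile_evol M phi t : 0 < t -> profile M phi -> profile M (evol j phi t).
Proof.
move=> t0 P.
have E0 : evol j phi t 0 = M.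
  apply/eqP; rewrite eq_le; apply/andP; split.
    have := evol_le_uniform 0 t0 P (lexx 0).
    by have [-> _ _] := profile_upper j0 (pos_uniform 0 t0) P.
  have := lower_le_evol (pos_uniform 0 t0) (total_uniform 0 t) t0 P (lexx 0).
  by have [-> _ _] := profile_lower j0 (pos_uniform 0 t0) P.
split=> //.
- move=> x x0.
  apply: le_trans (lower_le_evol (pos_uniform 0 t0) (total_uniform 0 t) t0 P x0).
  by have [_ + _] := profile_lower j0 (pos_uniform 0 t0) P; exact.
- move=> x y x0 xy; apply: lb_le_inf; first by case: (has_inf_evol t0 P x0).
  move=> _ [n _ <-]; apply: le_trans (evol_le_uniform n t0 P (le_trans x0 xy)) _.
  by have [_ _] := profile_upper j0 (pos_uniform n t0) P; exact.
Qed.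

Lemma evol_mono M M' phi phi' t : 0 < t -> profile M phi -> profile M' phi' ->
  (forall x, 0 <= x -> phi x <= phi' x) ->
  forall x, 0 <= x -> evol j phi t x <= evol j phi' t x.
Proof.
move=> t0 P P' pp x x0; apply: lb_le_inf; first by case: (has_inf_evol t0 P' x0).
move=> _ [n _ <-]; apply: le_trans (evol_le_uniform n t0 P x0) _.
exact: (upper_mono0 j0 (pos_uniform n t0) P P' pp x0).
Qed.

(** Append a step [h] to a uniform subdivision of [[0, t]]: dropping its cut raises the value, and
    the uniform upper barrier exceeds [evol j phi t] by an error that vanishes with [n]. *)
Lemma evol_le_heatF M phi t h x : 0 < t -> 0 < h -> profile M phi -> 0 <= x ->
  evol j phi (t + h) x <= heatF h (evol j phi t) x.
Proof.
move=> t0 h0 P x0; apply: (@le_harmonic _ _ (j * t)) => n.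
have jh : 0 <= j * h by rewrite mulr_ge0// ltW.
have PU := profile_upper j0 (pos_uniform n t0) P.
apply: (@le_trans _ _ (upper j (uniform_steps n t ++ [:: h]) phi x)).
  apply: (evol_le_upper _ _ (addr_gt0 t0 h0) P x0).
    by rewrite all_cat pos_uniform//= h0.
  by rewrite total_cat total_uniform /total big_seq1.
rewrite upper_cat /=.
apply: (heatF_mono h0 (profile_cutF jh PU) (profile_evol t0 P) _ _ x0).
  by rewrite divr_ge0// mulr_ge0// ltW.
move=> y y0; apply: le_trans (cutF_le jh PU y0) _.
exact: (upper_le_evol n t0 P y0).
Qed.

(** The same appended step in the lower barrier; its final cut is what costs [j h]. *)
Lemma heatF_le_evol M phi t h x : 0 < t -> 0 < h -> profile M phi -> 0 <= x ->
  heatF h (evol j phi t) x <= evol j phi (t + h) x + j * h.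
Proof.
move=> t0 h0 P x0; apply: (@le_harmonic _ _ (j * t)) => n.
have jh : 0 <= j * h by rewrite mulr_ge0// ltW.
have PL := profile_lower j0 (pos_uniform n t0) P.
apply: (@le_trans _ _ (heatF h (lower j (uniform_steps n t) phi) x + j * t / n.+1%:R)).
  apply: (heatF_mono h0 (profile_evol t0 P) PL _ _ x0).
    by rewrite divr_ge0// mulr_ge0// ltW.
  by move=> y y0; exact: (evol_le_lower n t0 P y0).
rewrite lerD2r; apply: le_trans (le_cutF _ _ jh) _; rewrite lerD2r.
have -> : cutF (j * h) (heatF h (lower j (uniform_steps n t) phi)) =
          lower j (uniform_steps n t ++ [:: h]) phi by rewrite lower_cat.
apply: (lower_le_evol _ _ (addr_gt0 t0 h0) P x0).
  by rewrite all_cat pos_uniform//= h0.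
by rewrite total_cat total_uniform /total big_seq1.
Qed.

(** Both functions are symmetric about [(0, M)], so the bounds on the half-line hold on the whole
    line, where further convolutions act. *)
Lemma evol_step M phi t h y : 0 < t -> 0 < h -> profile M phi ->
  `|odd_ext (evol j phi (t + h)) y - heat_flow h (odd_ext (evol j phi t)) y| <= j * h.
Proof.
move=> t0 h0 P; rewrite -/(heatF h (evol j phi t)).
have th0 := addr_gt0 t0 h0; have Pt := profile_evol t0 P; have Pth := profile_evol th0 P.
have jh : 0 <= j * h by rewrite mulr_ge0// ltW.
have main z : 0 <= z -> `|odd_ext (evol j phi (t + h)) z - heatF h (evol j phi t) z| <= j * h.
  move=> z0; rewrite odd_ext_ge0//.
  by rewrite ler_norml; have := evol_le_heatF t0 h0 P z0; have := heatF_le_evol t0 h0 P z0; lra.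
have [|y0] := leP 0 y; first exact: main.
have ny0 : 0 <= - y by rewrite oppr_ge0 ltW.
have := main _ ny0; rewrite (heatFN y h0 Pt) odd_extN.
have [-> _ _] := Pth; set a := odd_ext _ _; set b := heatF _ _ _.
by rewrite (_ : _ - a - _ = - (a - b)); [rewrite normrN|ring].
Qed.

(** The counterpart of [evol_step] from time [0], obtained from the subdivision with a single step;
    it drives the limit at the initial time. *)
Lemma evol_near_heatF M phi t x : 0 < t -> profile M phi -> 0 <= x ->
  `|evol j phi t x - heatF t phi x| <= j * t.
Proof.
move=> t0 P x0; have jt : 0 <= j * t by rewrite mulr_ge0// ltW.
have pt : all (fun s => 0 < s) [:: t] by rewrite /= t0.
have tt : total [:: t] = t by rewrite /total big_seq1.
have := evol_le_upper pt tt t0 P x0; have := lower_le_evol pt tt t0 P x0 => /=.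
have := le_cutF (heatF t phi) x jt.
have : heatF t (cutF (j * t) phi) x <= heatF t phi x + 0.
  apply: (heatF_mono t0 (profile_cutF jt P) P (lexx 0) _ x0) => y y0.
  by rewrite addr0; exact: (cutF_le jt P y0).
by rewrite ler_norml => ? ? ? ?; lra.
Qed.

End evolution.

(** * Continuity of the limit density *)

Section regularity.
Context {R : realType}.
Local Notation mu := (@lebesgue_measure R).
Implicit Types (x y a b c s t h e : R) (k n i : nat).

Lemma le_dyadic a b c : (forall n : nat, a <= b + c / 2 ^+ n) -> a <= b.
Proof.
move=> h; have [c0|c0] := leP 0 c; last first.
  by have := h 0%N; rewrite expr0 divr1; lra.
apply: (@le_harmonic _ _ _ c) => n; apply: le_trans (h n) _.
rewrite lerD2l ler_wpM2l// lef_pV2 ?posrE ?exprn_gt0 ?ltr0n//.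
by rewrite -natrX ler_nat ltn_expl.
Qed.

Lemma le_norm_quarters a b c d e : `|a| <= e / 4 -> `|b| <= e / 4 ->
  `|c| <= e / 4 -> `|d| <= e / 4 -> `|a - b - (c + d)| <= e.
Proof. by rewrite !ler_norml => ? ? ? ?; lra. Qed.

Lemma le_norm_perturb a b b' c c' d e : `|a + (b - c)| <= d ->
  `|b' - b| <= e -> `|c' - c| <= e -> `|a - (c' - b')| <= d + 2 * e.
Proof. by rewrite !ler_norml => ? ? ?; lra. Qed.

Lemma subr_regroup a b c d : a - b = c - d + (a - c - (b - d)).
Proof. by ring. Qed.

Lemma subr_regroup_opp a b c d : a - b = c - d - (c - a - (d - b)).
Proof. by ring. Qed.

Lemma subr_regroup3 a b p q r : a - b = (a + p) - (b + q) - ((p - r) + (r - q)).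
Proof. by ring. Qed.

Lemma dyadic_small c e : 0 < e ->
  exists K : nat, forall n, (K <= n)%N -> c / 2 ^+ n < e.
Proof.
move=> e0; have [c0|c0] := leP c 0.
  exists 0%N => n _; apply: le_lt_trans e0.
  by rewrite pmulr_lle0// invr_gt0 exprn_gt0.
exists (Num.bound (c / e)) => n Kn.
rewrite ltr_pdivrMr ?exprn_gt0// mulrC -ltr_pdivrMr//.
apply: lt_le_trans (archi_boundP (divr_ge0 (ltW c0) (ltW e0))) _.
by rewrite -natrX ler_nat (leq_trans Kn)// ltnW// ltn_expl.
Qed.

Lemma cvg_div_dyadic c : c / 2 ^+ n @[n --> \oo] --> (0 : R).
Proof.
have -> : (fun n => c / 2 ^+ n) = (fun n => c * (2^-1) ^+ n).
  by apply/funext => n; rewrite exprVn.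
rewrite -[X in _ --> X](mulr0 c); apply: cvgMr; apply: cvg_expr.
by rewrite ger0_norm// invf_lt1// ltr1n.
Qed.

(** Adding or subtracting the remaining error [c / 2 ^ i] makes the sequence monotone: [w]
    decreases, [z] increases, and their initial values bracket the limit. *)
Lemma dyadic_cauchy (u : nat -> R) c :
  (forall i, `|u i.+1 - u i| <= c / 2 ^+ i.+1) ->
  cvgn u /\ `|limn u - u 0%N| <= c.
Proof.
move=> du.
have hc i : c / 2 ^+ i = c / 2 ^+ i.+1 + c / 2 ^+ i.+1.
  by rewrite exprS; field; rewrite expf_neq0.
have c0 : 0 <= c by have := le_trans (normr_ge0 _) (du 0%N); rewrite expr1 pmulr_lge0// invr_gt0.
have cp i : 0 <= c / 2 ^+ i by rewrite divr_ge0// exprn_ge0.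
pose w i := u i + c / 2 ^+ i; pose z i := u i - c / 2 ^+ i.
have wd : nonincreasing_seq w.
  apply/nonincreasing_seqP => i; rewrite /w; have := du i; have := hc i.
  by rewrite ler_norml => ? ?; lra.
have zi : nondecreasing_seq z.
  apply/nondecreasing_seqP => i; rewrite /z; have := du i; have := hc i.
  by rewrite ler_norml => ? ?; lra.
have zw i : z i <= w i by rewrite /z /w; have := cp i; lra.
have w0 i : w i <= w 0%N by exact: wd.
have z0 i : z 0%N <= z i by exact: zi.
have cw : cvgn w.
  apply: nonincreasing_is_cvgn => //; exists (z 0%N) => _ [i _ <-].
  exact: le_trans (z0 i) (zw i).
have cu : u n @[n --> \oo] --> limn w.
  rewrite -[limn w]subr0.
  have -> : u = (fun n => w n - c / 2 ^+ n) by apply/funext => n; rewrite /w addrK.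
  by apply: cvgB; [exact: cw|exact: cvg_div_dyadic].
split; first by apply/cvg_ex; exists (limn w).
rewrite (cvg_lim _ cu)// ler_norml.
have : limn w <= w 0%N.
  by apply: limr_le => //; apply: nearW.
have : z 0%N <= limn w.
  by apply: limr_ge => //; apply: nearW => n; exact: le_trans (z0 n) (zw n).
by rewrite /z /w expr0 divr1 => ? ?; lra.
Qed.

(** [E t] stands for [odd_ext (evol j phi t)]; the regularity is drawn from boundedness, sign and
    the one-step estimate alone. *)
Variables (E : R -> R -> R) (C j : R).
Hypothesis j0 : 0 <= j.
Hypothesis bE : forall t, 0 < t -> bounded_measurable C (E t).
Hypothesis E0 : forall t y, 0 < t -> 0 <= E t y.
Hypothesis E_step : forall t h y, 0 < t -> 0 < h ->
  `|E (t + h) y - heat_flow h (E t) y| <= j * h.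

Let C0 : 0 <= C.
Proof. by have [_ /(_ 0)] := bE ltr01; exact: le_trans. Qed.

Let mul_sqrt s : 0 < s -> 3 * j * s * Num.sqrt (2 / s) = 3 * j * Num.sqrt (2 * s).
Proof.
move=> s0; rewrite -[in LHS]mulrA; congr (_ * _).
have -> : 2 * s = s ^+ 2 * (2 / s) by field; rewrite gt_eqF.
by rewrite [RHS]sqrtrM ?sqr_ge0// sqrtr_sqr gtr0_norm.
Qed.

(** By the semigroup law, [heat_flow s] maps the two functions compared here to the approximations
    of [E t] at the scales [s] and [4 s]. So these differ by an error [3 j s] that is still smoothed
    over a time [s]. *)
Let sub_bound s t y : 0 < s -> 4 * s < t ->
  `|E (t - s) y - heat_flow (3 * s) (E (t - 4 * s)) y| <= 3 * j * s.
Proof.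
move=> s0 st; have t4 : 0 < t - 4 * s by rewrite subr_gt0.
have s3 : 0 < 3 * s by rewrite mulr_gt0.
have := E_step y t4 s3; rewrite (_ : t - 4 * s + 3 * s = t - s); last by ring.
by rewrite (_ : 3 * j * s = j * (3 * s)); last ring.
Qed.

Let bsub s t : 0 < s -> 4 * s < t -> bounded_measurable (3 * j * s)
  (fun y => E (t - s) y - heat_flow (3 * s) (E (t - 4 * s)) y).
Proof.
move=> s0 st; have t4 : 0 < t - 4 * s by rewrite subr_gt0.
have ts : 0 < t - s by lra.
split; last by move=> y; exact: sub_bound.
apply: measurable_funB; first by case: (bE ts).
have s3 : 0 < 3 * s by rewrite mulr_gt0.
by case: (bounded_heat_flow s3 (bE t4)).
Qed.

(** The first term is the bound at the coarsest scale [t / 2]; the second is the sum of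
    [3 j sqrt t / 2 ^ n] over [n >= 1]. *)
Definition lip_const t := C * Num.sqrt (4 / t) + 3 * j * Num.sqrt t.

(** The telescoping over scales is done on differences of values and not on derivatives, because
    [heat_slope_flow], on which the comparison of slopes relies, already asks for a Lipschitz
    bound. *)
Lemma E_lipschitz t x y : 0 < t -> `|E t x - E t y| <= lip_const t * `|x - y|.
Proof.
(* Starting at [t / 2] keeps [t - s n] positive; with ratio [4] the increments, of order
   [sqrt (s n)], halve each time. *)
move=> t0; pose s n := t / 2 / (2 ^+ n) ^+ 2.
have s0 n : 0 < s n by rewrite !divr_gt0// exprn_gt0// exprn_gt0.
have s4 n : s n = 4 * s n.+1.
  by rewrite /s (exprS 2); field; rewrite expf_neq0.
have sd n : s n.+1 <= s n by rewrite (s4 n); have := s0 n.+1; lra.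
have st n : s n < t.
  elim: n => [|n]; last exact: le_lt_trans.
  by rewrite /s expr0 expr1n divr1 ltr_pdivrMr// ltr_pMr// ltr1n.
have ts n : 0 < t - s n by rewrite subr_gt0.
pose f n := heat_flow (s n) (E (t - s n)).
have fE n z : `|E t z - f n z| <= j * s n.
  by have := E_step z (ts n) (s0 n); rewrite subrK.
have fL n : `|f n x - f n y| <=
    (C * Num.sqrt (4 / t) + 3 * j * Num.sqrt t * (1 - (2 ^+ n)^-1)) * `|x - y|.
  elim: n => [|n IH].
    have -> : 1 - (2 ^+ 0)^-1 = 0 :> R by rewrite expr0 invr1 subrr.
    rewrite mulr0 addr0.
    have := heat_flow_lipschitz x y (s0 0%N) (bE (ts 0%N)).
    have -> // : 2 / s 0%N = 4 / t.
    by rewrite /s expr0 expr1n divr1; field; rewrite gt_eqF.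
  have s30 : 0 < 3 * s n.+1 by rewrite mulr_gt0.
  have st4 : 4 * s n.+1 < t by rewrite -s4.
  have b1 := bsub (s0 n.+1) st4.
  have t4 : 0 < t - 4 * s n.+1 by rewrite subr_gt0.
  have fn z : f n z = heat_flow (s n.+1) (heat_flow (3 * s n.+1) (E (t - 4 * s n.+1))) z.
    rewrite (heat_flow_semigroup z (s0 n.+1) s30 (bE t4) (fun y => E0 y t4)).
    by rewrite /f s4; congr (heat_flow _ _ z); ring.
  have fd z : f n.+1 z - f n z = heat_flow (s n.+1)
      (fun y => E (t - s n.+1) y - heat_flow (3 * s n.+1) (E (t - 4 * s n.+1)) y) z.
    by rewrite fn (heat_flowB z (s0 n.+1) (bE (ts n.+1)) (bounded_heat_flow s30 (bE t4))).
  have := heat_flow_lipschitz x y (s0 n.+1) b1; rewrite -!fd mul_sqrt//.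
  have -> : Num.sqrt (2 * s n.+1) = Num.sqrt t / 2 ^+ n.+1.
    have -> : 2 * s n.+1 = t * ((2 ^+ n.+1)^-1) ^+ 2.
      by rewrite /s exprVn; field; rewrite expf_neq0.
    by rewrite sqrtrM ?ltW// sqrtr_sqr ger0_norm// invr_ge0 exprn_ge0.
  have hn : (2 ^+ n)^-1 = 2 * (2 ^+ n.+1)^-1 :> R.
    by rewrite [in RHS]exprS; field; rewrite expf_neq0.
  rewrite hn in IH; move: IH; set d := `|x - y|; set p := (2 ^+ n.+1)^-1.
  set q := Num.sqrt t; set r := C * _ => IH D.
  have : `|f n.+1 x - f n.+1 y| <= `|f n x - f n y| + `|f n.+1 x - f n x - (f n.+1 y - f n y)|.
    by rewrite [X in `|X| <= _](subr_regroup _ _ (f n x) (f n y)) ler_normD.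
  move=> /le_trans; apply; apply: le_trans (lerD IH D) _.
  by rewrite le_eqVlt; apply/orP; left; apply/eqP; ring.
(* [f n] is within [j s n] of [E t] at both points, so the uniform Lipschitz bound passes to the
   limit. *)
apply: (@le_dyadic _ _ (j * t)) => n.
have fL' : `|f n x - f n y| <= lip_const t * `|x - y|.
  apply: le_trans (fL n) _; rewrite ler_wpM2r// lerD2l.
  by rewrite ler_piMr ?gerBl ?invr_ge0 ?exprn_ge0 ?mulr_ge0 ?sqrtr_ge0.
have sn : 2 * (j * s n) <= j * t / 2 ^+ n.
  have -> : 2 * (j * s n) = j * t * ((2 ^+ n) ^+ 2)^-1.
    by rewrite /s; field; rewrite expf_neq0.
  rewrite ler_wpM2l ?mulr_ge0 ?(ltW t0)// lef_pV2 ?posrE ?exprn_gt0// ?exprn_gt0//.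
  by rewrite expr2 ler_peMr ?exprn_ge0// exprn_ege1// ler1n.
apply: le_trans (lerD fL' sn); rewrite (subr_regroup_opp (E t x) _ (f n x) (f n y)).
apply: le_trans (ler_normB _ _) _; rewrite lerD2l mulr_natl mulr2n.
by apply: le_trans (ler_normB _ _) _; apply: lerD; rewrite distrC fE.
Qed.

Definition approx_slope t s x := heat_slope s (E (t - s)) x.

Lemma approx_slope_quarter t s x : 0 < s -> 4 * s < t ->
  `|approx_slope t s x - approx_slope t (4 * s) x| <= 3 * j * Num.sqrt (2 * s).
Proof.
move=> s0 st; have t4 : 0 < t - 4 * s by rewrite subr_gt0.
have ts : 0 < t - s by lra.
have s3 : 0 < 3 * s by rewrite mulr_gt0.
have -> : approx_slope t (4 * s) x = heat_slope s (heat_flow (3 * s) (E (t - 4 * s))) x.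
  rewrite (heat_slope_flow x s0 s3 (bE t4) (fun y => E0 y t4) (fun y z => E_lipschitz y z t4)).
  by rewrite /approx_slope; congr (heat_slope _ _ x); ring.
rewrite /approx_slope -(heat_slopeB x s0 (bE ts) (bounded_heat_flow s3 (bE t4))).
by rewrite -mul_sqrt//; exact: (le_norm_heat_slope x s0 (bsub s0 st)).
Qed.

(** [4 ^ - k], written through a square so that its root is plainly [2 ^ - k]. *)
Definition scale k : R := ((2 ^+ k) ^+ 2)^-1.

Lemma scale_gt0 k : 0 < scale k.
Proof. by rewrite invr_gt0 !exprn_gt0. Qed.

Lemma scale4 k : scale k = 4 * scale k.+1.
Proof. by rewrite /scale (exprS 2); field; rewrite expf_neq0. Qed.

Lemma scale_le k : scale k <= (2 ^+ k)^-1.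
Proof.
rewrite lef_pV2 ?posrE ?exprn_gt0// expr2 ler_peMr ?exprn_ge0//.
by rewrite exprn_ege1// ler1n.
Qed.

Lemma scale_anti k i : scale (k + i) <= scale k.
Proof.
elim: i => [|i IH]; first by rewrite addn0.
by rewrite addnS; apply: le_trans IH; rewrite (scale4 (k + i)); have := scale_gt0 (k + i).+1; lra.
Qed.

(* [E t] is within [j s] of [heat_flow s (E (t - s))], and differentiating a heat
   flow over a time [s] costs [s ^ (-1/2)]: the successive approximations at the
   scales [4 ^ - k] differ by [O(2 ^ - k)]. *)
Definition slope t x := - limn (fun k => approx_slope t (scale k) x).

(** The approximations move by halving amounts, so the distance to their limit is of the order of
    the first increment. A plus sign appears because [slope], the density of a tail, is minus a
    derivative. *)
Lemma slope_close t k x : scale k < t ->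
  `|slope t x + approx_slope t (scale k) x| <= 3 * j * Num.sqrt 2 / 2 ^+ k.
Proof.
(* The sequence starts at [k], from where on [t - scale i] is positive. *)
move=> kt; pose u i := approx_slope t (scale (i + k)) x.
have du i : `|u i.+1 - u i| <= 3 * j * Num.sqrt 2 / 2 ^+ k / 2 ^+ i.+1.
  rewrite /u addSn (scale4 (i + k)).
  apply: le_trans (approx_slope_quarter x (scale_gt0 _) _) _.
    by rewrite -scale4 addnC; exact: le_lt_trans (scale_anti k i) kt.
  rewrite sqrtrM// -!mulrA ler_wpM2l// ler_wpM2l// ler_wpM2l ?sqrtr_ge0//.
  rewrite /scale -exprVn sqrtr_sqr ger0_norm ?invr_ge0 ?exprn_ge0//.
  by rewrite -invfM -exprD addnS [(k + i)%N]addnC.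
have [cu lu] := dyadic_cauchy du.
have -> : slope t x = - limn u.
  congr (- _); apply/cvg_lim => //.
  have cu' : u n @[n --> \oo] --> limn u by exact: cu.
  rewrite -(cvg_shiftn k); exact: cu'.
by rewrite addrC -opprB normrN; exact: lu.
Qed.

Lemma approx_lipschitz t s x y : 0 < s -> s < t ->
  `|approx_slope t s x - approx_slope t s y| <=
  lip_const (t - s) * Num.sqrt (2 / s) * `|x - y|.
Proof.
move=> s0 st; have ts : 0 < t - s by rewrite subr_gt0.
by apply: (heat_slope_lipschitz x y s0 (bE ts)) => z w; exact: E_lipschitz.
Qed.

(** Replacing [E t] by the heat flow of [E t'] costs [j |t - t'|], and that flow moves a Lipschitz
    function by the square root of the elapsed time. The constant majorises [lip_const] on
    [[a, b]]. *)
Lemma E_time a b t t' y : 0 < a -> a <= t -> t <= b -> a <= t' -> t' <= b ->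
  `|E t y - E t' y| <= j * `|t - t'| +
     (C * Num.sqrt (4 / a) + 3 * j * Num.sqrt b) * Num.sqrt (2 * `|t - t'|).
Proof.
move=> a0; wlog tt : t t' / t' < t.
  move=> h; have [tt|tt|->] := ltgtP t t' => at_ tb at' t'b.
  - by rewrite distrC (distrC t); exact: h.
  - exact: h.
  - by rewrite !subrr normr0 !mulr0 sqrtr0 mulr0 addr0.
move=> at_ tb at' t'b; have h0 : 0 < t - t' by rewrite subr_gt0.
have t'0 : 0 < t' by exact: lt_le_trans at'.
rewrite (gtr0_norm h0).
have := E_step y t'0 h0; rewrite (_ : t' + (t - t') = t); last by ring.
move=> e1.
have lc0 : 0 <= lip_const t'.
  by have := le_trans (normr_ge0 _) (E_lipschitz 1 0 t'0); rewrite subr0 normr1 mulr1.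
have e2 : `|heat_flow (t - t') (E t') y - E t' y| <=
    0 + lip_const t' * Num.sqrt (2 * (t - t')).
  by apply: (heat_flow_close h0 (bE t'0) _ lc0) => z; rewrite add0r; exact: E_lipschitz.
have lc : lip_const t' <= C * Num.sqrt (4 / a) + 3 * j * Num.sqrt b.
  apply: lerD; last by rewrite ler_wpM2l ?mulr_ge0// ler_wsqrtr.
  rewrite ler_wpM2l// ler_wsqrtr// ler_wpM2l// lef_pV2//.
have -> : E t y - E t' y = (E t y - heat_flow (t - t') (E t') y) + (heat_flow (t - t') (E t') y - E t' y) by ring.
apply: le_trans (ler_normD _ _) _; apply: lerD => //.
by apply: le_trans e2 _; rewrite add0r ler_wpM2r// sqrtr_ge0.
Qed.

Lemma E_time_continuous t e : 0 < t -> 0 < e -> exists2 d, 0 < d &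
  forall t' y, `|t - t'| < d -> 0 < t' /\ `|E t y - E t' y| <= e.
Proof.
move=> t0 e0.
pose L := C * Num.sqrt (4 / (t / 2)) + 3 * j * Num.sqrt (2 * t).
have L0 : 0 <= L by rewrite addr_ge0 ?mulr_ge0 ?sqrtr_ge0.
(* [d1] controls the linear term and [d2] the square root, by [e / 2] each; the [+ 1] keeps the
   divisors positive. *)
pose d1 := e / 2 / (j + 1); pose d2 := (e / 2 / (L + 1)) ^+ 2 / 2.
have j1 : 0 < j + 1 by rewrite ltr_wpDl.
have L1 : 0 < L + 1 by rewrite ltr_wpDl.
have d10 : 0 < d1 by rewrite !divr_gt0.
have d20 : 0 < d2 by rewrite divr_gt0// exprn_gt0// !divr_gt0.
exists (Num.min (t / 2) (Num.min d1 d2)); first by rewrite !lt_min d10 d20 divr_gt0.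
move=> t' y; rewrite !lt_min => /and3P[h1 h2 h3].
move: (h1); rewrite ltr_norml => /andP[? ?].
have t'0 : 0 < t' by lra.
split=> //; apply: (@le_trans _ _ (e / 2 + e / 2)); last by rewrite -splitr.
apply: (le_trans (@E_time (t / 2) (2 * t) t t' y _ _ _ _ _)); rewrite ?divr_gt0//; try lra.
apply: lerD.
  move/ltW : h2; rewrite ler_pdivlMr// => h2.
  by apply: le_trans h2; rewrite mulrC ler_wpM2l// lerDl.
rewrite -/L.
have : Num.sqrt (2 * `|t - t'|) <= e / 2 / (L + 1).
  have w0 : 0 <= e / 2 / (L + 1) by rewrite ltW// !divr_gt0.
  rewrite -[leRHS](ger0_norm w0) -[leRHS]sqrtr_sqr; apply: ler_wsqrtr.
  by move/ltW : h3; rewrite /d2 ler_pdivlMr// mulrC.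
rewrite ler_pdivlMr// => h4; apply: le_trans h4.
by rewrite mulrC ler_wpM2l ?sqrtr_ge0// lerDl.
Qed.

(** Fix a scale at which both slopes are within [e / 4] of their approximations. At a fixed scale
    the approximation is Lipschitz in [x], and in [t] it inherits the continuity of [E], which is
    uniform in space. *)
Lemma slope_continuous t x e : 0 < t -> 0 < e -> exists2 d, 0 < d &
  forall t' x', `|t - t'| < d -> `|x - x'| < d -> `|slope t x - slope t' x'| <= e.
Proof.
move=> t0 e0; have e40 : 0 < e / 4 by rewrite divr_gt0.
pose c := 3 * j * Num.sqrt 2.
have c0 : 0 <= c by rewrite !mulr_ge0// sqrtr_ge0.
have [k kt ke] : exists2 k, scale k < t / 2 & c / 2 ^+ k <= e / 4.
  have t20 : 0 < t / 2 by rewrite divr_gt0.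
  have [n1 H1] := dyadic_small 1 t20; have [n2 H2] := dyadic_small c e40.
  exists (maxn n1 n2); last by rewrite ltW// H2// leq_maxr.
  by apply: le_lt_trans (scale_le _) _; rewrite -div1r H1// leq_maxl.
set s := scale k in kt; have s0 : 0 < s := scale_gt0 k.
have st : s < t by rewrite (lt_trans kt)// ltr_pdivrMr// ltr_pMr// ltr1n.
have ts0 : 0 < t - s by rewrite subr_gt0.
pose q := Num.sqrt (2 / s); have q0 : 0 < q by rewrite sqrtr_gt0 divr_gt0.
have [d1 d10 D1] := E_time_continuous ts0 (divr_gt0 e40 q0).
pose L := lip_const (t - s) * q.
have L0 : 0 <= L.
  rewrite mulr_ge0 ?(ltW q0)//.
  by have := le_trans (normr_ge0 _) (E_lipschitz 1 0 ts0); rewrite subr0 normr1 mulr1.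
have L1 : 0 < L + 1 by rewrite ltr_wpDl.
exists (Num.min (t / 2) (Num.min d1 (e / 4 / (L + 1)))).
  by rewrite !lt_min d10 !divr_gt0.
move=> t' x'; rewrite !lt_min => /and3P[h1 h2 _] /and3P[_ _ h3].
move: (h1); rewrite ltr_norml => /andP[? ?].
have st' : s < t' by lra.
have t's0 : 0 < t' - s by rewrite subr_gt0.
have a1 := slope_close x st; have a2 := slope_close x' st'.
have a3 : `|approx_slope t s x - approx_slope t s x'| <= e / 4.
  apply: le_trans (approx_lipschitz x x' s0 st) _; rewrite -/q -/L.
  move/ltW : h3; rewrite ler_pdivlMr// => h3.
  by apply: le_trans h3; rewrite mulrC ler_wpM2l// lerDl.
have a4 : `|approx_slope t s x' - approx_slope t' s x'| <= e / 4.
  rewrite /approx_slope -(heat_slopeB x' s0 (bE ts0) (bE t's0)).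
  have bd : bounded_measurable (e / 4 / q) (fun y => E (t - s) y - E (t' - s) y).
    split; first by apply: measurable_funB; [case: (bE ts0)|case: (bE t's0)].
    by move=> y; apply: (D1 _ y _).2; rewrite (_ : _ - _ = t - t')//; ring.
  by apply: le_trans (le_norm_heat_slope x' s0 bd) _; rewrite -/q divfK// gt_eqF.
rewrite (subr_regroup3 _ _ (approx_slope t s x) (approx_slope t' s x') (approx_slope t s x')).
by apply: le_norm_quarters => //; [exact: le_trans a1 ke|exact: le_trans a2 ke].
Qed.

Lemma continuous_slope t : 0 < t -> continuous (slope t).
Proof.
move=> t0 x; apply/cvgrPdist_le => e e0.
have [d d0 D] := slope_continuous x t0 e0.
near=> y; apply: D; first by rewrite subrr normr0.
by near: y; apply: cvgr_dist_lt; [exact: cvg_id|].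
Unshelve. all: by end_near. Qed.

Lemma slope_bounded t : 0 < t -> exists B, forall x, `|slope t x| <= B.
Proof.
move=> t0.
have [k kt] : exists k, scale k < t.
  have [n H] := dyadic_small 1 t0.
  by exists n; apply: le_lt_trans (scale_le _) _; rewrite -div1r H.
have ts : 0 < t - scale k by rewrite subr_gt0.
exists (3 * j * Num.sqrt 2 / 2 ^+ k + C * Num.sqrt (2 / scale k)) => x.
rewrite -[slope t x](addrK (approx_slope t (scale k) x)).
apply: le_trans (ler_normB _ _) _; apply: lerD; first exact: slope_close.
exact: (le_norm_heat_slope x (scale_gt0 k) (bE ts)).
Qed.

Lemma integrable_slope t a b : 0 < t -> mu.-integrable `[a, b] (EFin \o slope t).
Proof.
move=> t0; apply: continuous_compact_integrable; first exact: segment_compact.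
by apply: continuous_subspaceT; exact: continuous_slope.
Qed.

(** The approximations integrate exactly by [Rintegral_heat_slope] and are uniformly close to
    [slope], so on a bounded interval the identity holds up to [O(2 ^ - k)]. *)
Lemma Rintegral_slope t a b : 0 < t -> a < b ->
  \int[mu]_(x in `[a, b]) slope t x = E t a - E t b.
Proof.
move=> t0 ab; pose c := 3 * j * Num.sqrt 2.
have c0 : 0 <= c by rewrite !mulr_ge0// sqrtr_ge0.
have [K HK] := dyadic_small 1 t0.
have main n : `|\int[mu]_(x in `[a, b]) slope t x - (E t a - E t b)| <=
    (c * (b - a) + 2 * j) / 2 ^+ (n + K).
  set k := (n + K)%N.
  have kt : scale k < t.
    by apply: le_lt_trans (scale_le _) _; rewrite -div1r HK// leq_addl.
  have ts : 0 < t - scale k by rewrite subr_gt0.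
  have s0 := scale_gt0 k.
  have [ih hE] := Rintegral_heat_slope s0 (bE ts) ab.
  have iS := integrable_slope a b t0.
  have mab : measurable ([set` `[a, b]] : set (measurableTypeR R)) by exact: measurable_itv.
  have iD := integrableD mab iS ih.
  have : `|\int[mu]_(x in `[a, b]) (slope t x + approx_slope t (scale k) x)| <= c / 2 ^+ k * (b - a).
    apply: (bounded_interval_Rintegral ab) => [|x _]; last exact: slope_close.
    exact: eq_integrable iD.
  rewrite RintegralD// hE.
  have e1 := E_step a ts s0; have e2 := E_step b ts s0; move: e1 e2; rewrite !subrK.
  have sk : j * scale k <= j / 2 ^+ k by rewrite ler_wpM2l// scale_le.
  have -> : (c * (b - a) + 2 * j) / 2 ^+ k = c / 2 ^+ k * (b - a) + 2 * (j / 2 ^+ k) by ring.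
  by move=> e1 e2 e3; apply: le_norm_perturb e3 _ _; [exact: le_trans e2 sk|exact: le_trans e1 sk].
apply/eqP; rewrite -subr_eq0 -normr_le0.
apply: (@le_dyadic _ _ ((c * (b - a) + 2 * j) / 2 ^+ K)) => n.
by rewrite add0r; apply: le_trans (main n) _; rewrite addnC exprD invfM mulrA.
Qed.

Lemma slope_ge0 t x : 0 < t -> (forall y z, y <= z -> E t z <= E t y) ->
  0 <= slope t x.
Proof.
move=> t0 Et; apply: (@right_limit_ge0 _ _ x 1) => //.
- by move=> b _; exact: integrable_slope.
- by move=> b /andP[xb _]; rewrite Rintegral_slope// subr_ge0 Et// ltW.
- by apply: cvg_at_right_filter; exact: continuous_slope.
Qed.

End regularity.

(** * Barriers of measures *)

Section interval_integrals.
Context {R : realType}.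
Local Notation mu := (@lebesgue_measure R).

Lemma within_continuous_dist (A : set R) (f : R -> R) (x e : R) :
  {within A, continuous f} -> A x -> 0 < e -> exists2 d, 0 < d &
  forall y, A y -> `|x - y| < d -> `|f x - f y| <= e.
Proof.
move=> /subspace_continuousP cf Ax e0.
have /cvgrPdist_le /(_ _ e0) := cf x Ax.
by move=> [d /= d0 D]; exists d => // y Ay xy; exact: D.
Qed.

Lemma dist_within_continuous (A : set R) (f : R -> R) :
  (forall x e, A x -> 0 < e -> exists2 d, 0 < d &
    forall y, A y -> `|x - y| < d -> `|f x - f y| <= e) ->
  {within A, continuous f}.
Proof.
move=> h; apply/subspace_continuousP => x Ax; apply/cvgrPdist_le => e e0.
by have [d d0 D] := h x e Ax e0; exists d => //= y xy Ay; exact: D.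
Qed.

Lemma cvg_integral_half_line (g : R -> R) (a : R) :
  (forall x, a <= x -> 0 <= g x) -> measurable_fun `[a, +oo[ g ->
  (\int[mu]_(x in `[a, (a + n%:R)%R]) (g x)%:E)%E @[n --> \oo] -->
  (\int[mu]_(x in `[a, +oo[) (g x)%:E)%E.
Proof.
move=> g0 mg; rewrite itv_bndy_bigcup_BRight.
apply: (@ge0_nondecreasing_set_cvg_integral _ (measurableTypeR R) R
  (fun n : nat => `[a, a + n%:R]%classic) (EFin \o g) mu).
- move=> m n mn; apply/subsetPset => x /=; rewrite !in_itv/= => /andP[-> xm].
  by rewrite (le_trans xm)// lerD2l ler_nat.
- by move=> n; exact: measurable_itv.
- move=> n; apply/measurable_EFinP; apply: measurable_funS mg => //.
  by move=> x /=; rewrite !in_itv/= andbT => /andP[].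
- by move=> n x /=; rewrite in_itv/= => /andP[ax _]; rewrite lee_fin g0.
Qed.

End interval_integrals.

(** * Tails of integrable densities and the cut radius *)

Section tails.
Context {R : realType}.
Local Notation mu := (@lebesgue_measure R).
Implicit Types (r s x y e : R).
Variable g : R -> R.
Hypothesis g0 : forall x, 0 <= x -> 0 <= g x.
Hypothesis ig : mu.-integrable Rplus (EFin \o g).

Definition tail r := \int[mu]_(x in `[r, +oo[) g x.

Let ig_ r : 0 <= r -> mu.-integrable `[r, +oo[ (EFin \o g).
Proof.
move=> r0; apply: integrableS ig => //; first exact: measurable_itv.
by apply: subset_itvr; rewrite bnd_simp.
Qed.

Lemma tail_split r s : 0 <= r -> r <= s ->
  tail r = \int[mu]_(x in `[r, s]) g x + tail s.
Proof.
move=> r0 rs; apply/eqP; rewrite addrC -subr_eq; apply/eqP.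
rewrite /tail Rintegral_itvB//; [|exact: ig_].
by rewrite Rintegral_itv_obnd_cbnd//; apply: integrableS (ig_ (le_trans r0 rs)) => //; apply: subset_itvr; rewrite bnd_simp.
Qed.

Lemma tail_ge0 r : 0 <= r -> 0 <= tail r.
Proof.
move=> r0; apply: Rintegral_ge0 => x /=; rewrite in_itv/= andbT => rx.
exact/g0/(le_trans r0).
Qed.

Lemma tail_anti r s : 0 <= r -> r <= s -> tail s <= tail r.
Proof.
move=> r0 rs; rewrite (tail_split r0 rs) lerDr; apply: Rintegral_ge0 => x /=.
by rewrite in_itv/= => /andP[rx _]; exact/g0/(le_trans r0).
Qed.

Lemma tail_within (b : R) : 0 <= b -> {within `[0, b], continuous tail}.
Proof.
move=> b0.
have ib : mu.-integrable `[0, b] (EFin \o g).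
  apply: integrableS ig => //; first exact: measurable_itv.
  by move=> x /=; rewrite /Rplus/= !in_itv/= => /andP[->].
have h := parameterized_integral_continuous b0 ib.
apply: dist_within_continuous => x e xb e0.
have [d d0 D] := within_continuous_dist h xb e0; exists d => // y yb xy.
have := D y yb xy; rewrite /parameterized_integral.
have E z : [set` `[0, b]] z -> \int[mu]_(w in `[0, z]) g w = tail 0 - tail z.
  by rewrite /= in_itv/= => /andP[z0 _]; rewrite (tail_split (lexx 0) z0) addrK.
by rewrite !E// distrC (_ : _ - _ - _ = tail x - tail y)//; ring.
Qed.

Lemma tail_continuous r e : 0 <= r -> 0 < e -> exists2 d, 0 < d &
  forall y, 0 <= y -> `|r - y| < d -> `|tail r - tail y| <= e.
Proof.
move=> r0 e0.
have r10 : 0 <= r + 1 by rewrite addr_ge0.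
have rr : [set` `[0, r + 1]] r by rewrite /= in_itv/= r0 lerDl ler01.
have [d d0 D] := within_continuous_dist (tail_within r10) rr e0.
exists (Num.min d 1); first by rewrite lt_min d0 ltr01.
move=> y y0; rewrite lt_min => /andP[yd y1]; apply: D => //.
rewrite /= in_itv/= y0/=; move: y1; rewrite ltr_norml => /andP[]; lra.
Qed.

Lemma tail_small e : 0 < e -> exists2 A, 0 <= A & tail A < e.
Proof.
move=> e0.
have mg : measurable_fun [set` `[(0 : R), +oo[] g.
  by apply/measurable_EFinP; apply: measurable_int ig.
have := cvg_integral_half_line g0 mg.
have -> : (\int[mu]_(x in `[0%R, +oo[) (g x)%:E = (tail 0)%:E)%E.
  by rewrite /tail /Rintegral fineK//; apply: (integrable_fin_num _ ig); exact: measurable_itv.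
have nE (n : nat) : (\int[mu]_(x in `[0%R, (0 + n%:R)%R]) (g x)%:E)%E = (tail 0 - tail n%:R)%:E.
  rewrite add0r (tail_split (lexx 0) (ler0n _ n)) addrK /Rintegral fineK//.
  apply: integrable_fin_num; first exact: measurable_itv.
  apply: integrableS ig => //; first exact: measurable_itv.
  by move=> x /=; rewrite /Rplus/= !in_itv/= => /andP[->].
under eq_cvg do rewrite nE.
move=> /fine_cvg /= /cvgrPdist_lt /(_ _ e0) [n _ /(_ n (leqnn n))] /=.
rewrite opprB addrC subrK ger0_norm ?tail_ge0// => h.
by exists n%:R.
Qed.

(** The intermediate value theorem gives a point at level [c], and continuity puts the infimum of
    such points at the same level: the cut radius is finite and attained. *)
Lemma tail_level c : 0 < c -> c < tail 0 -> exists2 r, 0 < r &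
  tail r = c /\ forall s, 0 <= s -> tail s = c -> r <= s.
Proof.
move=> c0 c1.
have [A A0 Ac] := tail_small c0.
have [r1 r1A r1c] : exists2 x, x \in `[0, A] & tail x = c.
  apply: IVT => //; first exact: tail_within.
  by rewrite ge_min le_max (ltW Ac) (ltW c1) orbT.
pose S := [set r | 0 <= r /\ tail r = c].
have S1 : S r1 by split=> //; move: r1A; rewrite in_itv/= => /andP[].
have hS : has_inf S by split; [exists r1|exists 0 => x []].
have i0 : 0 <= inf S by apply: lb_le_inf; [exists r1|move=> x []].
have ic : tail (inf S) = c.
  apply/eqP; rewrite -subr_eq0 -normr_le0; apply/ler_addgt0Pr => e e0; rewrite add0r.
  have [d d0 D] := tail_continuous i0 e0.
  have [s [s0 sc] sd] := inf_adherent d0 hS.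
  rewrite -sc; apply: D => //; rewrite ler0_norm; last by rewrite subr_le0 ge_inf//; case: hS.
  by rewrite opprB ltrBlDl.
exists (inf S); last by split=> // s s0 sc; apply: ge_inf => //; case: hS.
by rewrite lt_neqAle i0 andbT; apply/eqP => i; move: c1; rewrite i ic ltxx.
Qed.

End tails.

(** The [L^1] part of [in_U], which both steps of a barrier propagate; the [L^oo] bound on the final
    density comes from [slope_bounded]. *)
Definition integrable_umeas (R : realType) (u : umeas R) : Prop :=
  [/\ 0 <= atom u, forall x, 0 <= x -> 0 <= dens u x
    & (@lebesgue_measure R).-integrable Rplus (EFin \o dens u)].

Section tail_profiles.
Context {R : realType}.
Local Notation mu := (@lebesgue_measure R).
Implicit Types (u : umeas R) (r x : R).

Lemma F_tail r u : F r u = atom u * (r == 0)%:R + tail (dens u) r.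
Proof. by []. Qed.

Lemma F_tail_gt0 r u : 0 < r -> F r u = tail (dens u) r.
Proof. by move=> r0; rewrite F_tail gt_eqF// mulr0 add0r. Qed.

Lemma profile_F u : integrable_umeas u -> profile (F 0 u) (fun r => F r u).
Proof.
move=> [a0 d0 id]; split=> //.
- by move=> x x0; rewrite F_tail addr_ge0 ?mulr_ge0// tail_ge0.
- move=> x y x0 xy; rewrite !F_tail lerD ?tail_anti// ler_wpM2l// ler_nat.
  case: (eqVneq y 0) => // y0; rewrite (_ : x == 0)//.
  by apply/eqP/le_anti; rewrite x0 -y0 xy.
Qed.

(** Up to the radius [r0] at which the tail equals [c], the cut takes exactly [c] off the tail;
    beyond [r0] nothing is left. At [0] the pasted atom restores the mass. *)
Lemma integrable_cut_paste j delta u : 0 < j * delta -> integrable_umeas u ->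
  j * delta < F 0 (of_dens (dens u)) ->
  integrable_umeas (cut_paste j delta u) /\
  (forall r, 0 <= r -> F r (cut_paste j delta u) = cutF (j * delta) (fun r => F r u) r).
Proof.
set c := j * delta => c0 [a0 d0 id]; rewrite F_tail/= mul0r add0r => ct.
have [r0 r00 [r0c r0m]] := tail_level d0 id c0 ct.
have fl : first_at_level c u = r0%:E.
  apply/eqP; rewrite eq_le; apply/andP; split.
    by apply: ereal_inf_lbound; exists r0 => //; split; [exact: ltW|rewrite F_tail_gt0].
  apply: le_ereal_inf_tmp => _ [s [s0 sc] <-]; rewrite lee_fin.
  (* The level is not attained at [0], where [F] also counts the atom and the density alone already
     exceeds [c]. *)
  apply: r0m => //; have := sc; rewrite F_tail; case: (eqVneq s 0) => [s00|_].
    rewrite s00 mulr1 => h; have : tail (dens u) 0 <= c by rewrite -h lerDr.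
    by move=> /(lt_le_trans ct); rewrite ltxx.
  by rewrite mulr0 add0r.
pose g r := if r <= r0 then dens u r else 0.
have cE : dens (cut_paste j delta u) = g.
  by apply/funext => r; rewrite /cut_paste/= -/c fl lee_fin.
have gE : g = dens u \_ `]-oo, r0].
  by apply/funext => r; rewrite patchE mem_setE in_itv.
have g0 x : 0 <= x -> 0 <= g x by move=> x0; rewrite /g; case: ifP => // _; exact: d0.
have ig : mu.-integrable Rplus (EFin \o g).
  rewrite gE -restrict_EFin; apply/integrable_restrict => //.
    exact: measurable_itv.
  apply: integrableS id => //; first exact: measurable_itv.
  by apply: measurableI; exact: measurable_itv.
split.
  by split; [rewrite /= addr_ge0// ltW|rewrite cE|rewrite cE].
have tg0 r : r0 < r -> tail g r = 0.
  move=> rr; rewrite /tail -[RHS](@Rintegral_set0 _ _ _ mu (cst 0)) Rintegral_mkcond [RHS]Rintegral_mkcond.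
  congr fine; apply: eq_integral => x _; rewrite !patchE in_set0.
  case: ifPn => //; rewrite inE/= in_itv/= andbT => rx.
  by rewrite /g leNgt (lt_le_trans rr rx).
have tgr r : 0 <= r -> r <= r0 -> tail g r = tail (dens u) r - c.
  move=> r_0 rr0; rewrite -r0c (tail_split id r_0 rr0) addrK.
  (* The cut keeps the endpoint [r0], which is a null set. *)
  have tr0 : tail g r0 = 0.
    rewrite /tail -Rintegral_itv_obnd_cbnd.
      rewrite -[RHS](@Rintegral_set0 _ _ _ mu (cst 0)) Rintegral_mkcond [RHS]Rintegral_mkcond.
      congr fine; apply: eq_integral => x _; rewrite !patchE in_set0.
      case: ifPn => //; rewrite inE/= in_itv/= andbT => rx.
      by rewrite /g leNgt rx.
    apply: integrableS ig => //; first exact: measurable_itv.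
    move=> x /=; rewrite /Rplus/= !in_itv/= !andbT => /ltW h.
    exact: le_trans (ltW r00) h.
  rewrite (tail_split ig r_0 rr0) tr0 addr0.
  by apply: eq_Rintegral => x; rewrite inE/= in_itv/= /g => /andP[_ ->].
move=> r r_0; rewrite F_tail cE /cutF -/c /=.
case: (eqVneq r 0) => [->|rn0].
  rewrite -/c (tgr _ (lexx 0) (ltW r00)) F_tail eqxx !mulr1; ring.
have rp : 0 < r by rewrite lt_neqAle eq_sym rn0.
rewrite mulr0 add0r F_tail_gt0//; have [rr0|rr0] := leP r r0.
  rewrite tgr// max_l// subr_ge0 -r0c; exact: tail_anti.
rewrite tg0// max_r// subr_le0 -r0c; apply: tail_anti => //; exact: ltW.
Qed.

End tail_profiles.

(** * The Neumann evolution of a measure, seen on tails *)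

Section free_evolution.
Context {R : realType}.
Local Notation mu := (@lebesgue_measure R).
Implicit Types (u : umeas R) (r t x y z : R).

(* [odd_ext] of the tail of [D_z] is the indicator of [y <= z] plus that of [y < -z]. *)
Definition half0 : R -> R := \1_[set` `[(0 : R), +oo[].
Definition half1 : R -> R := \1_[set` `](0 : R), +oo[].

Lemma half0E x : half0 x = (0 <= x)%R%:R.
Proof. by rewrite /half0 indicE mem_setE in_itv/= andbT. Qed.

Lemma half1E x : half1 x = (0 < x)%R%:R.
Proof. by rewrite /half1 indicE mem_setE in_itv/= andbT. Qed.

Lemma half0_ge0 x : 0 <= half0 x. Proof. by rewrite half0E. Qed.
Lemma half1_ge0 x : 0 <= half1 x. Proof. by rewrite half1E. Qed.

Lemma measurable_half0 : measurable_fun setT half0.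
Proof. by apply: measurable_indic; exact: measurable_itv. Qed.

Lemma measurable_half1 : measurable_fun setT half1.
Proof. by apply: measurable_indic; exact: measurable_itv. Qed.

(* [umeas_int] with values in the extended reals, where Tonelli needs no
   integrability. *)
Definition umeas_pair u (h : R -> \bar R) : \bar R :=
  ((atom u)%:E * h 0%R + \int[mu]_z (((dens u \_ Rplus) z)%:E * h z))%E.

Variable u : umeas R.
Hypothesis iu : integrable_umeas u.
Let rho : R -> R := dens u \_ Rplus.

Let rho_ge0 z : 0 <= rho z.
Proof.
rewrite /rho patchE; case: ifPn => //; rewrite /Rplus mem_setE in_itv/= andbT => z0.
by have [_ + _] := iu; exact.
Qed.

Let measurable_rho : measurable_fun setT rho.
Proof.
apply/(measurable_restrictT (dens u)); first exact: measurable_itv.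
by have [_ _ /measurable_int/measurable_EFinP] := iu.
Qed.

Let integral_rho (D : set (measurableTypeR R)) (h : R -> R) :
  (\int[mu]_(z in D `&` Rplus) (dens u z * h z)%:E = \int[mu]_(z in D) ((rho z)%:E * (h z)%:E))%E.
Proof.
rewrite integral_mkcondr; apply: eq_integral => z _.
by rewrite /rho !patchE; case: ifPn => // _; rewrite mul0e.
Qed.

Lemma umeas_pair_ge0 h : (forall z, 0 <= h z)%E -> (0 <= umeas_pair u h)%E.
Proof.
move=> h0; rewrite /umeas_pair adde_ge0//.
  by rewrite mule_ge0// lee_fin; case: iu.
by apply: integral_ge0 => z _; rewrite mule_ge0// lee_fin rho_ge0.
Qed.

Let measurable_rho_mul (k : R * R -> \bar R) : measurable_fun setT k ->
  measurable_fun setT (fun p : R * R => (rho p.2)%:E * k p)%E.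
Proof.
move=> mk; apply: emeasurable_funM => //; apply/measurable_EFinP.
exact: measurableT_comp.
Qed.

Lemma measurable_umeas_pair (k : R * R -> \bar R) : measurable_fun setT k ->
  (forall p, 0 <= k p)%E ->
  measurable_fun setT (fun x => umeas_pair u (fun z => k (x, z))).
Proof.
move=> mk k0; apply: emeasurable_funD.
  apply: measurable_funeM; apply: (measurableT_comp mk).
  exact: pair2_measurable.
apply: (@measurable_fun_fubini_tonelli_F _ _ _ _ _ mu (fun p => (rho p.2)%:E * k p)%E).
  exact: measurable_rho_mul.
by move=> p; rewrite mule_ge0// lee_fin rho_ge0.
Qed.

Lemma umeas_pair_tonelli (k : R * R -> \bar R) : measurable_fun setT k ->
  (forall p, 0 <= k p)%E ->
  (\int[mu]_x umeas_pair u (fun z => k (x, z)) =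
   umeas_pair u (fun z => \int[mu]_x k (x, z)))%E.
Proof.
move=> mk k0.
have mkz z : measurable_fun setT (fun x => k (x, z)).
  by apply: (measurableT_comp mk); exact: pair2_measurable.
have a0 : (0 <= (atom u)%:E)%E by rewrite lee_fin; case: iu.
rewrite /umeas_pair ge0_integralD//.
- congr (_ + _)%E; first by rewrite ge0_integralZl//; exact: mkz.
  etransitivity; first apply: (lebesgue_tonelli (measurable_rho_mul mk)).
    by move=> p; rewrite mule_ge0// lee_fin rho_ge0.
  have r0 z : (0 <= (rho z)%:E)%E by rewrite lee_fin.
  by apply: eq_integral => z _; rewrite /= ge0_integralZl//; exact: mkz.
- by move=> x _; rewrite mule_ge0.
- by apply: measurable_funeM; exact: mkz.
- by move=> x _; apply: integral_ge0 => z _; rewrite mule_ge0// lee_fin rho_ge0.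
- apply: (@measurable_fun_fubini_tonelli_F _ _ _ _ _ mu (fun p => (rho p.2)%:E * k p)%E).
    exact: measurable_rho_mul.
  by move=> p; rewrite mule_ge0// lee_fin rho_ge0.
Qed.

Lemma umeas_pairZ c h : 0 <= c -> measurable_fun setT h -> (forall z, 0 <= h z)%E ->
  umeas_pair u (fun z => c%:E * h z)%E = (c%:E * umeas_pair u h)%E.
Proof.
move=> c0 mh h0; rewrite /umeas_pair ge0_muleDr; last 2 first.
- by rewrite mule_ge0// lee_fin; case: iu.
- by apply: integral_ge0 => z _; rewrite mule_ge0// lee_fin rho_ge0.
rewrite muleCA; congr (_ + _)%E; rewrite -ge0_integralZl//.
- by apply: eq_integral => z _; rewrite muleCA.
- by apply: emeasurable_funM => //; exact/measurable_EFinP.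
- by move=> z _; rewrite mule_ge0// lee_fin rho_ge0.
Qed.

Variable t : R.
Hypothesis t0 : 0 < t.

Lemma dens_free_evol x : (dens (free_evol t u) x)%:E =
  umeas_pair u (fun z => (heat t (x - z) + heat t (x + z))%:E).
Proof.
rewrite /free_evol /= /umeas_int /umeas_pair EFinD EFinM; congr (_ * _ + _)%E.
  by rewrite /Gneum /G /heat oppr0 subr0 addr0.
have iG : mu.-integrable Rplus (EFin \o (fun z => dens u z * Gneum t x z)).
  have [_ _ id] := iu.
  apply: (@le_integrable _ _ _ mu Rplus _ _ (fun z => (2 * heat t 0)%:E * (dens u z)%:E)%E).
  - exact: measurable_itv.
  - apply/measurable_EFinP; apply: measurable_funM.
      by move/measurable_int : (id) => /measurable_EFinP.
    apply: measurable_funTS; apply: measurable_funD;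
      apply: (measurableT_comp (measurable_heat t)); exact: measurable_funB.
  - move=> z _ /=; rewrite lee_fin [leLHS]normrM [leRHS]normrM mulrC ler_wpM2r//.
    rewrite [leRHS]ger0_norm ?mulr_ge0 ?heat_ge0//.
    rewrite /Gneum [leLHS]ger0_norm ?addr_ge0 ?heat_ge0// mulr2n mulrDl !mul1r.
    by apply: lerD; rewrite heat_anti// normr0.
  - by apply: integrableZl => //; exact: measurable_itv.
have E : (\int[mu]_(z in Rplus) (Gneum t x z * dens u z)%:E =
          \int[mu]_(z in Rplus) (dens u z * Gneum t x z)%:E)%E.
  by apply: eq_integral => z _; rewrite mulrC.
rewrite /Rintegral E fineK; last by apply: integrable_fin_num iG; exact: measurable_itv.
rewrite -integral_rho setTI; apply: eq_integral => z _.
by rewrite /Gneum /G opprK.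
Qed.

Let integral_tail r : 0 <= r ->
  (\int[mu]_(z in `[r, +oo[) (dens u z)%:E = (tail (dens u) r)%:E)%E.
Proof.
move=> r0; rewrite /tail /Rintegral fineK//; have [_ _ id] := iu.
apply: integrable_fin_num; first exact: measurable_itv.
apply: integrableS id; [exact: measurable_itv|exact: measurable_itv|].
by apply: subset_itvr; rewrite bnd_simp.
Qed.

(** A superposition of point masses. The strict inequality in [half1] counts an atom at the origin
    once for [y = 0] and twice for [y < 0], in agreement with [2 phi 0 - phi (- y)]. *)
Lemma odd_ext_F y : (odd_ext (fun r => F r u) y)%:E =
  umeas_pair u (fun z => (half0 (z - y) + half1 (- z - y))%:E).
Proof.
have [a0 d0 id] := iu; have [y0|y0] := leP 0 y.
  rewrite odd_ext_ge0// F_tail EFinD EFinM; congr (_ * _ + _)%E.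
    rewrite sub0r oppr0 sub0r half0E half1E oppr_ge0 oppr_gt0 ltNge y0 addr0.
    by congr (_%:R%:E); rewrite eq_le y0 andbT.
  rewrite -(integral_tail y0) integral_mkcond; apply: eq_integral => z _.
  rewrite /rho !patchE /Rplus !mem_setE !in_itv/= !andbT half0E half1E subr_ge0.
  have [yz|zy] := leP y z.
    rewrite (le_trans y0 yz) (_ : (0 < - z - y) = false) ?addr0 ?mule1//.
    by apply/negbTE; rewrite -leNgt; have := le_trans y0 yz; lra.
  case: ifPn => z0; last by rewrite mul0e.
  rewrite (_ : (0 < - z - y) = false) ?addr0 ?mule0//.
  by apply/negbTE; rewrite -leNgt; lra.
have ny0 : 0 < - y by rewrite oppr_gt0.
rewrite /odd_ext leNgt y0/= (F_tail_gt0 _ ny0) (F_tail 0) eqxx mulr1.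
have -> : 2 * (atom u + tail (dens u) 0) - tail (dens u) (- y) =
    atom u * 2 + (tail (dens u) 0 + \int[mu]_(z in `[0, - y]) dens u z).
  by rewrite (tail_split id (lexx 0) (ltW ny0)); ring.
rewrite EFinD EFinM; congr (_ * _ + _)%E.
  by rewrite sub0r oppr0 sub0r half0E half1E (ltW ny0) ny0 -natrD.
have E1 : (\int[mu]_z ((rho z)%:E * (half0 (z - y))%:E) = (tail (dens u) 0)%:E)%E.
  rewrite -(integral_tail (lexx 0)) [RHS]integral_mkcond; apply: eq_integral => z _.
  rewrite /rho !patchE /Rplus !mem_setE !in_itv/= !andbT half0E subr_ge0.
  by case: ifPn => z0; rewrite ?mul0e// (le_trans (ltW y0) z0) mule1.
have E2 : (\int[mu]_z ((rho z)%:E * (half1 (- z - y))%:E) =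
    (\int[mu]_(z in `[0, - y]) dens u z)%:E)%E.
  have i2 : mu.-integrable `[0, - y] (EFin \o dens u).
    apply: integrableS id; [exact: measurable_itv|exact: measurable_itv|].
    by move=> z /=; rewrite /Rplus/= !in_itv/= => /andP[->].
  rewrite /Rintegral fineK; last by apply: integrable_fin_num => //; exact: measurable_itv.
  rewrite -integral_itv_bndo_bndc; last first.
    apply: measurable_funS (measurable_int _ i2); first exact: measurable_itv.
    by move=> z /=; rewrite !in_itv/= => /andP[-> /ltW].
  rewrite [RHS]integral_mkcond; apply: eq_integral => z _.
  rewrite /rho !patchE /Rplus !mem_setE !in_itv/= andbT half1E.
  have -> : (0 < - z - y) = (z < - y) by rewrite -[LHS](ltrD2r z); congr (_ < _); ring.
  by case: ifPn => z0; rewrite ?mul0e//=; case: ifPn => _; rewrite ?mule1 ?mule0.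
rewrite EFinD -E1 -E2 -ge0_integralD//.
- by apply: eq_integral => z _; rewrite EFinD ge0_muleDr// lee_fin ?half0_ge0 ?half1_ge0.
- by move=> z _; rewrite mule_ge0// lee_fin ?rho_ge0 ?half0_ge0.
- apply: emeasurable_funM; apply/measurable_EFinP => //.
  by apply: (measurableT_comp measurable_half0); exact: measurable_funB.
- by move=> z _; rewrite mule_ge0// lee_fin ?rho_ge0 ?half1_ge0.
- apply: emeasurable_funM; apply/measurable_EFinP => //.
  apply: (measurableT_comp measurable_half1); apply: measurable_funB => //.
Qed.

Let mheat (f : R -> R) : measurable_fun setT f -> measurable_fun setT (fun x => heat t (f x)).
Proof. by move=> mf; exact: (measurableT_comp (measurable_heat t)). Qed.

(** The case of one point mass at [z]: the tail of the Neumann kernel is the heat flow of the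
    reflected step. Each image charge is matched by a reflection of the integration variable. *)
Lemma integral_half_heat r z :
  (\int[mu]_x (half0 (x - r) * (heat t (x - z) + heat t (x + z)))%:E =
   \int[mu]_y (heat t (r - y) * (half0 (z - y) + half1 (- z - y)))%:E)%E.
Proof.
have msub (a : R) : measurable_fun setT (fun x : R => x - a) by exact: measurable_funB.
have mrev (a : R) : measurable_fun setT (fun x : R => a - x) by exact: measurable_funB.
have madd (a : R) : measurable_fun setT (fun x : R => x + a) by exact: measurable_funD.
have m0 (f : R -> R) : measurable_fun setT f -> measurable_fun setT (fun x => half0 (f x)).
  by move=> mf; exact: (measurableT_comp measurable_half0).
have m1 (f : R -> R) : measurable_fun setT f -> measurable_fun setT (fun x => half1 (f x)).
  by move=> mf; exact: (measurableT_comp measurable_half1).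
have A1 : (\int[mu]_x (half0 (x - r) * heat t (x - z))%:E =
           \int[mu]_y (heat t (r - y) * half0 (z - y))%:E)%E.
  rewrite -(ge0_integral_reflect (r + z) (f := fun x => (half0 (x - r) * heat t (x - z))%:E)).
  - apply: eq_integral => y _; rewrite mulrC; congr (heat t _ * half0 _)%:E; ring.
  - by apply/measurable_EFinP; apply: measurable_funM; [exact: m0|exact: mheat].
  - by move=> x; rewrite lee_fin mulr_ge0 ?half0_ge0 ?heat_ge0.
have A2 : (\int[mu]_x (half0 (x - r) * heat t (x + z))%:E =
           \int[mu]_y (heat t (r - y) * half0 (- z - y))%:E)%E.
  rewrite -(ge0_integral_reflect (r - z) (f := fun x => (half0 (x - r) * heat t (x + z))%:E)).
  - apply: eq_integral => y _; rewrite mulrC; congr (heat t _ * half0 _)%:E; ring.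
  - by apply/measurable_EFinP; apply: measurable_funM; [exact: m0|exact: mheat].
  - by move=> x; rewrite lee_fin mulr_ge0 ?half0_ge0 ?heat_ge0.
(* The two indicators differ only at the single point [y = - z]. *)
have A3 : (\int[mu]_y (heat t (r - y) * half0 (- z - y))%:E =
           \int[mu]_y (heat t (r - y) * half1 (- z - y))%:E)%E.
  transitivity (\int[mu]_(y in `]-oo, (- z)%R]) (heat t (r - y))%:E)%E.
    rewrite [RHS]integral_mkcond; apply: eq_integral => y _.
    rewrite patchE mem_setE in_itv/= half0E subr_ge0.
    by case: ifP => _; rewrite ?mulr1 ?mulr0.
  rewrite -integral_itv_bndo_bndc; last first.
    by apply/measurable_EFinP; apply: measurable_funTS; exact: mheat.
  rewrite integral_mkcond; apply: eq_integral => y _.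
  rewrite patchE mem_setE in_itv/= half1E subr_gt0.
  by case: ifP => _; rewrite ?mulr1 ?mulr0.
under eq_integral do rewrite mulrDr EFinD.
under [RHS]eq_integral do rewrite mulrDr EFinD.
rewrite ge0_integralD//.
- rewrite [RHS]ge0_integralD//.
  + by rewrite A1 A2 A3.
  + by move=> x _; rewrite lee_fin mulr_ge0 ?half0_ge0 ?heat_ge0.
  + by apply/measurable_EFinP; apply: measurable_funM; [exact: mheat|exact: m0].
  + by move=> x _; rewrite lee_fin mulr_ge0 ?half1_ge0 ?heat_ge0.
  + by apply/measurable_EFinP; apply: measurable_funM; [exact: mheat|exact: m1].
- by move=> x _; rewrite lee_fin mulr_ge0 ?half0_ge0 ?heat_ge0.
- by apply/measurable_EFinP; apply: measurable_funM; [exact: m0|exact: mheat].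
- by move=> x _; rewrite lee_fin mulr_ge0 ?half0_ge0 ?heat_ge0.
- by apply/measurable_EFinP; apply: measurable_funM; [exact: m0|exact: mheat].
Qed.

(** Tonelli superposes [integral_half_heat] over [u], with [dens_free_evol] on one side and
    [odd_ext_F] on the other. *)
Lemma free_evol_heatF : integrable_umeas (free_evol t u) /\
  forall r, 0 <= r -> F r (free_evol t u) = heatF t (fun r => F r u) r.
Proof.
have P := profile_F iu; have bE := bounded_odd_ext P.
pose h1 (p : R * R) := (heat t (p.1 - p.2) + heat t (p.1 + p.2))%:E.
have mh1 : measurable_fun setT h1.
  apply/measurable_EFinP; apply: measurable_funD;
  apply: (measurableT_comp (measurable_heat t)); [exact: measurable_funB|exact: measurable_funD].
have h10 p : (0 <= h1 p)%E by rewrite lee_fin addr_ge0 ?heat_ge0.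
pose h2 (p : R * R) := (half0 (p.2 - p.1) + half1 (- p.2 - p.1))%:E.
have mh2 : measurable_fun setT h2.
  apply/measurable_EFinP; apply: measurable_funD.
    by apply: (measurableT_comp measurable_half0); exact: measurable_funB.
  apply: (measurableT_comp measurable_half1); apply: measurable_funB => //.
  exact: measurableT_comp.
have h20 p : (0 <= h2 p)%E by rewrite lee_fin addr_ge0 ?half0_ge0 ?half1_ge0.
have mpair (k : R * R -> \bar R) x : measurable_fun setT k -> measurable_fun setT (fun z => k (x, z)).
  by move=> mk; apply: (measurableT_comp mk); exact: pair1_measurable.
have main r : (\int[mu]_(x in `[r, +oo[) (dens (free_evol t u) x)%:E =
    \int[mu]_y (heat t (r - y) * odd_ext (fun r => F r u) y)%:E)%E.
  pose k1 (p : R * R) := ((half0 (p.1 - r))%:E * h1 p)%E.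
  pose k2 (p : R * R) := ((heat t (r - p.1))%:E * h2 p)%E.
  have mk1 : measurable_fun setT k1.
    apply: emeasurable_funM => //; apply/measurable_EFinP.
    by apply: (measurableT_comp measurable_half0); exact: measurable_funB.
  have k10 p : (0 <= k1 p)%E by rewrite mule_ge0// lee_fin half0_ge0.
  have mk2 : measurable_fun setT k2.
    apply: emeasurable_funM => //; apply/measurable_EFinP.
    by apply: (measurableT_comp (measurable_heat t)); exact: measurable_funB.
  have k20 p : (0 <= k2 p)%E by rewrite mule_ge0// lee_fin heat_ge0.
  transitivity (\int[mu]_x umeas_pair u (fun z => k1 (x, z)))%E.
    rewrite integral_mkcond; apply: eq_integral => x _.
    rewrite /k1/= umeas_pairZ ?half0_ge0//; last exact: mpair.
    rewrite /h1/= -dens_free_evol patchE mem_setE in_itv/= andbT half0E subr_ge0.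
    by case: ifP => _; rewrite ?mul1e ?mul0e.
  transitivity (\int[mu]_y umeas_pair u (fun z => k2 (y, z)))%E; last first.
    apply: eq_integral => y _.
    rewrite /k2/= umeas_pairZ ?heat_ge0//; last exact: mpair.
    by rewrite /h2/= -odd_ext_F EFinM.
  rewrite (umeas_pair_tonelli mk1 k10) (umeas_pair_tonelli mk2 k20).
  congr (umeas_pair u _); apply/funext => z.
  rewrite /k1 /k2 /h1 /h2/=.
  under eq_integral do rewrite -EFinM.
  by under [RHS]eq_integral do rewrite -EFinM; exact: integral_half_heat.
have dens0 x : 0 <= dens (free_evol t u) x.
  by rewrite -lee_fin dens_free_evol; apply: umeas_pair_ge0 => z; exact: (h10 (x, z)).
have dfin : mu.-integrable Rplus (EFin \o dens (free_evol t u)).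
  apply/integrableP; split.
    apply: measurable_funTS.
    have := measurable_umeas_pair mh1 h10.
    by apply: eq_measurable_fun => x _; rewrite /= dens_free_evol.
  have -> : (\int[mu]_(x in Rplus) `|(EFin \o dens (free_evol t u)) x| =
             \int[mu]_(x in Rplus) (dens (free_evol t u) x)%:E)%E.
    by apply: eq_integral => x _; rewrite -[LHS]/(`|dens (free_evol t u) x|%:E) ger0_norm.
  rewrite main ltey_eq; apply/orP; left.
  apply: integrable_fin_num => //; exact: (integrable_conv 0 (integrable_heat t0) bE).
split.
  by split=> //; rewrite /=.
move=> r r0; rewrite F_tail /= mul0r add0r /tail /Rintegral main.
by [].
Qed.

End free_evolution.

(** * The barriers of the statement as [upper] and [lower] *)

Section barrier_profiles.
Context {R : realType}.
Variables (j : R) (j0 : 0 < j) (u : umeas R).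
Hypothesis iu : integrable_umeas u.
Hypothesis atom0 : atom u = 0.
Let phi r := F r u.
Let M := F 0 u.
Implicit Types (delta t r : R) (k n : nat).

Let jge0 : 0 <= j. Proof. exact: ltW. Qed.

Let P : profile M phi. Proof. exact: profile_F. Qed.

Let nseq_last k delta : nseq k.+1 delta = nseq k delta ++ [:: delta].
Proof. by rewrite -addn1 nseqD. Qed.

Lemma F_of_dens (v : umeas R) : atom v = 0 -> F 0 (of_dens (dens v)) = F 0 v.
Proof. by rewrite /F /= => ->. Qed.

(** The vanishing atom belongs to the induction because the condition for the next cut concerns the
    density alone; without an atom its mass is the conserved [M]. *)
Lemma barrier_plus_upper delta k : 0 < delta -> j * delta < M ->
  [/\ integrable_umeas (barrier_plus j delta u k),
      atom (barrier_plus j delta u k) = 0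
    & forall r, 0 <= r -> F r (barrier_plus j delta u k) = upper j (nseq k delta) phi r].
Proof.
move=> d0 dM; have jd : 0 < j * delta by rewrite mulr_gt0.
elim: k => [//|k [ik ak Fk]].
have Pk := profile_upper jge0 (pos_nseq k d0) P.
have dk : j * delta < F 0 (of_dens (dens (barrier_plus j delta u k))).
  by rewrite F_of_dens// Fk//; case: Pk => -> _ _.
have [ic Fc] := integrable_cut_paste jd ik dk.
have [ie Fe] := free_evol_heatF ic d0.
split=> // r r0.
rewrite [barrier_plus _ _ _ _]/= Fe// nseq_last upper_cat /=.
rewrite /heatF; congr (heat_flow _ _ r); apply: odd_ext_eq => x x0.
by rewrite Fc// /cutF !Fk.
Qed.

(** The iterates carry an atom here, but each cut follows a diffusion, which turns all mass into
    density. *)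
Lemma barrier_minus_lower delta k : 0 < delta -> j * delta < M ->
  integrable_umeas (barrier_minus j delta u k) /\
  forall r, 0 <= r -> F r (barrier_minus j delta u k) = lower j (nseq k delta) phi r.
Proof.
move=> d0 dM; have jd : 0 < j * delta by rewrite mulr_gt0.
elim: k => [//|k [ik Fk]].
have Pk := profile_lower jge0 (pos_nseq k d0) P.
have [ie Fe] := free_evol_heatF ik d0.
have Fe' r : 0 <= r -> F r (free_evol delta (barrier_minus j delta u k)) =
    heatF delta (lower j (nseq k delta) phi) r.
  by move=> r0; rewrite Fe// /heatF; congr (heat_flow _ _ r); exact: odd_ext_eq.
have dk : j * delta < F 0 (of_dens (dens (free_evol delta (barrier_minus j delta u k)))).
  by rewrite F_of_dens// Fe'// (heatF0 d0 Pk).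
have [ic Fc] := integrable_cut_paste jd ie dk.
split=> // r r0.
rewrite [barrier_minus _ _ _ _]/= Fc// nseq_last lower_cat /=.
by rewrite /cutF !Fe'.
Qed.

Lemma uniform_stepsE t k delta : 0 < t -> t = k%:R * delta ->
  nseq k delta = uniform_steps k.-1 t.
Proof.
case: k => [|k] t0 e; first by move: t0; rewrite e mul0r ltxx.
by rewrite /uniform_steps e mulrAC divff ?mul1r// pnatr_eq0.
Qed.

Lemma step_gt0 t k delta : 0 < t -> t = k%:R * delta -> 0 < delta -> (0 < k)%N.
Proof. by case: k => // + e; rewrite e mul0r ltxx. Qed.

Lemma barrier_plus_evol t k delta r : 0 < t -> t = k%:R * delta -> 0 < delta ->
  j * delta < M -> 0 <= r ->
  evol j phi t r <= F r (barrier_plus j delta u k) <= evol j phi t r + j * delta.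
Proof.
move=> t0 e d0 dM r0; have [_ _ ->//] := barrier_plus_upper k d0 dM.
have k0 := step_gt0 t0 e d0.
have E : j * t / k%:R = j * delta by rewrite e; field; rewrite pnatr_eq0 -lt0n.
rewrite (uniform_stepsE t0 e) (evol_le_uniform _ _ t0 P r0)// andTb.
have := upper_le_evol jge0 k.-1 t0 P r0; rewrite prednK// E; exact.
Qed.

Lemma barrier_minus_evol t k delta r : 0 < t -> t = k%:R * delta -> 0 < delta ->
  j * delta < M -> 0 <= r ->
  F r (barrier_minus j delta u k) <= evol j phi t r <= F r (barrier_minus j delta u k) + j * delta.
Proof.
move=> t0 e d0 dM r0; have [_ ->//] := barrier_minus_lower k d0 dM.
have k0 := step_gt0 t0 e d0.
have E : j * t / k%:R = j * delta by rewrite e; field; rewrite pnatr_eq0 -lt0n.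
rewrite (uniform_stepsE t0 e).
rewrite (lower_le_evol jge0 (pos_uniform k.-1 t0) (total_uniform _ _) t0 P r0) andTb.
have := evol_le_lower jge0 k.-1 t0 P r0; rewrite prednK// E; exact.
Qed.

Lemma dyadic_step t (l : nat) : t = (2 ^ l)%N%:R * (t / 2 ^+ l).
Proof. by rewrite natrX mulrC divfK// expf_neq0. Qed.

Lemma dyadic_small_step t c : 0 < c ->
  exists K, forall n, (K <= n)%N -> j * (t / 2 ^+ n) < c.
Proof.
move=> c0; have [K H] := dyadic_small (j * t) c0.
by exists K => n Kn; rewrite mulrA H.
Qed.

Lemma barrier_dyadic_cvg t r : 0 < t -> 0 <= r -> 0 < M ->
  F r (barrier_plus j (t / 2 ^+ l) u (2 ^ l)) @[l --> \oo] --> evol j phi t r /\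
  F r (barrier_minus j (t / 2 ^+ l) u (2 ^ l)) @[l --> \oo] --> evol j phi t r.
Proof.
move=> t0 r0 M0.
have d0 l : 0 < t / 2 ^+ l by rewrite divr_gt0// exprn_gt0.
have [K HK] := dyadic_small_step t M0.
split; apply/cvgrPdist_le => e e0; have [K' HK'] := dyadic_small_step t e0;
  exists (maxn K K') => //= l /=; rewrite geq_max => /andP[/HK h1 /HK'/ltW h2].
- have := barrier_plus_evol t0 (dyadic_step t l) (d0 l) h1 r0.
  by rewrite ler_norml => ?; lra.
- have := barrier_minus_evol t0 (dyadic_step t l) (d0 l) h1 r0.
  by rewrite ler_norml => ?; lra.
Qed.

Lemma barrier_dyadic_mono t r l m : 0 < t -> 0 <= r -> (l <= m)%N ->
  j * (t / 2 ^+ l) < M ->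
  F r (barrier_plus j (t / 2 ^+ m) u (2 ^ m)) <=
    F r (barrier_plus j (t / 2 ^+ l) u (2 ^ l)) /\
  F r (barrier_minus j (t / 2 ^+ l) u (2 ^ l)) <=
    F r (barrier_minus j (t / 2 ^+ m) u (2 ^ m)).
Proof.
move=> t0 r0 lm h.
have d0 i : 0 < t / 2 ^+ i by rewrite divr_gt0// exprn_gt0.
have h' : j * (t / 2 ^+ m) < M.
  apply: le_lt_trans h; rewrite ler_pM2l// ler_pM2l// lef_pV2 ?posrE ?exprn_gt0//.
  by rewrite ler_weXn2l// ler1n.
have [_ _ ->//] := barrier_plus_upper (2 ^ m) (d0 m) h'.
have [_ _ ->//] := barrier_plus_upper (2 ^ l) (d0 l) h.
have [_ ->//] := barrier_minus_lower (2 ^ m) (d0 m) h'.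
have [_ ->//] := barrier_minus_lower (2 ^ l) (d0 l) h.
have -> : (2 ^ m = 2 ^ l * 2 ^ (m - l))%N by rewrite -expnD subnKC.
have -> : t / 2 ^+ l = (2 ^ (m - l))%N%:R * (t / 2 ^+ m).
  have -> : 2 ^+ m = 2 ^+ l * 2 ^+ (m - l) :> R by rewrite -exprD subnKC.
  by rewrite natrX; field; rewrite !expf_neq0.
have p0 : (0 < 2 ^ (m - l))%N by rewrite expn_gt0.
split; first exact: (upper_refine jge0 (2 ^ l) p0 (d0 m) P r0).
exact: (lower_refine jge0 (2 ^ l) p0 (d0 m) P r0).
Qed.

End barrier_profiles.

Section barrier_limits.
Context {R : realType}.
Variables (j : R) (j0 : 0 < j) (rho : R -> R).
Hypothesis iu : integrable_umeas (of_dens rho).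
Let u := of_dens rho.
Let phi r := F r u.
Hypothesis M0 : 0 < F 0 u.

Lemma dyadic_limit_evol t r : 0 < t -> 0 <= r ->
  dyadic_limit j rho t r (evol j phi t r).
Proof.
move=> t0 r0; have [c1 c2] := barrier_dyadic_cvg j0 iu erefl t0 r0 M0.
by split=> // l m lm h; have [] := barrier_dyadic_mono j0 iu erefl t0 r0 lm h.
Qed.

Lemma inf_sup_barriers_evol t r : 0 < t -> 0 <= r ->
  inf_sup_barriers j rho t r (evol j phi t r).
Proof.
move=> t0 r0.
(* Dyadic steps supply admissible pairs with [j delta] arbitrarily small; they make the infimum and
   the supremum reach the limit. *)
have adm e : 0 < e -> exists dk, admissible_step j rho t dk /\ j * dk.1 <= e.
  move=> e0; have m0 : 0 < Num.min e (F 0 u) by rewrite lt_min e0.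
  have [K HK] := dyadic_small_step j t m0.
  exists (t / 2 ^+ K, (2 ^ K)%N); have := HK K (leqnn K).
  rewrite lt_min => /andP[h1 h2]; split; last exact: ltW.
  by split=> //=; [rewrite divr_gt0// exprn_gt0|exact: dyadic_step].
split; apply/eqP; rewrite eq_le; apply/andP; split.
- apply: le_ereal_inf_tmp => _ [[d k] [/= d0 e dM] <-]; rewrite lee_fin.
  by have /andP[] := barrier_plus_evol j0 iu erefl t0 e d0 dM r0.
- apply/lee_addgt0Pr => e e0; have [[d k] [[/= d0 tk dM] de]] := adm e e0.
  apply: (@le_trans _ _ (F r (barrier_plus j d u k))%:E).
    by apply: ereal_inf_lbound; exists (d, k).
  rewrite -EFinD lee_fin.
  have /andP[_ h] := barrier_plus_evol j0 iu erefl t0 tk d0 dM r0.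
  by apply: le_trans h _; rewrite lerD2l.
- apply/lee_addgt0Pr => e e0; have [[d k] [[/= d0 tk dM] de]] := adm e e0.
  apply: (@le_trans _ _ ((F r (barrier_minus j d u k))%:E + e%:E)%E).
    rewrite -EFinD lee_fin.
    have /andP[_ h] := barrier_minus_evol j0 iu t0 tk d0 dM r0.
    by apply: le_trans h _; rewrite lerD2l.
  by apply: leeD2r; apply: ereal_sup_ubound; exists (d, k).
- apply: ge_ereal_sup => _ [[d k] [/= d0 e dM] <-]; rewrite lee_fin.
  by have /andP[] := barrier_minus_evol j0 iu t0 e d0 dM r0.
Qed.

End barrier_limits.

Section densities.
Context {R : realType}.
Local Notation mu := (@lebesgue_measure R).

Lemma nonneg_Linf_L1_integrable (rho : R -> R) : nonneg_Linf_L1 rho ->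
  integrable_umeas (of_dens rho).
Proof.
move=> [r0 _ /Lfun1_integrable]; rewrite -restrict_EFin => i1; split=> //.
have /integrable_restrict : mu.-integrable setT ((EFin \o rho) \_ Rplus) by [].
by move=> /(_ (measurable_itv _) measurableT); rewrite setTI.
Qed.

Lemma bounded_nonneg_Linf_L1 (rho : R -> R) B : integrable_umeas (of_dens rho) ->
  (forall x, 0 <= x -> rho x <= B) -> nonneg_Linf_L1 rho.
Proof.
move=> [_ /= r0 ir] rB.
have ip : mu.-integrable setT (EFin \o (rho \_ Rplus)).
  rewrite -restrict_EFin; apply/integrable_restrict => //; first exact: measurable_itv.
  by rewrite setTI.
split=> //; last exact/Lfun1_integrable.
rewrite inE; apply/andP; split; rewrite inE/=.
  by apply/measurable_EFinP; exact: measurable_int ip.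
rewrite /finite_norm unlock; case: ifPn => _; last exact: ltry.
apply: (@le_lt_trans _ _ B%:E); last exact: ltry.
apply/ess_supP; apply: aeW => x; rewrite /= lee_fin patchE.
case: ifPn => [|_]; last by rewrite normr0 (le_trans (r0 0 (lexx 0)))// rB.
by rewrite /Rplus mem_setE in_itv/= andbT => x0; rewrite ger0_norm ?rB ?r0.
Qed.

End densities.

(** * The limit density and its uniqueness *)

Section limit.
Context {R : realType}.
Local Notation mu := (@lebesgue_measure R).
Variables (j : R) (j0 : 0 < j) (rho : R -> R).
Hypothesis iu : integrable_umeas (of_dens rho).
Let u := of_dens rho.
Let phi r := F r u.
Let M := F 0 u.
Implicit Types (t r x e : R).

Definition flow (s : R -> R) t x := slope (fun t => odd_ext (evol j (fun r => F r (of_dens s)) t)) t x.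

Let E t := odd_ext (evol j phi t).
Let P : profile M phi. Proof. exact: profile_F. Qed.
Let jge0 : 0 <= j. Proof. exact: ltW. Qed.
Let bE t : 0 < t -> bounded_measurable (2 * M) (E t).
Proof. by move=> t0; exact: (bounded_odd_ext (profile_evol jge0 t0 P)). Qed.
Let E0 t y : 0 < t -> 0 <= E t y.
Proof. by move=> t0; have /andP[] := odd_ext_bound y (profile_evol jge0 t0 P). Qed.
Let E_step t h y : 0 < t -> 0 < h -> `|E (t + h) y - heat_flow h (E t) y| <= j * h.
Proof. by move=> t0 h0; exact: (evol_step jge0 y t0 h0 P). Qed.

Lemma flow_ge0 t x : 0 < t -> 0 <= flow rho t x.
Proof.
move=> t0; apply: (slope_ge0 jge0 bE E0 E_step x t0) => y z yz.
exact: (odd_ext_anti (profile_evol jge0 t0 P) yz).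
Qed.

Lemma flow_bounded t : 0 < t -> exists B, forall x, `|flow rho t x| <= B.
Proof. by move=> t0; exact: (slope_bounded jge0 bE E0 E_step t0). Qed.

Lemma continuous_flow t : 0 < t -> continuous (flow rho t).
Proof. by move=> t0; exact: (continuous_slope jge0 bE E0 E_step t0). Qed.

Lemma flow_joint_continuous t x e : 0 < t -> 0 < e -> exists2 d, 0 < d &
  forall t' x', `|t - t'| < d -> `|x - x'| < d -> `|flow rho t x - flow rho t' x'| <= e.
Proof. by move=> t0 e0; exact: (slope_continuous jge0 bE E0 E_step x t0 e0). Qed.

(** The upper barrier with one step lies below the pure diffusion of [u], whose tail vanishes at
    infinity. So no mass is lost when the slope is integrated up to infinity in [integral_flow]. *)
Lemma evol_small t e : 0 < t -> 0 < e -> exists2 A, 0 <= A &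
  forall x, A <= x -> 0 <= evol j phi t x < e.
Proof.
move=> t0 e0; have jt : 0 <= j * t by rewrite mulr_ge0// ltW.
have [[_ fd fi] Fe] := free_evol_heatF iu t0.
have [A A0 Ae] := tail_small fd fi e0.
have A10 : 0 < A + 1 by rewrite ltr_wpDl.
exists (A + 1); first exact: ltW.
move=> x Ax; have x0 : 0 < x by exact: lt_le_trans Ax.
have PE := profile_evol jge0 t0 P.
apply/andP; split; first by have [_ + _] := PE; apply; exact: ltW.
have pt : all (fun s => 0 < s) [:: t] by rewrite /= t0.
have tt : total [:: t] = t by rewrite /total big_seq1.
have := evol_le_upper jge0 pt tt t0 P (ltW x0) => /= /le_lt_trans; apply.
apply: (@le_lt_trans _ _ (heatF t phi x + 0)).
  apply: (heatF_mono t0 (profile_cutF jt P) P (lexx 0) _ (ltW x0)) => y y0.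
  by rewrite addr0; exact: (cutF_le jt P y0).
rewrite addr0 -Fe ?(ltW x0)// (F_tail_gt0 _ x0).
apply: le_lt_trans Ae; apply: tail_anti => //.
by apply: le_trans Ax; rewrite lerDl.
Qed.

Lemma integral_flow t r : 0 < t -> 0 <= r ->
  (\int[mu]_(x in `[r, +oo[) (flow rho t x)%:E = (evol j phi t r)%:E)%E.
Proof.
move=> t0 r0; have cf := continuous_flow t0.
have mf : measurable_fun setT (flow rho t) by exact: continuous_measurable_fun.
have nE (n : nat) : (\int[mu]_(x in `[r, (r + n.+1%:R)%R]) (flow rho t x)%:E =
    (evol j phi t r - evol j phi t (r + n.+1%:R))%:E)%E.
  have rn : r < r + n.+1%:R by rewrite ltrDl ltr0n.
  have ii := integrable_slope jge0 bE E0 E_step r (r + n.+1%:R) t0.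
  have := Rintegral_slope jge0 bE E0 E_step t0 rn.
  rewrite /E !odd_ext_ge0 ?addr_ge0// => <-.
  by rewrite /Rintegral fineK//; apply: integrable_fin_num ii; exact: measurable_itv.
have c1 := @cvg_integral_half_line R (flow rho t) r (fun x _ => flow_ge0 x t0) (measurable_funTS mf).
have c2 : (\int[mu]_(x in `[r, (r + n%:R)%R]) (flow rho t x)%:E)%E @[n --> \oo] --> (evol j phi t r)%:E.
  rewrite -cvg_shiftS /=; under eq_cvg do rewrite nE.
  apply: cvg_EFin; first by apply: nearW.
  apply/cvgrPdist_le => e e0.
  have [A A0 HA] := evol_small t0 e0.
  exists (Num.bound A) => //= n nA; rewrite /= opprB addrC subrK.
  have /HA/andP[h1 h2] : A <= r + n.+1%:R.
    apply: (@le_trans _ _ (n.+1%:R)); last by rewrite lerDr.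
    apply: le_trans (ltW (archi_boundP A0)) _; rewrite ler_nat.
    exact: leq_trans nA (leqnSn n).
  by rewrite ger0_norm// ltW.
exact: cvg_unique c1 c2.
Qed.

Lemma F_flow t r : 0 < t -> 0 <= r -> F r (of_dens (flow rho t)) = evol j phi t r.
Proof. by move=> t0 r0; rewrite /F /= mul0r add0r /Rintegral integral_flow. Qed.

Lemma integrable_flow t : 0 < t -> integrable_umeas (of_dens (flow rho t)).
Proof.
move=> t0; split=> // [x _|]; first exact: flow_ge0.
have mf : measurable_fun setT (flow rho t).
  exact: continuous_measurable_fun (continuous_flow t0).
apply/integrableP; split; first by apply/measurable_EFinP; exact: measurable_funTS.
have -> : (\int[mu]_(x in Rplus) `|(EFin \o dens (of_dens (flow rho t))) x| =
           \int[mu]_(x in Rplus) (flow rho t x)%:E)%E.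
  by apply: eq_integral => x _; rewrite -[LHS]/(`|flow rho t x|%:E) ger0_norm ?flow_ge0.
by rewrite /Rplus integral_flow// ltry.
Qed.

Lemma flow_nonneg_Linf_L1 t : 0 < t -> nonneg_Linf_L1 (flow rho t).
Proof.
move=> t0; have [B HB] := flow_bounded t0.
apply: (bounded_nonneg_Linf_L1 (integrable_flow t0) (B := B)) => x _.
by rewrite (le_trans (ler_norm _)).
Qed.

Lemma flow_within : {within [set p : R * R | 0 <= p.1 /\ 0 < p.2],
  continuous (fun p : R * R => flow rho p.2 p.1)}.
Proof.
apply/subspace_continuousP => -[x t] /= [x0 t0].
apply/cvgrPdist_le => e e0.
have [d d0 D] := flow_joint_continuous x t0 e0.
exists (ball x d, ball t d) => /=; first by split; exact: nbhsx_ballx.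
by move=> [x' t'] /= [bx bt] _; exact: D.
Qed.

Lemma separates_flow : 0 < M -> separates_barriers j rho (flow rho).
Proof.
move=> M0; split; [exact: flow_within|exact: flow_nonneg_Linf_L1|].
move=> t r t0 r0; rewrite F_flow//; split; first exact: dyadic_limit_evol.
exact: inf_sup_barriers_evol.
Qed.

(** The dyadic limit forces equal tails, hence equal integrals over each [[r, b]]; continuity then
    gives equality at [r]. *)
Lemma flow_unique (T : R -> R -> R) : 0 < M -> separates_barriers j rho T ->
  forall t r, 0 < t -> 0 <= r -> T t r = flow rho t r.
Proof.
move=> M0 [cT LT HT] t r t0 r0.
have [_ T0 iT] := nonneg_Linf_L1_integrable (LT t t0).
have [_ S0 iS] := integrable_flow t0.
have FE x : 0 <= x -> tail (T t) x = tail (flow rho t) x.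
  move=> x0; have [[c1 _ _ _] _] := HT t x t0 x0.
  have [c2 _ _ _] := dyadic_limit_evol j0 iu M0 t0 x0.
  have := cvg_unique _ c1 c2; rewrite -F_flow//.
  rewrite /F /= !mul0r !add0r; apply; exact: Rhausdorff.
have iE b : r < b -> \int[mu]_(x in `[r, b]) T t x = \int[mu]_(x in `[r, b]) flow rho t x.
  move=> rb; have := FE r r0; rewrite (tail_split iT r0 (ltW rb)) (tail_split iS r0 (ltW rb)).
  by rewrite FE ?(le_trans r0 (ltW rb))//; exact: addIr.
have sub b : [set` `[r, b]] `<=` Rplus.
  by move=> x /=; rewrite /Rplus/= !in_itv/= andbT => /andP[rx _]; exact: le_trans rx.
have i1 b : mu.-integrable `[r, b] (EFin \o T t).
  by apply: integrableS iT; [exact: measurable_itv|exact: measurable_itv|exact: sub].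
have i2 b : mu.-integrable `[r, b] (EFin \o flow rho t).
  by apply: integrableS iS; [exact: measurable_itv|exact: measurable_itv|exact: sub].
(* Continuity of [T] is relative to the closed half-line, so only the limit from the right is taken;
   this covers [r = 0]. *)
have c1 : T t x @[x --> r^'+] --> T t r.
  move/subspace_continuousP : (cT) => /(_ (r, t) (conj r0 t0)) /cvgrPdist_le cT'.
  apply/cvgrPdist_le => e e0.
  have [[B1 B2] /= [[d /= d0 D] nB2] BB] := cT' e e0.
  exists d => //= x xr rx; apply: (BB (x, t)).
    by split=> /=; [exact: D|exact: nbhs_singleton].
  by split=> //=; exact: le_trans (ltW rx).
have c2 : flow rho t x @[x --> r^'+] --> flow rho t r.
  by apply: cvg_at_right_filter; exact: continuous_flow.
apply/eqP; rewrite eq_le -subr_ge0 -(subr_ge0 (flow rho t r)); apply/andP; split.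
- apply: (@right_limit_ge0 _ (fun y => flow rho t y - T t y) r 1) => //.
  + by move=> b _; exact: (integrable_diff (measurable_itv _) (i2 b) (i1 b)).
  + by move=> b /andP[rb _]; rewrite RintegralB ?iE ?subrr.
  + exact: cvgB.
- apply: (@right_limit_ge0 _ (fun y => T t y - flow rho t y) r 1) => //.
  + by move=> b _; exact: (integrable_diff (measurable_itv _) (i1 b) (i2 b)).
  + by move=> b /andP[rb _]; rewrite RintegralB ?iE ?subrr.
  + exact: cvgB.
Qed.

End limit.

(** * Weak convergence to the initial datum *)

Section weak_limit.
Context {R : realType}.
Local Notation mu := (@lebesgue_measure R).
Implicit Types (f g : R -> R) (x y r t e A B : R).

(** Compactness is applied to [x] alone, so that [y] may lie beyond [A]. *)
Lemma heine_cantor f A e : {within Rplus, continuous f} -> 0 < e ->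
  exists2 d, 0 < d & forall x y, 0 <= x <= A -> 0 <= y -> `|x - y| < d -> `|f x - f y| <= e.
Proof.
move=> cf e0; have e20 : 0 < e / 2 by rewrite divr_gt0.
have loc x : `[0, A]%classic x -> \forall x' \near x & i \near 0^'+,
    forall y, 0 <= x' -> 0 <= y -> `|x' - y| < i -> `|f x' - f y| <= e.
  rewrite /= in_itv/= => /andP[x0 xA].
  have Rx : Rplus x by rewrite /Rplus/= in_itv/= x0.
  have [d d0 D] := within_continuous_dist cf Rx e20.
  have d20 : 0 < d / 2 by rewrite divr_gt0.
  exists (ball x (d / 2), [set i | i < d / 2]).
    split; first exact: nbhsx_ballx.
    exact: nbhs_right_lt.
  move=> [x' i] /= [bx id] y x'0 y0 xy.
  have h1 : `|f x - f x'| <= e / 2.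
    apply: D; first by rewrite /Rplus/= in_itv/= x'0.
    by apply: lt_trans bx _; rewrite ltr_pdivrMr// ltr_pMr// ltr1n.
  have h2 : `|f x - f y| <= e / 2.
    apply: D; first by rewrite /Rplus/= in_itv/= y0.
    rewrite (splitr d) -(subrK x' x) -addrA; apply: le_lt_trans (ler_normD _ _) _.
    by apply: ltrD => //; exact: lt_trans xy id.
  rewrite (splitr e) (_ : f x' - f y = - (f x - f x') + (f x - f y)); last by ring.
  by apply: le_trans (ler_normD _ _) _; rewrite normrN lerD.
have /compact_near_coveringP cov := @segment_compact R 0 A.
have [d /= d0 D] := cov _ (0^'+) (fun d x => forall y, 0 <= x -> 0 <= y ->
  `|x - y| < d -> `|f x - f y| <= e) _ loc.
have d20 : 0 < d / 2 by rewrite divr_gt0.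
exists (d / 2) => // x y xA y0 xy; apply: (D (d / 2)) => //=.
- by rewrite sub0r normrN gtr0_norm// ltr_pdivrMr// ltr_pMr// ltr1n.
- by case/andP: xA.
Qed.

(** A Riemann-Stieltjes sum for [f] against [- dG]. It sees a density through finitely many tail
    values, so pointwise convergence of tails passes to it. *)
Definition step_sum (N : nat) (f : R -> R) (h : R) (G : R -> R) : R :=
  \sum_(k < N) f (k%:R * h) * (G (k%:R * h) - G (k.+1%:R * h)).

Lemma integrable_fg f g B : {within Rplus, continuous f} ->
  (forall x, 0 <= x -> `|f x| <= B) -> mu.-integrable Rplus (EFin \o g) ->
  mu.-integrable Rplus (EFin \o (fun x => f x * g x)).
Proof.
move=> cf fB ig.
have mg : measurable_fun Rplus g by move/measurable_int : (ig) => /measurable_EFinP.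
have mf : measurable_fun Rplus f.
  by apply: subspace_continuous_measurable_fun cf; exact: measurable_itv.
apply: (@le_integrable _ _ _ mu Rplus _ _ (fun x => B%:E * (g x)%:E)%E).
- exact: measurable_itv.
- by apply/measurable_EFinP; exact: measurable_funM.
- move=> x; rewrite /Rplus/= in_itv/= andbT => x0; rewrite lee_fin !normrM ler_wpM2r//.
  by rewrite (le_trans (fB x x0))// ler_norm.
- by apply: integrableZl => //; exact: measurable_itv.
Qed.

(** On each cell [f] is replaced by its left value, at the price of [e] times the mass of the cell;
    the mass beyond [N h] is weighted by the bound [B]. *)
Lemma step_sum_close f g B e h N :
  {within Rplus, continuous f} -> (forall x, 0 <= x -> `|f x| <= B) ->
  (forall x, 0 <= x -> 0 <= g x) -> mu.-integrable Rplus (EFin \o g) ->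
  0 < h -> (forall (k : nat) y, (k < N)%N -> k%:R * h <= y <= k.+1%:R * h ->
     `|f y - f (k%:R * h)| <= e) ->
  `|\int[mu]_(x in Rplus) (f x * g x) - step_sum N f h (tail g)| <=
  e * (tail g 0 - tail g (N%:R * h)) + B * tail g (N%:R * h).
Proof.
move=> cf fB g0 ig h0 osc.
pose q x := f x * g x.
have iq : mu.-integrable Rplus (EFin \o q) by exact: integrable_fg cf fB ig.
have kh k : 0 <= k%:R * h by rewrite mulr_ge0// ltW.
have part n : (n <= N)%N -> `|tail q 0 - tail q (n%:R * h) - step_sum n f h (tail g)| <=
    e * (tail g 0 - tail g (n%:R * h)).
  elim: n => [_|n IH nN].
    by rewrite /step_sum big_ord0 mul0r !subrr normr0 mulr0.
  have le : n%:R * h <= n.+1%:R * h by rewrite ler_pM2r// ler_nat.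
  rewrite /step_sum big_ord_recr/= -/(step_sum n f h (tail g)).
  set a := n%:R * h in IH le *; set b := n.+1%:R * h in le *.
  have a0 : 0 <= a by exact: kh.
  have sub : [set` `[a, b]] `<=` Rplus.
    by move=> x /=; rewrite /Rplus/= !in_itv/= andbT => /andP[ax _]; exact: le_trans ax.
  have mab : measurable ([set` `[a, b]] : set (measurableTypeR R)) by exact: measurable_itv.
  have iab (k : R -> R) : mu.-integrable Rplus (EFin \o k) -> mu.-integrable `[a, b] (EFin \o k).
    by move=> ik; apply: integrableS ik; [exact: measurable_itv|exact: measurable_itv|exact: sub].
  have ga : tail g a - tail g b = \int[mu]_(x in `[a, b]) g x.
    by rewrite (tail_split ig a0 le) addrK.
  have qa : tail q a - tail q b = \int[mu]_(x in `[a, b]) q x.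
    by rewrite (tail_split iq a0 le) addrK.
  have : `|tail q a - tail q b - f a * (tail g a - tail g b)| <= e * (tail g a - tail g b).
    rewrite qa ga -!RintegralZl//; [|exact: iab..].
    have ifa : mu.-integrable `[a, b] (EFin \o (fun x => f a * g x)).
      by apply: integrable_cstl => //; exact: iab.
    have iea : mu.-integrable `[a, b] (EFin \o (fun x => e * g x)).
      by apply: integrable_cstl => //; exact: iab.
    have idd := integrable_diff mab (iab _ iq) ifa.
    rewrite -RintegralB//; last exact: iab.
    apply: le_trans (le_normr_Rintegral mab idd) _.
    apply: le_Rintegral => //; first exact: (integrable_norm idd).
    move=> x; rewrite /= in_itv/= => /andP[ax xb].
    have gx : 0 <= g x by apply/g0/(le_trans a0).
    rewrite /q -mulrBl normrM (ger0_norm gx) ler_wpM2r//.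
    by apply: osc; [exact: nN|rewrite ax xb].
  have := IH (ltnW nN); rewrite (_ : tail q 0 - tail q b - (step_sum n f h (tail g) + f a * (tail g a - tail g b)) =
    (tail q 0 - tail q a - step_sum n f h (tail g)) + (tail q a - tail q b - f a * (tail g a - tail g b))); last by ring.
  move=> h1 h2; apply: le_trans (ler_normD _ _) _; apply: le_trans (lerD h1 h2) _.
  by rewrite le_eqVlt; apply/orP; left; apply/eqP; ring.
have tB : `|tail q (N%:R * h)| <= B * tail g (N%:R * h).
  have mN : measurable ([set` `[N%:R * h, +oo[] : set (measurableTypeR R)) by exact: measurable_itv.
  have sub : [set` `[N%:R * h, +oo[] `<=` Rplus.
    by move=> x /=; rewrite /Rplus/= !in_itv/= !andbT; exact: le_trans (kh N).
  have iN (k : R -> R) : mu.-integrable Rplus (EFin \o k) -> mu.-integrable `[N%:R * h, +oo[ (EFin \o k).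
    by move=> ik; apply: integrableS ik; [exact: measurable_itv|exact: measurable_itv|exact: sub].
  rewrite /tail; apply: le_trans (le_normr_Rintegral mN (iN _ iq)) _.
  rewrite -RintegralZl//; last exact: iN.
  apply: le_Rintegral => //.
  - exact: (integrable_norm (iN _ iq)).
  - by apply: integrable_cstl => //; exact: iN.
  - move=> x; rewrite /= in_itv/= andbT => Nx.
    have x0 : 0 <= x by exact: le_trans (kh N) Nx.
    by rewrite /q normrM (ger0_norm (g0 x x0)) ler_wpM2r ?g0// fB.
have := part N (leqnn N).
rewrite -[X in _ -> `|X - _| <= _]/(tail q 0).
rewrite (_ : tail q 0 - step_sum N f h (tail g) = (tail q 0 - tail q (N%:R * h) - step_sum N f h (tail g)) + tail q (N%:R * h)); last by ring.
by move=> h1; apply: le_trans (ler_normD _ _) _; exact: lerD.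
Qed.

Lemma cvg_step_sum f h N (T : Type) (Fi : set_system T) {FF : Filter Fi}
  (G : T -> R -> R) (G0 : R -> R) : 0 <= h ->
  (forall r, 0 <= r -> G t r @[t --> Fi] --> G0 r) ->
  step_sum N f h (G t) @[t --> Fi] --> step_sum N f h G0.
Proof.
move=> h0 cG; elim: N => [|N IH].
  rewrite /step_sum big_ord0; under eq_fun do rewrite big_ord0.
  exact: cvg_cst.
rewrite /step_sum big_ord_recr/=; under eq_fun do rewrite big_ord_recr/=.
apply: cvgD; first exact: IH.
by apply: cvgMr; apply: cvgB; apply: cG; rewrite mulr_ge0.
Qed.

End weak_limit.

Section initial_limit.
Context {R : realType}.
Local Notation mu := (@lebesgue_measure R).
Variables (j : R) (j0 : 0 < j) (rho : R -> R).
Hypothesis iu : integrable_umeas (of_dens rho).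
Implicit Types (f : R -> R) (t r x e : R).
Let u := of_dens rho.
Let phi r := F r u.
Let P : profile (F 0 u) phi. Proof. exact: profile_F. Qed.

Let phiE r : phi r = tail rho r.
Proof. by rewrite /phi F_tail mul0r add0r. Qed.

Lemma odd_ext_F_continuous r e : 0 <= r -> 0 < e -> exists2 d, 0 < d &
  forall y, `|y - r| < d -> `|odd_ext phi y - odd_ext phi r| <= e.
Proof.
have [_ _ ir] := iu; move=> r0 e0.
have [d d0 D] := tail_continuous ir r0 e0.
(* For [r > 0] the window stays inside the positive half-line; at [r = 0] the reflection has the
   same modulus on both sides. *)
exists (if r == 0 then d else Num.min d r).
  by case: (eqVneq r 0) => // rn0; rewrite lt_min d0 lt_neqAle eq_sym rn0.
move=> y yr; have yd : `|r - y| < d.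
  rewrite distrC; apply: lt_le_trans yr _; by case: ifP => // _; rewrite ge_min lexx.
rewrite (odd_ext_ge0 _ r0); have [y0|y0] := leP 0 y.
  by rewrite (odd_ext_ge0 _ y0) distrC !phiE; exact: D.
have r00 : r = 0.
  apply/eqP; case: (eqVneq r 0) yr => // rn0; rewrite lt_min => /andP[_].
  by rewrite ltr_norml; lra.
rewrite r00 /odd_ext (leNgt 0 y) y0/= !phiE (_ : 2 * _ - _ - _ = tail rho 0 - tail rho (- y)); last by ring.
rewrite -{1}r00; apply: D; first by rewrite oppr_ge0 ltW.
by rewrite r00 sub0r opprK; move: yd; rewrite r00 sub0r normrN.
Qed.

Lemma cvg_evol_initial r : 0 <= r -> evol j phi t r @[t --> 0^'+] --> phi r.
Proof.
move=> r0; apply/cvgrPdist_le => e e0.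
have e30 : 0 < e / 3 by rewrite divr_gt0.
have [d d0 D] := odd_ext_F_continuous r0 e30.
pose M := F 0 u; have M0 : 0 <= M.
  by have [p0 pp _] := P; rewrite /M -p0 pp.
(* Farther than [d] from [r] the oscillation is at most [2 M], hence at most [c |y - r|]; this is
   the modulus that [heat_flow_close] expects. *)
pose c := 2 * M / d; have c0 : 0 <= c by rewrite divr_ge0 ?mulr_ge0// ltW.
have c10 : 0 < c + 1 by rewrite ltr_wpDl.
pose s := e / 3 / (c + 1); have s0 : 0 < s by rewrite divr_gt0.
have osc y : `|odd_ext phi y - odd_ext phi r| <= e / 3 + c * `|y - r|.
  have [yr|yr] := ltP `|y - r| d.
    by apply: le_trans (D y yr) _; rewrite lerDl mulr_ge0.
  apply: (@le_trans _ _ (2 * M)).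
    have /andP[a1 a2] := odd_ext_bound y P; have /andP[b1 b2] := odd_ext_bound r P.
    by move: a1 a2 b1 b2; rewrite -/M ler_norml => *; apply/andP; split; lra.
  apply: (@le_trans _ _ (c * `|y - r|)); last by rewrite lerDr ltW.
  by rewrite /c -mulrA ler_peMr ?mulr_ge0// mulrC ler_pdivlMr// mul1r.
near=> t.
have t0 : 0 < t by near: t; exact: nbhs_right_gt.
have h1 := evol_near_heatF (ltW j0) t0 P r0.
have h2 := heat_flow_close t0 (bounded_odd_ext P) osc c0.
have jt : j * t <= e / 3.
  rewrite mulrC -ler_pdivlMr//; near: t; apply: nbhs_right_le; exact: divr_gt0.
have ct : c * Num.sqrt (2 * t) <= e / 3.
  apply: (@le_trans _ _ ((c + 1) * s)); last by rewrite /s mulrC divfK// gt_eqF.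
  apply: ler_pM => //; first by rewrite lerDl.
  rewrite -[leRHS](ger0_norm (ltW s0)) -sqrtr_sqr ler_wsqrtr//.
  rewrite mulrC -ler_pdivlMr//; near: t; apply: nbhs_right_le.
  by rewrite divr_gt0// exprn_gt0.
rewrite distrC (_ : _ - _ = (evol j phi t r - heatF t phi r) + (heatF t phi r - odd_ext phi r)); last first.
  by rewrite (odd_ext_ge0 _ r0); ring.
apply: le_trans (ler_normD _ _) _; apply: le_trans (lerD h1 h2) _.
by move: jt ct; lra.
Unshelve. all: by end_near.
Qed.

Let le_norm_three (a b c d e : R) : `|a - b| <= e / 8 + e / 12 ->
  `|c - d| <= e / 8 + 2 * (e / 12) -> `|b - d| <= e / 4 -> `|a - c| <= e.
Proof. by rewrite !ler_norml => ? ? ?; lra. Qed.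

(** Tails converge pointwise and the total mass is constant, so for small [t] little mass lies
    beyond a fixed [A]; below [A] step sums compare the integrals. *)
Lemma flow_weakly_to_initial : weakly_to_initial (flow j rho) rho.
Proof.
move=> f [cf [B fB]]; have [_ /= rho0 ir] := iu.
have B0 : 0 <= B by apply: le_trans (fB 0 (lexx 0)).
have tailS t r : 0 < t -> 0 <= r -> tail (flow j rho t) r = evol j phi t r.
  by move=> t0 r0; rewrite -(F_flow j0 iu t0 r0) F_tail mul0r add0r.
have tailc r : 0 <= r -> tail (flow j rho t) r @[t --> 0^'+] --> tail rho r.
  move=> r0; rewrite -phiE; apply: cvg_trans (cvg_evol_initial r0).
  apply: near_eq_cvg; near=> t; rewrite tailS//.
apply/cvgrPdist_le => e e0; rewrite /umeas_int/= mul0r add0r.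
set M := tail rho 0; have M0 : 0 <= M by exact: tail_ge0.
have M10 : 0 < M + 1 by rewrite ltr_wpDl.
have B10 : 0 < B + 1 by rewrite ltr_wpDl.
(* The budget: [e / 8] for the oscillation of [f] in each of the two integrals, [e / 12] for the
   tail of [rho] beyond [A] and twice that for the tail of the flow, [e / 4] between the step
   sums. *)
pose e1 := e / 8 / (M + 1); have e10 : 0 < e1 by rewrite !divr_gt0.
pose e2 := e / 12 / (B + 1); have e20 : 0 < e2 by rewrite !divr_gt0.
have e1M : e1 * M <= e / 8.
  rewrite /e1 -mulrA ger_pMr ?divr_gt0//.
  by rewrite mulrC ler_pdivrMr// mul1r lerDl.
have e2B : B * e2 <= e / 12.
  rewrite mulrC -[e2 * B]mulrA ger_pMr ?divr_gt0//.
  by rewrite mulrC ler_pdivrMr// mul1r lerDl.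
have [A' A'0 A'e] := tail_small rho0 ir e20.
pose A := A' + 1; have A0 : 0 < A by rewrite ltr_wpDl.
have Ae : tail rho A <= e2.
  apply: le_trans (ltW A'e); apply: tail_anti => //; by rewrite lerDl.
have [d d0 D] := @heine_cantor R f A e1 cf e10.
(* [N > A / d] makes the mesh [A / N] smaller than [d], with the last node exactly at [A]. *)
pose N := Num.bound (A / d).
have AdN : A / d < N%:R by apply: archi_boundP; rewrite divr_ge0// ltW.
have N0 : 0 < N%:R :> R by apply: le_lt_trans AdN; rewrite divr_ge0// ltW.
pose h := A / N%:R; have h0 : 0 < h by rewrite divr_gt0.
have Nh : N%:R * h = A by rewrite /h mulrC divfK// gt_eqF.
have hd : h < d by rewrite /h ltr_pdivrMr// mulrC -ltr_pdivrMr.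
have osc (k : nat) y : (k < N)%N -> k%:R * h <= y <= k.+1%:R * h ->
    `|f y - f (k%:R * h)| <= e1.
  move=> kN /andP[ky yk]; rewrite distrC.
  have kh0 : 0 <= k%:R * h by rewrite mulr_ge0// ltW.
  apply: D; first by rewrite kh0 -Nh ler_pM2r// ler_nat ltnW.
    exact: le_trans ky.
  rewrite distrC ger0_norm ?subr_ge0//; apply: le_lt_trans hd.
  by move: yk; rewrite -natr1 mulrDl mul1r lerBlDl.
have cs : step_sum N f h (tail (flow j rho t)) @[t --> 0^'+] --> step_sum N f h (tail rho).
  by apply: cvg_step_sum => //; exact: ltW.
have cA := tailc A (ltW A0).
have Ir := step_sum_close cf fB rho0 ir h0 osc.
near=> t.
have t0 : 0 < t by near: t; exact: nbhs_right_gt.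
have [_ /= s0 is_] := integrable_flow j0 iu t0.
have It := step_sum_close cf fB s0 is_ h0 osc.
have tM : tail (flow j rho t) 0 = M.
  by rewrite tailS//; have [-> _ _] := profile_evol (ltW j0) t0 P; rewrite -/(phi 0) phiE.
rewrite Nh -/M in Ir; rewrite Nh tM in It.
have c1 : `|step_sum N f h (tail rho) - step_sum N f h (tail (flow j rho t))| <= e / 4.
  near: t; move/cvgrPdist_le : cs; apply; exact: divr_gt0.
have c2 : `|tail rho A - tail (flow j rho t) A| <= e2.
  by near: t; move/cvgrPdist_le : cA; apply.
have tA0 := tail_ge0 rho0 (ltW A0).
have sA0 := tail_ge0 s0 (ltW A0).
have sA : tail (flow j rho t) A <= 2 * e2.
  by rewrite mulr_natl mulr2n (le_trans _ (lerD Ae c2))// -lerBlDl distrC ler_norm.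
have b1 : e1 * (M - tail rho A) + B * tail rho A <= e / 8 + e / 12.
  apply: lerD; last by apply: le_trans e2B; rewrite ler_wpM2l.
  by apply: le_trans e1M; rewrite ler_wpM2l// ?(ltW e10)// gerBl.
have b2 : e1 * (M - tail (flow j rho t) A) + B * tail (flow j rho t) A <= e / 8 + 2 * (e / 12).
  apply: lerD.
    by apply: le_trans e1M; rewrite ler_wpM2l// ?(ltW e10)// gerBl.
  apply: (@le_trans _ _ (B * (2 * e2))); first by rewrite ler_wpM2l.
  by rewrite mulrCA ler_wpM2l.
have := le_norm_three (le_trans Ir b1) (le_trans It b2) c1.
by rewrite add0r.
Unshelve. all: by end_near.
Qed.

End initial_limit.

Theorem theorem1p3 (R : realType) (j : R) (j_gt0 : 0 < j) :
  exists S : (R -> R) -> R -> R -> R,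
    (forall u : R -> R, initial_datum u ->
      [/\ separates_barriers j u (S u),
          (forall T : R -> R -> R, separates_barriers j u T ->
             forall t r, 0 < t -> 0 <= r -> T t r = S u t r)
        & weakly_to_initial (S u) u]) /\
    (forall u v : R -> R, initial_datum u -> initial_datum v ->
       U_le (of_dens u) (of_dens v) ->
       forall t, 0 < t -> U_le (of_dens (S u t)) (of_dens (S v t))).
Proof.
exists (flow j); split=> [u [Lu u0 _]|u v [Lu _ _] [Lv _ _] uv t t0 r r0].
  have iu := nonneg_Linf_L1_integrable Lu.
  split; first exact: separates_flow.
  - by move=> T HT t r; exact: flow_unique.
  - exact: flow_weakly_to_initial.
have iu := nonneg_Linf_L1_integrable Lu; have iv := nonneg_Linf_L1_integrable Lv.
rewrite [leLHS](F_flow j_gt0 iu t0 r0) [leRHS](F_flow j_gt0 iv t0 r0).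
exact (evol_mono (ltW j_gt0) t0 (profile_F iu) (profile_F iv) uv r0).
Qed.
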